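(* If $X$ is a compact weighted $2$-complex which satisfies the $2$-cell reduction hypothesis, then there is an algorithm which produces a finite presentation for any subgroup of $\pi_1X$ given by a finite set of generators.
   Context: Generators of a subgroup are given as closed based paths in $X^{(1)}$. Complexes and maps. All complexes are combinatorial $2$-complexes and all maps are combinatorial (each open cell maps homeomorphically onto an open cell; attaching maps are combinatorial after subdivision). A $2$-cell of $X$ is regarded as a map $R\to X$, $R$ a polygon, with $\partial R\to X$ the attaching map, assumed to be an immersion (locally injective). Spaces whose fundamental group is taken are connected. A path is a map from a subdivided interval or a single $0$-cell. A $1$-immersion is a map locally injective on the $1$-skeleton of its domain; a map is $\pi_1$-injective if it induces an injection on $\pi_1$. Sides and perimeter. A side of $X$ is a pair $(R,r)$ with $R$ a $2$-cell of $X$ and $r$ a $1$-cell of $\partial R$; it is present at the $1$-cell that is the image of $r$. For a map $\phi:Y\to X$ and a $1$-cell $y$ of $Y$, a side $(R,r)$ present at $\phi(y)$ is present at $y$ if there is a map $\rho:R\to Y$ with $\rho(r)=y$ and $\phi\circ\rho$ equal to $R\to X$; otherwise it is missing at $y$. A weighted $2$-complex is a $2$-complex $X$ with a nonnegative integer weight $\mathbf{Wt}((R,r))$ on each side such that $\sum_{(R,r)\text{ present at }x}\mathbf{Wt}((R,r))$ is finite for each $1$-cell $x$ and $\mathbf{Wt}(R)=\sum_r\mathbf{Wt}((R,r))>0$ for each $2$-cell $R$. The perimeter of $\phi:Y\to X$ is $\mathbf{P}(Y)=\sum_{y\in\mathrm{Edges}(Y)}\sum_{(R,r)\text{ missing at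 }y}\mathbf{Wt}((R,r))$; in particular this defines $\mathbf{P}(Q)$ for a path $Q\to X$. Packets. The exponent of $R\to X$ is the largest $n$ such that $\partial R\to X$ can be expressed as $W^n$ with $W$ a closed path in $X$. The packet $\widetilde R$ is $\partial R$ with $n$ copies of $R$ attached, the $j$-th via rotation of $\partial R$ by $j|W|$ edges ($0\le j<n$), with induced map $\widetilde R\to X$ extending $R\to X$ and sending each copy of $R$ to $X$ by $R\to X$. A map $\phi:Y\to X$ is packed if whenever $R\to X$ lifts to $R\to Y$, $\widetilde R\to X$ lifts to a map $\widetilde R\to Y$ extending it. $2$-cell reduction hypothesis. For a packed map $Y\to X$ and a $2$-cell $R\to X$, a $2$-cell attachment site is a pair of paths $R\leftarrow Q\to Y$ with $Q$ a subpath of $\partial R$, the two compositions $Q\to X$ (through $R$ and through $Y$) equal, and such that there is no lift $R\to\widetilde R\to Y$ of $R\to\widetilde R\to X$ whose composition with $Q\to R$ equals $Q\to Y$. It is a $2$-cell perimeter reduction if $\mathbf{P}(\widetilde R)<\mathbf{P}(Q)$. $X$ satisfies the $2$-cell reduction hypothesis if for every packed $1$-immersion $Y\to X$ which is not $\pi_1$-injective there exist a $2$-cell $R\to X$ and a $2$-cell perimeter reduction $R\leftarrow Q\to Y$. *)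

(* Defs.v *)
From mathcomp Require Import all_boot all_order all_algebra.
From Stdlib Require Import Relation_Operators.
From mathcomp Require Import boolp classical_sets functions cardinality fsbigop.

Set Implicit Arguments.
Unset Strict Implicit.
Unset Printing Implicit Defensive.

Import GRing.Theory.

Local Open Scope classical_set_scope.

(** * Combinatorial 2-complexes

    The 1-cells carry an arbitrary reference orientation; a dart [(e, b)] is the
    1-cell [e] with a direction, against the reference one when [b = true].
    The boundary circle of a 2-cell [f] is subdivided into [(degm1 f).+1] sides,
    indexed cyclically by ['I_(degm1 f).+1]: side [i] runs from corner [i] to
    corner [ordS i], and [bd f i] is the dart it is mapped to.  Hence a 2-cell
    comes with a parametrisation by a polygon, i.e. with the map R -> X. *)

Definition dartT (E : Type) : Type := (E * bool)%type.
Definition dflip E (d : dartT E) : dartT E := (d.1, ~~ d.2).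
Definition dturn E (b : bool) (d : dartT E) : dartT E := (d.1, b (+) d.2).
Definition dfrom E V (s t : E -> V) (d : dartT E) : V :=
  if d.2 then t d.1 else s d.1.

Record complex := Complex {
  vert : choiceType;
  edge : choiceType;
  face : choiceType;
  esrc : edge -> vert;
  etgt : edge -> vert;
  degm1 : face -> nat;
  bd : forall f : face, 'I_(degm1 f).+1 -> dartT edge;
  bd_closed : forall f (i : 'I_(degm1 f).+1),
    dfrom esrc etgt (bd (ordS i)) = dfrom esrc etgt (dflip (bd i));
  (* the attaching map is locally injective at every corner *)
  bd_immersed : forall f (i : 'I_(degm1 f).+1), bd (ordS i) <> dflip (bd i) }.

Arguments bd {c} f i.

Definition dart (X : complex) := (edge X * bool)%type.
Definition dsrc (X : complex) (d : dart X) : vert X := dfrom (@esrc X) (@etgt X) d.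
Definition dtgt (X : complex) (d : dart X) : vert X := dsrc (dflip d).
Definition deg (X : complex) (f : face X) : nat := (degm1 f).+1.

(** * Combinatorial maps

    A 1-cell goes to a dart.  A 2-cell [f] goes to the 2-cell [fmap f] by an
    isomorphism of polygons: side [i] goes to side [fside i], and [fori f = true]
    when the isomorphism reverses the cyclic order (for polygons with one or two
    sides this is not determined by [fside]). *)

Definition dmap_of (E E' : Type) (h : E -> dartT E') (d : dartT E) : dartT E' :=
  dturn d.2 (h d.1).

Record cmap (Y X : complex) := CMap {
  vmap : vert Y -> vert X;
  emap : edge Y -> dart X;
  fmap : face Y -> face X;
  fori : face Y -> bool;
  fside : forall f : face Y, 'I_(degm1 f).+1 -> 'I_(degm1 (fmap f)).+1;
  vmap_src : forall d : dart Y, vmap (dsrc d) = dsrc (dmap_of emap d);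
  fside_bij : forall f, bijective (@fside f);
  fside_cyc : forall f (i : 'I_(degm1 f).+1),
    if fori f then ordS (fside (ordS i)) = fside i
    else fside (ordS i) = ordS (fside i);
  fside_bd : forall f (i : 'I_(degm1 f).+1),
    dmap_of emap (bd f i) = dturn (fori f) (bd (fmap f) (fside i)) }.

Arguments fside {Y X} c f i.

Definition dmap (Y X : complex) (phi : cmap Y X) : dart Y -> dart X :=
  dmap_of (emap phi).

Record ceq (Y X : complex) (phi psi : cmap Y X) : Prop := Ceq {
  ceq_v : forall v, vmap phi v = vmap psi v;
  ceq_e : forall e, emap phi e = emap psi e;
  ceq_f : forall f, fmap phi f = fmap psi f;
  ceq_o : forall f, fori phi f = fori psi f;
  ceq_s : forall f i, fside phi f i = fside psi f i :> nat }.

Section Comp.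
Variables (Z Y X : complex) (phi : cmap Y X) (rho : cmap Z Y).

Let emapc (e : edge Z) : dart X := dmap phi (emap rho e).
Let fsidec (f : face Z) (i : 'I_(degm1 f).+1) :
  'I_(degm1 (fmap phi (fmap rho f))).+1 := fside phi _ (fside rho f i).

Lemma dturnA E a b (d : dartT E) : dturn a (dturn b d) = dturn (a (+) b) d.
Proof. by case: d => e c; rewrite /dturn /= addbA. Qed.

Lemma dmap_turn b (d : dart Y) : dmap phi (dturn b d) = dturn b (dmap phi d).
Proof. by rewrite /dmap /dmap_of /= dturnA. Qed.

Lemma dmap_comp (d : dart Z) : dmap_of emapc d = dmap phi (dmap rho d).
Proof. by rewrite [dmap rho d]/dmap /dmap_of dmap_turn. Qed.

Fact comp_src (d : dart Z) :
  vmap phi (vmap rho (dsrc d)) = dsrc (dmap_of emapc d).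
Proof. by rewrite dmap_comp !vmap_src. Qed.

Fact comp_bij f : bijective (@fsidec f).
Proof. exact: bij_comp (fside_bij phi _) (fside_bij rho f). Qed.

Fact comp_cyc f (i : 'I_(degm1 f).+1) :
  if fori phi (fmap rho f) (+) fori rho f
  then ordS (fsidec (ordS i)) = fsidec i
  else fsidec (ordS i) = ordS (fsidec i).
Proof.
have := fside_cyc rho i; rewrite /fsidec.
case: (fori rho f) => Hr.
  have := fside_cyc phi (fside rho f (ordS i)); rewrite Hr.
  by case: (fori phi _) => /= ->.
have := fside_cyc phi (fside rho f i); rewrite -Hr.
by case: (fori phi _).
Qed.

Fact comp_bd f (i : 'I_(degm1 f).+1) :
  dmap_of emapc (bd f i) =
  dturn (fori phi (fmap rho f) (+) fori rho f)
        (bd (fmap phi (fmap rho f)) (fsidec i)).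
Proof.
rewrite dmap_comp [dmap rho _]fside_bd dmap_turn [dmap phi _]fside_bd dturnA.
by rewrite addbC.
Qed.

Definition ccomp : cmap Z X :=
  @CMap Z X (fun v => vmap phi (vmap rho v)) emapc _ _ _
    comp_src comp_bij comp_cyc comp_bd.
End Comp.

(** * Paths, polygons, packets *)

Section PathComplex.
Variable m : nat.
Let src (i : 'I_m) : 'I_m.+1 := widen_ord (leqnSn m) i.
Let tgt (i : 'I_m) : 'I_m.+1 := lift ord0 i.
Let nobd (f : void) : 'I_1 -> dartT 'I_m := match f with end.
Fact path_closed (f : void) i :
  dfrom src tgt (nobd f (ordS i)) = dfrom src tgt (dflip (nobd f i)).
Proof. by case: f. Qed.
Fact path_immersed (f : void) i : nobd f (ordS i) <> dflip (nobd f i).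
Proof. by case: f. Qed.

(* the interval with [m] edges; a single 0-cell for [m = 0] *)
Definition interval : complex :=
  @Complex 'I_m.+1 'I_m void src tgt (fun=> 0) nobd path_closed path_immersed.
End PathComplex.

Lemma ordS_add n (i a : 'I_n.+1) : ordS (i + a)%R = (ordS i + a)%R.
Proof.
apply: val_inj => /=.
by rewrite -addn1 modnDml modnDml addn1 addSn.
Qed.

Section Wheel.
Variables (n : nat) (J : choiceType) (a : J -> 'I_n.+1).
Let src (i : 'I_n.+1) := i.
Let tgt (i : 'I_n.+1) := ordS i.
Let wbd (j : J) (i : 'I_n.+1) : dartT 'I_n.+1 := ((i + a j)%R, false).
Fact wheel_closed (j : J) i :
  dfrom src tgt (wbd j (ordS i)) = dfrom src tgt (dflip (wbd j i)).
Proof. by rewrite /dfrom /= /src /tgt ordS_add. Qed.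
Fact wheel_immersed (j : J) i : wbd j (ordS i) <> dflip (wbd j i).
Proof. by []. Qed.

(* a circle with [n.+1] edges and discs [j : J] attached via rotation by [a j] *)
Definition wheel : complex :=
  @Complex 'I_n.+1 'I_n.+1 J src tgt (fun=> n) wbd wheel_closed wheel_immersed.
End Wheel.

Definition polygon (n : nat) : complex := @wheel n unit (fun=> 0%R).

Section Walks.
Variable X : complex.

Fixpoint walk (u : vert X) (s : seq (dart X)) (v : vert X) : bool :=
  if s is d :: s' then (dsrc d == u) && walk (dtgt d) s' v else u == v.

Definition bdpath (f : face X) : seq (dart X) := codom (bd f).

Definition is_bd_power (f : face X) (n : nat) : Prop :=
  exists W u, walk u W u /\ bdpath f = flatten (nseq n W).

(* since the degree is positive, any such [n] is at most the degree *)
Definition exponent (f : face X) : nat :=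
  \max_(n < (deg f).+1 | `[< is_bd_power f n >]) n.

Definition period (f : face X) : nat := deg f %/ exponent f.

Lemma size_bdpath f : size (bdpath f) = deg f.
Proof. by rewrite size_codom card_ord. Qed.

Lemma bd_power1 f : is_bd_power f 1.
Proof.
exists (bdpath f), (dsrc (bd f ord0)); split; last by rewrite /= cats0.
have step (i : 'I_(degm1 f).+1) : dtgt (bd f i) = dsrc (bd f (ordS i)).
  by rewrite /dtgt /dsrc bd_closed.
have gen k m (i0 : 'I_(degm1 f).+1) : i0 = k :> nat -> k + m = (degm1 f).+1 ->
   walk (dsrc (bd f i0)) [seq bd f (inord i) | i <- iota k m] (dsrc (bd f ord0)).
  elim: m k i0 => [|m IH] k i0 i0k /= km.
    by move: (ltn_ord i0); rewrite i0k -km addn0 ltnn.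
  have -> : inord k = i0 by rewrite -i0k inord_val.
  rewrite eqxx /= step.
  case: m IH km => [|m] IH km.
    have -> : ordS i0 = ord0; last by rewrite /= eqxx.
    by apply: val_inj => /=; rewrite i0k -km addn1 modnn.
  apply: IH; last by rewrite addSnnS.
  by rewrite /= i0k modn_small // -km !addnS !ltnS leq_addr.
have -> : bdpath f = [seq bd f (inord i) | i <- iota 0 (degm1 f).+1].
  rewrite /bdpath codomE -val_enum_ord -map_comp; apply: eq_map => i /=.
  by rewrite inord_val.
exact: gen.
Qed.

Lemma bd_power_exponent f : is_bd_power f (exponent f).
Proof.
have h1 : 1 < (deg f).+1 by [].
have P1 : `[< is_bd_power f (Ordinal h1) >] by apply/asboolP; exact: bd_power1.
rewrite /exponent (bigop.bigmax_eq_arg _ P1).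
by case: arg_maxnP => // i /asboolP.
Qed.

Lemma exponent_gt0 f : 0 < exponent f.
Proof.
have [W [u [_ E]]] := bd_power_exponent f.
by case: (exponent f) E => // E; move: (size_bdpath f); rewrite E.
Qed.

Lemma bd_period f (i : 'I_(degm1 f).+1) j :
  bd f (i + inZp (j * period f))%R = bd f i.
Proof.
have [W [u [_ E]]] := bd_power_exponent f.
have szE : deg f = exponent f * size W.
  rewrite -size_bdpath E size_flatten /shape map_nseq sumn_nseq mulnC //.
have pE : period f = size W by rewrite /period szE mulKn // exponent_gt0.
have W0 : 0 < size W by move: (erefl (deg f)); rewrite {1}szE; case: size;
  rewrite ?muln0.
set x0 := bd f ord0.
have nthE (k : 'I_(degm1 f).+1) : bd f k = nth x0 W (k %% size W).
  have -> : bd f k = nth x0 (bdpath f) k.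
    rewrite /bdpath codomE (nth_map ord0) ?size_enum_ord ?ltn_ord //.
    by rewrite nth_ord_enum.
  rewrite E.
  have : k < exponent f * size W by rewrite -szE ltn_ord.
  move: (val k) => {}k; elim: (exponent f) k => [|e IH] k //= lt.
  rewrite nth_cat; case: ltnP => [h|h]; first by rewrite modn_small.
  rewrite IH; last by rewrite ltn_subLR // -mulSn.
  by rewrite -{2}(subnK h) modnDr.
rewrite !nthE /= pE; congr nth.
have dvd : size W %| (degm1 f).+1 by rewrite -/(deg f) szE dvdn_mull.
by rewrite modn_dvdm // -modnDmr modn_dvdm // modnMl addn0.
Qed.

(** The map R -> X, the packet and its map to X. *)

Section Cell.
Variable f : face X.
Let n := degm1 f.

Section WheelMap.
Variables (J : choiceType) (a : J -> 'I_n.+1).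
Hypothesis Ha : forall j i, bd f (i + a j)%R = bd f i.
Let K := @wheel n J a.
Let vm (i : vert K) : vert X := dsrc (bd f i).
Let fm (_ : face K) : face X := f.
Let fs (j : face K) (i : 'I_n.+1) : 'I_n.+1 := i.
Fact wm_src (d : dart K) : vm (dsrc d) = dsrc (dmap_of (bd f : edge K -> dart X) d).
Proof.
case: d => i []; rewrite /dmap_of /dturn /vm /dsrc.
  exact: bd_closed.
by rewrite /= -surjective_pairing.
Qed.
Fact wm_bij (j : face K) : bijective (@fs j).
Proof. by exists id. Qed.
Fact wm_cyc (j : face K) (i : 'I_n.+1) :
  if false then ordS (fs j (ordS i)) = fs j i else fs j (ordS i) = ordS (fs j i).
Proof. by []. Qed.
Fact wm_bd (j : face K) (i : 'I_n.+1) :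
  dmap_of (bd f : edge K -> dart X) (@bd K j i) = dturn false (bd (fm j) (fs j i)).
Proof. by rewrite /dmap_of /= Ha. Qed.
Definition wheel_map : cmap K X :=
  @CMap K X vm (bd f) fm (fun=> false) fs wm_src wm_bij wm_cyc wm_bd.
End WheelMap.

Definition cell : complex := polygon n.

Fact cell_rot (j : unit) i : bd f (i + (0%R : 'I_n.+1))%R = bd f i.
Proof. by rewrite addr0. Qed.

Definition cell_map : cmap cell X := @wheel_map unit (fun=> 0%R) cell_rot.

Definition packet_rot (j : 'I_(exponent f)) : 'I_n.+1 := inZp (j * period f).

Definition packet : complex := wheel packet_rot.

Fact packet_rotP j i : bd f (i + packet_rot j)%R = bd f i.
Proof. exact: bd_period. Qed.

Definition packet_map : cmap packet X := wheel_map packet_rotP.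

(* the inclusion of R in its packet as the copy of index 0 *)
Let cv (v : vert cell) : vert packet := v.
Let ce (e : edge cell) : dart packet := (e, false).
Let cf (_ : face cell) : face packet := Ordinal (exponent_gt0 f).
Let cs (g : face cell) (i : 'I_n.+1) : 'I_n.+1 := i.
Fact ci_src (d : dart cell) : cv (dsrc d) = dsrc (dmap_of ce d).
Proof. by case: d => i []. Qed.
Fact ci_bij (g : face cell) : bijective (@cs g).
Proof. by exists id. Qed.
Fact ci_cyc (g : face cell) (i : 'I_n.+1) :
  if false then ordS (cs g (ordS i)) = cs g i else cs g (ordS i) = ordS (cs g i).
Proof. by []. Qed.
Fact ci_bd (g : face cell) (i : 'I_n.+1) :
  dmap_of ce (@bd cell g i) = dturn false (@bd packet (cf g) (cs g i)).
Proof.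
rewrite /dmap_of /dturn /= /packet_rot /= mul0n addr0.
by congr (_, _); apply: val_inj; rewrite /= mod0n addn0 modn_small.
Qed.
Definition cell_incl : cmap cell packet :=
  @CMap cell packet cv ce cf (fun=> false) cs ci_src ci_bij ci_cyc ci_bd.

(* the subpath of the boundary of R made of the [m] sides [i], [i + 1], ... *)
Section Subpath.
Variables (i : 'I_n.+1) (m : nat).
Let sv (k : vert (interval m)) : vert cell := (i + inZp k)%R.
Let se (k : edge (interval m)) : dart cell := ((i + inZp k)%R, false).
Let sf (g : face (interval m)) : face cell := match g with end.
Let ss (g : face (interval m)) (k : 'I_(degm1 g).+1) : 'I_(degm1 (sf g)).+1 :=
  match g with end.
Fact sp_src (d : dart (interval m)) : sv (dsrc d) = dsrc (dmap_of se d).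
Proof.
case: d => k [] //=; rewrite /sv /dsrc /dfrom /=.
have -> : inZp (bump 0 k) = ordS (inZp k) :> 'I_n.+1.
  by apply: val_inj; rewrite /= /bump leq0n -[(_ %% _).+1]addn1 modnDml addnC.
by rewrite addrC -ordS_add addrC.
Qed.
Fact sp_bij (g : face (interval m)) : bijective (@ss g).
Proof. by case: g. Qed.
Fact sp_cyc (g : face (interval m)) (k : 'I_(degm1 g).+1) :
  if false then ordS (ss (ordS k)) = ss k else ss (ordS k) = ordS (ss k).
Proof. by case: g k. Qed.
Fact sp_bd (g : face (interval m)) (k : 'I_(degm1 g).+1) :
  dmap_of se (bd g k) = dturn false (bd (sf g) (ss k)).
Proof. by case: g k. Qed.
Definition subpath : cmap (interval m) cell :=
  @CMap (interval m) cell sv se sf (fun=> false) ss sp_src sp_bij sp_cyc sp_bd.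
End Subpath.
End Cell.
End Walks.

(** * Sides, weights and perimeter *)

Definition side (X : complex) := {f : face X & 'I_(degm1 f).+1}.

Definition present_at (X : complex) (x : edge X) (s : side X) : Prop :=
  (bd (tag s) (tagged s)).1 = x.

Definition present_along (Y X : complex) (phi : cmap Y X) (y : edge Y)
    (s : side X) : Prop :=
  exists rho : cmap (cell (tag s)) Y,
    (emap rho (tagged s : edge (cell (tag s)))).1 = y /\
    ceq (ccomp phi rho) (cell_map (tag s)).

Definition missing_along (Y X : complex) (phi : cmap Y X) (y : edge Y)
    (s : side X) : Prop :=
  present_at (emap phi y).1 s /\ ~ present_along phi y s.

(* a sum of natural numbers is finite when it has finitely many nonzero terms *)
Record weighting (X : complex) := Weighting {
  wt : side X -> nat;
  wt_finite : forall x : edge X,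
    finite_set [set s | present_at x s /\ 0 < wt s];
  wt_pos : forall f : face X,
    0 < \sum_(r < (degm1 f).+1) wt (Tagged (fun f => 'I_(degm1 f).+1) r) }.

(* [\big[addn/0]_(i \in A)] is 0 when infinitely many terms are nonzero, so this
   is the perimeter only for domains of finite perimeter; it is used below for
   packets and paths, which have finitely many 1-cells. *)
Definition perimeter (X : complex) (w : weighting X) (Y : complex)
    (phi : cmap Y X) : nat :=
  \big[addn/0]_(y \in [set: edge Y])
    \big[addn/0]_(s \in missing_along phi y) wt w s.

(** * Homotopy of edge paths, subgroups of the fundamental group

    Elements of pi_1(X, x0) are represented by the closed edge paths at [x0],
    equality being [homotopic x0 x0]. *)

Inductive hstep (X : complex) (u v : vert X) :
    seq (dart X) -> seq (dart X) -> Prop :=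
| HBacktrack s1 d s2 : walk u (s1 ++ [:: d; dflip d] ++ s2) v ->
    hstep u v (s1 ++ [:: d; dflip d] ++ s2) (s1 ++ s2)
| HCell s1 f s2 : walk u (s1 ++ bdpath f ++ s2) v ->
    hstep u v (s1 ++ bdpath f ++ s2) (s1 ++ s2).

Definition homotopic (X : complex) (u v : vert X) :=
  Relation_Operators.clos_refl_sym_trans _ (hstep u v).

Definition connected (X : complex) : Prop :=
  inhabited (vert X) /\ forall u v : vert X, exists s, walk u s v.

Definition pi1_injective (Y X : complex) (phi : cmap Y X) : Prop :=
  forall (y : vert Y) (s1 s2 : seq (dart Y)), walk y s1 y -> walk y s2 y ->
    homotopic (vmap phi y) (vmap phi y) (map (dmap phi) s1) (map (dmap phi) s2) ->
    homotopic y y s1 s2.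

Definition compact_complex (X : complex) : Prop :=
  [/\ finite_set [set: vert X], finite_set [set: edge X]
    & finite_set [set: face X]].

(** * The 2-cell reduction hypothesis *)

Definition immersion1 (Y X : complex) (phi : cmap Y X) : Prop :=
  forall d1 d2 : dart Y, dsrc d1 = dsrc d2 -> dmap phi d1 = dmap phi d2 -> d1 = d2.

Definition packed (Y X : complex) (phi : cmap Y X) : Prop :=
  forall (f : face X) (rho : cmap (cell f) Y),
    ceq (ccomp phi rho) (cell_map f) ->
    exists sigma : cmap (packet f) Y,
      ceq (ccomp phi sigma) (packet_map f) /\ ceq (ccomp sigma (cell_incl f)) rho.

(* [Q] is the path of [m] edges along the boundary of [f] from corner [i] *)
Definition attachment_site (Y X : complex) (phi : cmap Y X) (f : face X)
    (i : 'I_(degm1 f).+1) (m : nat) (q : cmap (interval m) Y) : Prop :=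
  [/\ m <= deg f,
      ceq (ccomp phi q) (ccomp (cell_map f) (subpath i m))
    & ~ exists sigma : cmap (packet f) Y,
        ceq (ccomp phi sigma) (packet_map f) /\
        ceq (ccomp (ccomp sigma (cell_incl f)) (subpath i m)) q].

Definition perimeter_reduction (X : complex) (w : weighting X) (Y : complex)
    (phi : cmap Y X) (f : face X) (i : 'I_(degm1 f).+1) (m : nat)
    (q : cmap (interval m) Y) : Prop :=
  attachment_site phi i q /\
  perimeter w (packet_map f) < perimeter w (ccomp (cell_map f) (subpath i m)).

Definition reduction_hypothesis (X : complex) (w : weighting X) : Prop :=
  forall (Y : complex) (phi : cmap Y X),
    connected Y -> packed phi -> immersion1 phi -> ~ pi1_injective phi ->
    exists (f : face X) (i : 'I_(degm1 f).+1) (m : nat) (q : cmap (interval m) Y),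
      perimeter_reduction w phi i q.

(** * Finite presentations *)

(* the letter [(i, b)] is the [i]-th generator, inverted when [b = true] *)
Definition word (n : nat) := seq ('I_n * bool).

Record fin_pres := FinPres { ngen : nat; relators : seq (word ngen) }.

Inductive wstep (P : fin_pres) : word (ngen P) -> word (ngen P) -> Prop :=
| WCancel w1 x w2 : wstep (w1 ++ [:: x; dflip x] ++ w2) (w1 ++ w2)
| WRelator w1 r w2 : r \in relators P -> wstep (w1 ++ r ++ w2) (w1 ++ w2).

(* equality in the group presented by [P] *)
Definition pres_eq (P : fin_pres) :=
  Relation_Operators.clos_refl_sym_trans _ (@wstep P).

Definition inv_path (X : complex) (s : seq (dart X)) : seq (dart X) :=
  rev (map (@dflip _) s).

Definition eval_word (X : complex) (n : nat) (th : 'I_n -> seq (dart X))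
    (a : word n) : seq (dart X) :=
  flatten [seq if x.2 then inv_path (th x.1) else th x.1 | x <- a].

(* the closed paths at [x0] whose class is in the subgroup generated by [gens] *)
Definition subgroup_gen (X : complex) (x0 : vert X) (gens : seq (seq (dart X))) :
    set (seq (dart X)) :=
  [set l | walk x0 l x0 /\ exists a : word (size gens),
     homotopic x0 x0 l (eval_word (tnth (in_tuple gens)) a)].

(* [th] induces an isomorphism from the group presented by [P] onto [H] *)
Definition presents (X : complex) (x0 : vert X) (P : fin_pres)
    (H : set (seq (dart X))) : Prop :=
  exists th : 'I_(ngen P) -> seq (dart X),
    [/\ forall i, walk x0 (th i) x0,
        forall a b : word (ngen P),
          pres_eq a b <-> homotopic x0 x0 (eval_word th a) (eval_word th b)
      & forall l, H l <->
          walk x0 l x0 /\ exists a, homotopic x0 x0 l (eval_word th a)].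

(** * Algorithms: Kleene's partial recursive functions *)

Inductive recfun :=
| RZero | RSucc | RProj of nat
| RComp of recfun & seq recfun
| RPrim of recfun & recfun
| RMu of recfun.

(* [reval p xs y]: the program [p] halts on the arguments [xs] with result [y] *)
Inductive reval : recfun -> seq nat -> nat -> Prop :=
| EZero xs : reval RZero xs 0
| ESucc x xs : reval RSucc (x :: xs) x.+1
| EProj i xs : i < size xs -> reval (RProj i) xs (nth 0 xs i)
| EComp p ps xs ys y : revals ps xs ys -> reval p ys y ->
    reval (RComp p ps) xs y
| EPrim0 p q xs y : reval p xs y -> reval (RPrim p q) (0 :: xs) y
| EPrimS p q n xs r y : reval (RPrim p q) (n :: xs) r ->
    reval q [:: n, r & xs] y -> reval (RPrim p q) (n.+1 :: xs) y
| EMu p xs n : reval p (n :: xs) 0 ->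
    (forall m, m < n -> exists k, reval p (m :: xs) k.+1) -> reval (RMu p) xs n
with revals : seq recfun -> seq nat -> seq nat -> Prop :=
| ENil xs : revals [::] xs [::]
| ECons p ps xs y ys : reval p xs y -> revals ps xs ys ->
    revals (p :: ps) xs (y :: ys).

(** Goedel numbers, relative to a numbering [num] of the 1-cells. *)

Definition code_letter (x : nat * bool) : nat := x.1.*2 + x.2.

Definition code_path (X : complex) (num : edge X -> nat) (s : seq (dart X)) : nat :=
  CodeSeq.code [seq code_letter (num d.1, d.2) | d <- s].

Definition code_gens (X : complex) (num : edge X -> nat)
    (gens : seq (seq (dart X))) : nat :=
  CodeSeq.code (map (code_path num) gens).

Definition code_word (n : nat) (a : word n) : nat :=
  CodeSeq.code [seq code_letter (nat_of_ord x.1, x.2) | x : 'I_n * bool <- a].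

Definition code_pres (P : fin_pres) : nat :=
  CodeSeq.code (ngen P :: map (@code_word (ngen P)) (relators P)).

(* Main.v *)
Require Import Defs.
From mathcomp Require Import all_boot all_algebra.
From Stdlib Require Import Relation_Operators.
From mathcomp Require Import boolp classical_sets cardinality fsbigop.
From mathcomp Require Import zify.

(** Let H be the subgroup generated by the given closed paths.  It is presented on the
    given generators themselves, so that only the relators have to be found: words in
    the generators, trivial in the fundamental group of X, of which all such words are
    consequences.  The algorithm searches for a finite certificate that a list of
    relators is complete.

    A certificate is a finite graph immersed in the 1-skeleton of X, with edges labelled
    by words in the generators, in which the generators can be read as closed paths at
    the state 0 and which is closed under reductions: if a subpath Q of the boundary of
    a 2-cell R, with P(packet of R) < P(Q), can be read from a state, then the whole
    boundary of R is closed at that state.  The relators are the labels along the closed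
    boundaries of 2-cells, and the equalities between a generator and the label along
    it; the certificate contains derivations showing that they are trivial in X.

    Soundness ([certificate_sound]).  Attach to the graph all the 2-cells whose boundary
    is closed in it.  The resulting complex Y -> X is a packed 1-immersion without
    2-cell perimeter reductions, so that it is injective on fundamental groups by the
    reduction hypothesis ([full_pi1_injective]).  If a word in the generators is trivial
    in X, its evaluation lifts to a closed path of Y, which is trivial in Y; reading
    labels maps homotopies of Y to consequences of the relators, and gives back the
    word.

    Existence ([certificate_exists]).  Every H has a certificate.  In the 1-skeleton of
    the covering space of X with group H, start from the edges of the lifts of the
    generators, and attach the lift of the boundary of R whenever a reducing subpath Q
    of it is present but the whole is not.  The perimeter drops each time
    ([attach_perim]), so this ends with a finite graph closed under reductions.  An edge
    of the covering space, together with paths from the base vertex to its ends, is an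
    element of H, which gives the labels.

    The reducing triples of X form a finite list which the program contains as a
    constant, and checking a certificate is computable ([computable_check]), so an
    unbounded search finds one ([certificate_search]). *)

Set Implicit Arguments.
Unset Strict Implicit.
Unset Printing Implicit Defensive.

Import GRing.Theory.

(** * Kleene programs *)

(** The arity is fixed because [RProj i] halts only on long enough argument lists. *)
Definition compn (n : nat) (f : seq nat -> nat) : Prop :=
  exists p, forall xs, size xs = n -> reval p xs (f xs).

Lemma compn_ext n f g :
  (forall xs, size xs = n -> f xs = g xs) -> compn n f -> compn n g.
Proof. by move=> fg [p Hp]; exists p => xs sz; rewrite -fg //; apply: Hp. Qed.

Lemma compn_zero n : compn n (fun=> 0).
Proof. by exists RZero => xs _; constructor. Qed.

Lemma compn_proj n i : i < n -> compn n (nth 0 ^~ i).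
Proof. by move=> lin; exists (RProj i) => xs sz; constructor; rewrite sz. Qed.

Lemma compn_comp1 n g f : compn 1 g -> compn n f -> compn n (fun xs => g [:: f xs]).
Proof.
move=> [q Hq] [p Hp]; exists (RComp q [:: p]) => xs sz.
apply: EComp (Hq _ _) => //.
by do ?[apply: ECons | apply: ENil]; apply: Hp.
Qed.

Lemma compn_comp2 n g f1 f2 :
  compn 2 g -> compn n f1 -> compn n f2 -> compn n (fun xs => g [:: f1 xs; f2 xs]).
Proof.
move=> [q Hq] [p1 H1] [p2 H2]; exists (RComp q [:: p1; p2]) => xs sz.
apply: EComp (Hq _ _) => //.
by do ?[apply: ECons | apply: ENil]; [apply: H1 | apply: H2].
Qed.

Lemma compn_succ n f : compn n f -> compn n (fun xs => (f xs).+1).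
Proof.
move=> [p Hp]; exists (RComp RSucc [:: p]) => xs sz.
apply: (@EComp _ _ _ [:: f xs]); last by constructor.
by do ?[apply: ECons | apply: ENil]; apply: Hp.
Qed.

Fixpoint primrec (f g : seq nat -> nat) (k : nat) (xs : seq nat) : nat :=
  if k is k'.+1 then g [:: k', primrec f g k' xs & xs] else f xs.

Lemma compn_primrec n f g :
  compn n f -> compn n.+2 g -> compn n.+1 (fun xs => primrec f g (head 0 xs) (behead xs)).
Proof.
move=> [p Hp] [q Hq]; exists (RPrim p q) => -[//|k xs] [sz] /=.
elim: k => [|k IH] /=; first by constructor; apply: Hp.
by apply: EPrimS IH _; apply: Hq => /=; rewrite sz.
Qed.

Lemma compn_mu n f h : compn n.+1 f ->
  (forall xs, size xs = n -> f (h xs :: xs) = 0) ->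
  (forall xs m, size xs = n -> m < h xs -> 0 < f (m :: xs)) -> compn n h.
Proof.
move=> [p Hp] h0 hpos; exists (RMu p) => xs sz; constructor.
  by rewrite -(h0 xs sz); apply: Hp; rewrite /= sz.
move=> m lt; exists (f (m :: xs)).-1; rewrite prednK; last exact: hpos.
by apply: Hp; rewrite /= sz.
Qed.

Lemma compn_add n f g : compn n f -> compn n g -> compn n (fun xs => f xs + g xs).
Proof.
move=> cf cg.
have H : compn 2 (fun xs => nth 0 xs 0 + nth 0 xs 1).
  have [] := @compn_primrec 1 (nth 0 ^~ 0) (fun xs => (nth 0 xs 1).+1).
  - exact: compn_proj.
  - by apply: compn_succ; apply: compn_proj.
  move=> p Hp; exists p => -[|x [|y []]] // sz.
  have <- : primrec (nth 0 ^~ 0) (fun xs => (nth 0 xs 1).+1) x [:: y] = x + y.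
    by elim: x {sz} => //= x ->.
  exact: Hp.
exact: compn_comp2 H cf cg.
Qed.

Lemma compn_mul n f g : compn n f -> compn n g -> compn n (fun xs => f xs * g xs).
Proof.
move=> cf cg.
have H : compn 2 (fun xs => nth 0 xs 0 * nth 0 xs 1).
  have [] := @compn_primrec 1 (fun=> 0) (fun xs => nth 0 xs 2 + nth 0 xs 1).
  - exact: compn_zero.
  - by apply: compn_add; apply: compn_proj.
  move=> p Hp; exists p => -[|x [|y []]] // sz.
  have <- : primrec (fun=> 0) (fun xs => nth 0 xs 2 + nth 0 xs 1) x [:: y] = x * y.
    by elim: x {sz} => //= x ->; rewrite mulSn.
  exact: Hp.
exact: compn_comp2 H cf cg.
Qed.

Lemma compn_sub n f g : compn n f -> compn n g -> compn n (fun xs => f xs - g xs).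
Proof.
move=> cf cg.
have P : compn 1 (fun xs => (nth 0 xs 0).-1).
  have [] := @compn_primrec 0 (fun=> 0) (nth 0 ^~ 0).
  - exact: compn_zero.
  - exact: compn_proj.
  move=> p Hp; exists p => -[|x []] // sz.
  have <- : primrec (fun=> 0) (nth 0 ^~ 0) x [::] = x.-1 by case: x {sz}.
  exact: Hp.
have H : compn 2 (fun xs => nth 0 xs 1 - nth 0 xs 0).
  have [] := @compn_primrec 1 (nth 0 ^~ 0) (fun xs => (nth 0 xs 1).-1).
  - exact: compn_proj.
  - by apply: (compn_comp1 P); apply: compn_proj.
  move=> p Hp; exists p => -[|x [|y []]] // sz.
  have <- : primrec (nth 0 ^~ 0) (fun xs => (nth 0 xs 1).-1) x [:: y] = y - x.
    by elim: x {sz} => [|x /= ->]; rewrite ?subn0 ?subnS.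
  exact: Hp.
exact: compn_comp2 H cg cf.
Qed.

Lemma compn_exp2 n f : compn n f -> compn n (fun xs => 2 ^ f xs).
Proof.
move=> cf.
have H : compn 1 (fun xs => 2 ^ nth 0 xs 0).
  have [] := @compn_primrec 0 (fun=> 1) (fun xs => nth 0 xs 1 + nth 0 xs 1).
  - by apply: compn_succ; apply: compn_zero.
  - by apply: compn_add; apply: compn_proj.
  move=> p Hp; exists p => -[|x []] // sz.
  have <- : primrec (fun=> 1) (fun xs => nth 0 xs 1 + nth 0 xs 1) x [::] = 2 ^ x.
    by elim: x {sz} => //= x ->; rewrite addnn -mul2n expnS.
  exact: Hp.
exact: compn_comp1 H cf.
Qed.

(** The bijection [(a, b) |-> 2 ^ a * (2 * b + 1) - 1] underlies the numbering of
    sequences: the code of [a :: s] is one more than the pair of [a] and the code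
    of [s].  Its inverse is computed by minimisation, first of a quotient, then of
    the exponent of the first power of 2 which is not a divisor. *)
Definition npair (a b : nat) : nat := (2 ^ a * b.*2.+1).-1.

Lemma npairS a b : (npair a b).+1 = 2 ^ a * b.*2.+1.
Proof. by rewrite prednK // muln_gt0 expn_gt0. Qed.

Definition nfst (m : nat) : nat := head 0 (CodeSeq.decode m.+1).
Definition nsnd (m : nat) : nat := CodeSeq.code (behead (CodeSeq.decode m.+1)).

Lemma nfstK a b : nfst (npair a b) = a.
Proof.
by rewrite /nfst npairS -[b]CodeSeq.decodeK -[_ * _]/(CodeSeq.code (a :: _))
  CodeSeq.codeK.
Qed.

Lemma nsndK a b : nsnd (npair a b) = b.
Proof.
by rewrite /nsnd npairS -{1}[b]CodeSeq.decodeK -[_ * _]/(CodeSeq.code (a :: _))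
  CodeSeq.codeK /= CodeSeq.decodeK.
Qed.

Lemma npairK m : npair (nfst m) (nsnd m) = m.
Proof.
apply: succn_inj; rewrite npairS /nfst /nsnd -[RHS]CodeSeq.decodeK.
by case: (CodeSeq.decode _) (CodeSeq.decodeK m.+1).
Qed.

Lemma compn_npair n f g :
  compn n f -> compn n g -> compn n (fun xs => npair (f xs) (g xs)).
Proof.
move=> cf cg; apply: (@compn_ext _ (fun xs => 2 ^ f xs * (g xs + g xs).+1 - 1)).
  by move=> xs _; rewrite addnn subn1.
by apply: compn_sub; [apply: compn_mul; [apply: compn_exp2
  | apply/compn_succ/compn_add] | apply/compn_succ/compn_zero].
Qed.

Lemma compn_divexp2 n f g :
  compn n f -> compn n g -> compn n (fun xs => f xs %/ 2 ^ (g xs).+1).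
Proof.
move=> cf cg.
have H : compn 2 (fun xs => nth 0 xs 0 %/ 2 ^ (nth 0 xs 1).+1).
  apply: (@compn_mu 2
    (fun xs => (nth 0 xs 1).+1 - 2 ^ (nth 0 xs 2).+1 * (nth 0 xs 0).+1)).
  - apply: compn_sub; first by apply: compn_succ; apply: compn_proj.
    apply: compn_mul; last by apply: compn_succ; apply: compn_proj.
    by apply: compn_exp2; apply: compn_succ; apply: compn_proj.
  - move=> xs _ /=; apply/eqP; rewrite subn_eq0 mulnC.
    by rewrite ltn_ceil // expn_gt0.
  - move=> xs m _ /= lt; rewrite subn_gt0 ltnS mulnC.
    by rewrite -leq_divRL // expn_gt0.
exact: compn_comp2 H cf cg.
Qed.

Lemma divexp2_npair a b : 2 ^ a * b.*2.+1 %/ 2 ^ a.+1 = b.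
Proof. by rewrite expnSr divnMA mulKn ?expn_gt0 // divn2 /= uphalf_double. Qed.

Lemma compn_nfst n f : compn n f -> compn n (fun xs => nfst (f xs)).
Proof.
move=> cf.
have H : compn 1 (fun xs => nfst (nth 0 xs 0)); last exact: compn_comp1 H cf.
apply: (@compn_mu 1 (fun xs => 1 - ((nth 0 xs 1).+1 -
   2 ^ (nth 0 xs 0).+1 * ((nth 0 xs 1).+1 %/ 2 ^ (nth 0 xs 0).+1)))).
- apply: compn_sub; first by apply/compn_succ/compn_zero.
  apply: compn_sub; first by apply: compn_succ; apply: compn_proj.
  apply: compn_mul; first by apply/compn_exp2/compn_succ/compn_proj.
  by apply: compn_divexp2; [apply: compn_succ|]; apply: compn_proj.
- move=> [|x []] //= _; move: (npairS (nfst x) (nsnd x)); rewrite npairK => ->.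
  apply/eqP; rewrite subn_eq0 subn_gt0 divexp2_npair expnSr -mulnA.
  by rewrite ltn_pmul2l ?expn_gt0 // mul2n.
- move=> [|x []] //= m _ lt; move: (npairS (nfst x) (nsnd x)); rewrite npairK => ->.
  rewrite subn_gt0 ltnS leqn0 subn_eq0 [2 ^ m.+1 * _]mulnC divnK //.
  by rewrite dvdn_mulr // dvdn_exp2l.
Qed.

Lemma compn_nsnd n f : compn n f -> compn n (fun xs => nsnd (f xs)).
Proof.
move=> cf; apply: (@compn_ext _ (fun xs => (f xs).+1 %/ 2 ^ (nfst (f xs)).+1)).
  by move=> xs _; rewrite -{1}[f xs]npairK npairS divexp2_npair.
by apply: compn_divexp2; [apply: compn_succ | apply: compn_nfst].
Qed.

(** * Computable functions between numbered data types

    A program is never written out again below: computability of a function is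
    derived from closure properties, once every data type has a numbering.  All
    numberings are bijective, so that an unbounded search over numbers is a search
    over the data. *)

Class numbered (T : Type) := Numbered {
  enc : T -> nat; dec : nat -> T; encK : cancel enc dec; decK : cancel dec enc }.

#[export] Instance numbered_nat : numbered nat.
Proof. by exists id id. Defined.

#[export] Instance numbered_pair A B `{numbered A} `{numbered B} : numbered (A * B).
Proof.
exists (fun x => npair (enc x.1) (enc x.2)) (fun n => (dec (nfst n), dec (nsnd n))).
- by move=> x; rewrite nfstK nsndK !encK -surjective_pairing.
- by move=> n /=; rewrite !decK npairK.
Defined.

#[export] Instance numbered_option A `{numbered A} : numbered (option A).
Proof.
exists (fun o => if o is Some x then (enc x).+1 else 0)
       (fun n => if n is m.+1 then Some (dec m) else None).
- by case=> //= a; rewrite encK.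
- by case=> //= n; rewrite decK.
Defined.

#[export] Instance numbered_seq A `{numbered A} : numbered (seq A).
Proof.
exists (fun s => CodeSeq.code (map enc s)) (fun n => map dec (CodeSeq.decode n)).
- by move=> s; rewrite CodeSeq.codeK (mapK encK).
- by move=> n; rewrite (mapK decK) CodeSeq.decodeK.
Defined.

Lemma enc_inj A `{numbered A} : injective (@enc A _).
Proof. exact: can_inj encK. Qed.

(** A list and the option of its head and tail have the same code, so building and
    destructing lists costs no program. *)
Lemma enc_cons A `{numbered A} (a : A) s : enc (a :: s) = enc (Some (a, s)).
Proof. by rewrite /= npairS. Qed.

Definition computable A B `{numbered A} `{numbered B} (f : A -> B) : Prop :=
  exists p, forall a, reval p [:: enc a] (enc (f a)).

Lemma computable_compn A B `{numbered A} `{numbered B} (f : A -> B) g :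
  compn 1 g -> (forall a, g [:: enc a] = enc (f a)) -> computable f.
Proof. by move=> [p Hp] gf; exists p => a; rewrite -gf; apply: Hp. Qed.

Lemma compn_computable A B {nA : numbered A} {nB : numbered B} (f : A -> B) :
  computable f -> compn 1 (fun xs => enc (f (dec (nth 0 xs 0)))).
Proof.
move=> [p Hp]; exists p => -[|x []] // _ /=.
by have := Hp (@dec A nA x); rewrite decK.
Qed.

Lemma compn_call n A B `{numbered A} `{numbered B} (f : A -> B) g :
  computable f -> compn n g -> compn n (fun xs => enc (f (dec (g xs)))).
Proof. by move=> /compn_computable cf cg; apply: compn_comp1 cf cg. Qed.

Section Closure.
Context {C A B : Type} `{numbered C} `{numbered A} `{numbered B}.

Lemma computable_ext (f g : A -> B) : f =1 g -> computable f -> computable g.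
Proof. by move=> fg [p Hp]; exists p => a; rewrite -fg. Qed.

Lemma computable_const (b : B) : computable (fun _ : C => b).
Proof.
apply: (@computable_compn _ _ _ _ _ (fun=> enc b)) => //.
by elim: (enc b) => [|n IH]; [apply: compn_zero | apply: compn_succ].
Qed.

Lemma computable_id : computable (@id C).
Proof.
by apply: (@computable_compn _ _ _ _ _ (nth 0 ^~ 0)) => //; apply: compn_proj.
Qed.

Lemma computable_comp (g : A -> B) (f : C -> A) :
  computable g -> computable f -> computable (fun c => g (f c)).
Proof.
move=> cg cf; apply: (computable_compn (compn_call cg (compn_computable cf))).
by move=> c /=; rewrite !encK.
Qed.

(** A change of data type that preserves codes is computed by the same program. *)
Lemma computable_recode (g : A -> B) (f : C -> A) :
  (forall a, enc (g a) = enc a) -> computable f -> computable (fun c => g (f c)).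
Proof. by move=> gE [p Hp]; exists p => c; rewrite gE. Qed.

Lemma computable_pair (f : C -> A) (g : C -> B) :
  computable f -> computable g -> computable (fun c => (f c, g c)).
Proof.
move=> cf cg.
apply: (computable_compn (compn_npair (compn_computable cf) (compn_computable cg))).
by move=> c /=; rewrite !encK.
Qed.

Lemma computable_fst (f : C -> A * B) : computable f -> computable (fun c => (f c).1).
Proof.
move=> cf; apply: (computable_compn (compn_nfst (compn_computable cf))) => c /=.
by rewrite encK nfstK.
Qed.

Lemma computable_snd (f : C -> A * B) : computable f -> computable (fun c => (f c).2).
Proof.
move=> cf; apply: (computable_compn (compn_nsnd (compn_computable cf))) => c /=.
by rewrite encK nsndK.
Qed.

Lemma computable_Some (f : C -> A) : computable f -> computable (fun c => Some (f c)).
Proof.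
by move=> cf; apply: (computable_compn (compn_succ (compn_computable cf))) => c /=;
  rewrite encK.
Qed.

Lemma computable_match (o : C -> option A) (f : C * A -> B) (g : C -> B) :
  computable o -> computable f -> computable g ->
  computable (fun c => if o c is Some a then f (c, a) else g c).
Proof.
move=> co cf cg.
have cP := compn_primrec (compn_computable cg) (compn_call cf
  (compn_npair (@compn_proj 3 2 isT) (@compn_proj 3 0 isT))).
apply: (computable_compn (compn_comp2 cP (compn_computable co) (@compn_proj 1 0 isT))).
by move=> c /=; rewrite encK; case: (o c) => [a|] /=; rewrite ?nfstK ?nsndK !encK.
Qed.

Lemma computable_iter (n : C -> nat) (step : C * B -> B) (i : C -> B) :
  computable n -> computable step -> computable i ->
  computable (fun c => iter (n c) (fun b => step (c, b)) (i c)).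
Proof.
move=> cn cs ci.
have cP := compn_primrec (compn_computable ci) (compn_call cs
  (compn_npair (@compn_proj 3 2 isT) (@compn_proj 3 1 isT))).
apply: (computable_compn (compn_comp2 cP (compn_computable cn) (@compn_proj 1 0 isT))).
move=> c /=; rewrite encK; elim: (n c) => [|k IH] /=; first by rewrite encK.
by rewrite IH nfstK nsndK !encK.
Qed.

End Closure.

Section Lists.
Context {C A : Type} `{numbered C} `{numbered A}.

Lemma computable_cons (f : C -> A) (g : C -> seq A) :
  computable f -> computable g -> computable (fun c => f c :: g c).
Proof.
move=> cf cg; have [p Hp] := computable_Some (computable_pair cf cg).
by exists p => c; rewrite enc_cons.
Qed.

Lemma computable_uncons (f : C -> seq A) : computable f ->
  computable (fun c => if f c is a :: s then Some (a, s) else None).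
Proof.
move=> [p Hp]; exists p => c; move: (Hp c).
by case: (f c) => // a s; rewrite enc_cons.
Qed.

End Lists.

Section Control.
Context {C A B : Type} `{numbered C} `{numbered A} `{numbered B}.

(** A fold over a list is an iteration on pairs of an accumulator and a remaining
    list.  The number of iterations may be any bound of the length, since nothing
    happens on the empty list, and the code of the list is such a bound. *)
Lemma computable_foldl (s : C -> seq A) (step : C * (B * A) -> B) (i : C -> B) :
  computable s -> computable step -> computable i ->
  computable (fun c => foldl (fun b a => step (c, (b, a))) (i c) (s c)).
Proof.
move=> cs cstep ci.
pose st (x : C * (B * seq A)) :=
  if (if x.2.2 is a :: s then Some (a, s) else None) is Some y then
    (step (x.1, (x.2.1, y.1)), y.2) else x.2.
have cst : computable st.
  apply: (@computable_match _ _ _ _ _ _ _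
    (fun z => (step (z.1.1, (z.1.2.1, z.2.1)), z.2.2))).
  - by apply: computable_uncons; do 2!apply: computable_snd; apply: computable_id.
  - apply: computable_pair; last by do 2!apply: computable_snd; apply: computable_id.
    apply: computable_comp => //; apply: computable_pair.
      by do 2!apply: computable_fst; apply: computable_id.
    apply: computable_pair; apply: computable_fst.
      by apply/computable_snd/computable_fst/computable_id.
    by apply/computable_snd/computable_id.
  - by apply: computable_snd; apply: computable_id.
have cI : computable (fun c => (iter (enc (s c)) (fun x => st (c, x)) (i c, s c)).1).
  apply: computable_fst; apply: computable_iter => //; last exact: computable_pair.
apply: (computable_ext _ cI) => c.
have : size (s c) <= enc (s c).
  elim: (s c) => //= a s' IH; rewrite -[_ * _]/(2 ^ enc a * _).
  rewrite (leq_trans _ (leq_pmull _ _)) ?expn_gt0 // ltnS (leq_trans IH) //=.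
  by rewrite -addnn leq_addr.
move: (@enc (seq A) _ (s c)) => n; elim: n (s c) (i c) => [|n IH] [|a s1] b; rewrite ?iterSr //=.
  by move=> _; apply: (IH [::]).
by rewrite ltnS => /IH ->.
Qed.

Lemma computable_eq (T : eqType) `{numbered T} (f g : C -> T) :
  computable f -> computable g -> computable (fun c => f c == g c : nat).
Proof.
move=> cf cg; have [cf' cg'] := (compn_computable cf, compn_computable cg).
have c1 := compn_succ (compn_zero 1).
apply: (computable_compn (compn_sub c1 (compn_add (compn_sub cf' cg') (compn_sub cg' cf')))).
move=> c /=; rewrite !encK; case: eqP => [->|ne]; first by rewrite subnn.
apply/eqP; rewrite subn_eq0 lt0n addn_eq0 !subn_eq0 -eqn_leq.
by apply/eqP => e; apply: ne; apply: enc_inj e.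
Qed.

Lemma computable_leq (f g : C -> nat) :
  computable f -> computable g -> computable (fun c => f c <= g c : nat).
Proof.
move=> cf cg; have [cf' cg'] := (compn_computable cf, compn_computable cg).
apply: (computable_compn (compn_sub (compn_succ (compn_zero 1)) (compn_sub cf' cg'))).
by move=> c /=; rewrite !encK leqNgt /= -subn_gt0; case: (f c - g c).
Qed.

Lemma computable_if (b : C -> bool) (f g : C -> B) :
  computable (fun c => b c : nat) -> computable f -> computable g ->
  computable (fun c => if b c then f c else g c).
Proof.
move=> cb cf cg.
have cb' : computable (fun c => if b c : nat is n.+1 then Some n else None).
  by apply: (@computable_recode _ nat (option nat) _ _ _
    (fun k => if k is n.+1 then Some n else None)) cb; case.
apply: computable_ext (computable_match cb' (computable_comp cf
  (computable_fst (@computable_id (C * nat) _))) cg).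
by move=> c /=; case: (b c).
Qed.

End Control.

(** Computability of constants and of components of the context. *)
Ltac comp_var := first
  [ assumption | exact: computable_id | exact: computable_const
  | apply: computable_fst; comp_var | apply: computable_snd; comp_var ].

Section Lists.
Context {C A B : Type} `{numbered C} `{numbered A} `{numbered B}.

Lemma computable_bool (T : Type) `{numbered T} (f : T -> bool) (g : C -> T) :
  computable (fun x => f x : nat) -> computable g -> computable (fun c => f (g c) : nat).
Proof. exact: computable_comp. Qed.

Lemma computable_and (a b : C -> bool) :
  computable (fun c => a c : nat) -> computable (fun c => b c : nat) ->
  computable (fun c => a c && b c : nat).
Proof.
move=> ca cb; apply: computable_ext (computable_if ca cb (computable_const 0)) => c.
by case: (a c).
Qed.

Lemma computable_rev (s : C -> seq A) : computable s -> computable (fun c => rev (s c)).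
Proof.
move=> cs; apply: (@computable_ext _ _ _ _
  (fun c => foldl (fun b a => a :: b) [::] (s c))).
  move=> c; rewrite /rev; elim: (s c) [::] => //= a s' IH b.
apply: (@computable_foldl _ _ _ _ _ _ s (fun z => z.2.2 :: z.2.1)) => //; last comp_var.
by apply: computable_cons; comp_var.
Qed.

End Lists.

Section Fold.
Context {C A B : Type} `{numbered C} `{numbered A} `{numbered B}.

Lemma computable_foldr (s : C -> seq A) (step : C * (A * B) -> B) (i : C -> B) :
  computable s -> computable step -> computable i ->
  computable (fun c => foldr (fun a b => step (c, (a, b))) (i c) (s c)).
Proof.
move=> cs cstep ci; apply: (@computable_ext _ _ _ _
  (fun c => foldl (fun b a => step (c, (a, b))) (i c) (rev (s c)))).
  by move=> c; rewrite foldl_rev.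
apply: (@computable_foldl _ _ _ _ _ _ _ (fun z => step (z.1, (z.2.2, z.2.1)))) => //.
  exact: computable_rev.
by apply: computable_comp => //; do 2?apply: computable_pair; comp_var.
Qed.

End Fold.

Section Map.
Context {C A B : Type} `{numbered C} `{numbered A} `{numbered B}.

Lemma computable_cat (s t : C -> seq A) :
  computable s -> computable t -> computable (fun c => s c ++ t c).
Proof.
move=> cs ct.
apply: (@computable_ext _ _ _ _ (fun c => foldr (fun a b => a :: b) (t c) (s c))).
  by move=> c; elim: (s c) => //= a s' ->.
apply: (@computable_foldr _ _ _ _ _ _ s (fun z => z.2.1 :: z.2.2)) => //.
by apply: computable_cons; comp_var.
Qed.

Lemma computable_map (f : C * A -> B) (s : C -> seq A) :
  computable f -> computable s -> computable (fun c => [seq f (c, a) | a <- s c]).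
Proof.
move=> cf cs; apply: (@computable_ext _ _ _ _
  (fun c => foldr (fun a b => f (c, a) :: b) [::] (s c))).
  by move=> c; elim: (s c) => //= a s' ->.
apply: (@computable_foldr _ _ _ _ _ _ s (fun z => f (z.1, z.2.1) :: z.2.2)) => //;
  last comp_var.
apply: computable_cons; last comp_var.
by apply: computable_comp => //; apply: computable_pair; comp_var.
Qed.

Lemma computable_all (f : C * A -> bool) (s : C -> seq A) :
  computable (fun x => f x : nat) -> computable s ->
  computable (fun c => all (fun a => f (c, a)) (s c) : nat).
Proof.
move=> cf cs; apply: (@computable_ext _ _ _ _
  (fun c => foldr (fun a b => if f (c, a) then b else 0) 1 (s c))).
  by move=> c; elim: (s c) => //= a s' ->; case: (f _).
apply: (@computable_foldr _ _ _ _ _ _ s (fun z => if f (z.1, z.2.1) then z.2.2 else 0))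
  => //; last comp_var.
apply: computable_if; [|comp_var|comp_var].
by apply: computable_bool => //; apply: computable_pair; comp_var.
Qed.

Lemma computable_has (f : C * A -> bool) (s : C -> seq A) :
  computable (fun x => f x : nat) -> computable s ->
  computable (fun c => has (fun a => f (c, a)) (s c) : nat).
Proof.
move=> cf cs; apply: (@computable_ext _ _ _ _
  (fun c => foldr (fun a b => if f (c, a) then 1 else b) 0 (s c))).
  by move=> c; elim: (s c) => //= a s' ->; case: (f _).
apply: (@computable_foldr _ _ _ _ _ _ s (fun z => if f (z.1, z.2.1) then 1 else z.2.2))
  => //; last comp_var.
apply: computable_if; [|comp_var|comp_var].
by apply: computable_bool => //; apply: computable_pair; comp_var.
Qed.

End Map.

Section Numbers.
Context {C : Type} `{numbered C}.

Lemma computable_succ (f : C -> nat) : computable f -> computable (fun c => (f c).+1).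
Proof. by move=> [p Hp]; exists (RComp RSucc [:: p]) => c;
  apply: EComp (ESucc _ _); [apply: ECons (Hp c) (ENil _)]. Qed.

Lemma computable_pred (f : C -> nat) : computable f -> computable (fun c => (f c).-1).
Proof.
move=> cf.
have co : computable (fun c => if f c is m.+1 then Some m else None).
  by apply: (@computable_recode _ nat (option nat) _ _ _
    (fun k => if k is n.+1 then Some n else None) f) => //; case.
apply: (@computable_ext _ _ _ _ (fun c => if (if f c is m.+1 then Some m else None)
  is Some m then m else 0)); first by move=> c; case: (f c).
by apply: (@computable_match _ _ _ _ _ _ _ snd) => //; comp_var.
Qed.

End Numbers.

Section ListFunctions.
Context {C A : Type} `{numbered C} `{numbered A}.

Lemma computable_flatten (s : C -> seq (seq A)) :
  computable s -> computable (fun c => flatten (s c)).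
Proof.
move=> cs; apply: (@computable_foldr _ _ _ _ _ _ s (fun z => z.2.1 ++ z.2.2)) => //.
  by apply: computable_cat; comp_var.
comp_var.
Qed.

Lemma computable_nth (x0 : A) (s : C -> seq A) (n : C -> nat) :
  computable s -> computable n -> computable (fun c => nth x0 (s c) (n c)).
Proof.
move=> cs cn.
have cu : forall D B (nD : numbered D) (nB : numbered B) (t : D -> seq A)
    (f : A * seq A -> B) b0, computable t -> computable f ->
    computable (fun c => if t c is a :: s' then f (a, s') else b0).
  move=> D B nD nB t f b0 ct cf.
  apply: (@computable_ext _ _ _ _ (fun c => if (if t c is a :: s' then Some (a, s') else None)
    is Some y then f y else b0)); first by move=> c; case: (t c).
  apply: (@computable_match _ _ _ _ _ _ _ (fun z => f z.2)); last comp_var.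
    exact: computable_uncons.
  by apply: computable_comp => //; comp_var.
pose tl (t : seq A) := if t is a :: s' then (a, s').2 else [::].
pose hd (t : seq A) := if t is a :: s' then (a, s').1 else x0.
apply: (@computable_ext _ _ _ _ (fun c => hd (iter (n c) tl (s c)))).
  move=> c; elim: (n c) (s c) => [|k IH] [|a t] //=; rewrite -iterS iterSr /= IH //.
  by rewrite nth_nil.
apply: computable_comp; first by apply: (cu _ _ _ _ _ fst) => //; comp_var.
apply: (@computable_iter _ _ _ _ _ (fun z => tl z.2)) => //.
by apply: (cu _ _ _ _ _ snd) => //; comp_var.
Qed.

Lemma computable_size (s : C -> seq A) : computable s -> computable (fun c => size (s c)).
Proof.
move=> cs; apply: (@computable_ext _ _ _ _ (fun c => foldr (fun _ k => k.+1) 0 (s c))).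
  by move=> c; elim: (s c) => //= a t ->.
apply: (@computable_foldr _ _ _ _ _ _ s (fun z => z.2.2.+1)) => //; last comp_var.
by apply: computable_succ; comp_var.
Qed.

End ListFunctions.

Lemma computable_iota0 C `{numbered C} (n : C -> nat) :
  computable n -> computable (fun c => iota 0 (n c)).
Proof.
move=> cn; apply: (@computable_ext _ _ _ _
   (fun c => iter (n c) (fun s => s ++ [:: size s]) [::])).
  move=> c; elim: (n c) => [|k IH] //; rewrite iterS IH -[k.+1]addn1 iotaD //=.
  by rewrite size_iota.
apply: (@computable_iter _ _ _ _ _ (fun z => z.2 ++ [:: size z.2])) => //; last comp_var.
apply: computable_cat; first comp_var.
by apply: computable_cons; [apply: computable_size|]; comp_var.
Qed.

Lemma computable_mem C `{numbered C} (T : eqType) `{numbered T} (x : C -> T) (s : C -> seq T) :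
  computable x -> computable s -> computable (fun c => x c \in s c : nat).
Proof.
move=> cx cs; apply: (@computable_ext _ _ _ _ (fun c => has (fun a => a == x c) (s c) : nat)).
  by move=> c; rewrite has_pred1.
apply: (@computable_has _ _ _ _ (fun z => z.2 == x z.1)) => //.
apply: computable_eq; first comp_var.
by apply: computable_comp => //; comp_var.
Qed.

Lemma computable_half_odd C `{numbered C} (n : C -> nat) : computable n ->
  computable (fun c => ((n c)./2, odd (n c) : nat)).
Proof.
move=> cn.
pose st (x : nat * nat) := if x.2 == 0 then (x.1, 1) else (x.1.+1, 0).
apply: (@computable_ext _ _ _ _ (fun c => iter (n c) st (0, 0))).
  by move=> c; elim: (n c) => //= k ->; rewrite uphalf_half /st /=; case: (odd k).
apply: (@computable_iter _ _ _ _ _ (fun z => st z.2)) => //; last comp_var.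
apply: computable_if; first by apply: computable_eq; comp_var.
  by apply: computable_pair; comp_var.
by apply: computable_pair; [apply: computable_succ|]; comp_var.
Qed.

Lemma computable_half C `{numbered C} (n : C -> nat) :
  computable n -> computable (fun c => (n c)./2).
Proof. by move=> cn; apply: (@computable_fst _ _ _ _ _ _ (fun c => ((n c)./2, odd (n c) : nat)));
  apply: computable_half_odd. Qed.

Lemma computable_odd C `{numbered C} (n : C -> nat) :
  computable n -> computable (fun c => odd (n c) : nat).
Proof. by move=> cn; apply: (@computable_snd _ _ _ _ _ _ (fun c => ((n c)./2, odd (n c) : nat)));
  apply: computable_half_odd. Qed.

Lemma computable_double C `{numbered C} (n : C -> nat) :
  computable n -> computable (fun c => (n c).*2).
Proof.
move=> cn; apply: (@computable_ext _ _ _ _ (fun c => iter (n c) (fun k => k.+2) 0)).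
  by move=> c; elim: (n c) => //= k ->.
apply: (@computable_iter _ _ _ _ _ (fun z => z.2.+2)) => //; last comp_var.
by do 2!apply: computable_succ; comp_var.
Qed.

(** A witness of a computable test is found by unbounded search, which halts as soon
    as there is one, because the test is total. *)
Lemma computable_search A T B {nA : numbered A} {nT : numbered T} {nB : numbered B}
    (ok : A * T -> bool) (out : A * T -> B) :
  computable (fun x => ok x : nat) -> computable out ->
  exists p, forall a, (exists t, ok (a, t)) ->
    exists t, ok (a, t) /\ reval p [:: enc a] (enc (out (a, t))).
Proof.
move=> ck cout.
have [r Hr] : compn 2 (fun xs => 1 - ok (dec (npair (nth 0 xs 1) (nth 0 xs 0)))).
  apply: compn_sub; first exact: compn_succ (compn_zero 2).
  apply: (@compn_comp1 _ (fun xs => ok (dec (nth 0 xs 0)) : nat)).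
    exact: (compn_computable ck).
  by apply: compn_npair; apply: compn_proj.
have [o Ho] : compn 2 (fun xs => enc (out (dec (npair (nth 0 xs 0) (nth 0 xs 1))))).
  by apply: compn_call => //; apply: compn_npair; apply: compn_proj.
have E a n : 1 - ok (dec (npair (enc a) n)) = 1 - ok (a, dec n).
  by rewrite [dec _]/= nfstK nsndK encK.
exists (RComp o [:: RProj 0; RMu r]) => a [t0 ok0].
have ex : exists n, ok (a, dec n) by exists (enc t0); rewrite encK.
exists (dec (ex_minn ex)); case: ex_minnP => n okn minn; split=> //.
apply: (@EComp _ _ _ [:: enc a; n]).
  apply: ECons; first exact: (@EProj 0 [:: enc a]).
  apply: ECons (ENil _); apply: EMu.
    have -> : 0 = 1 - ok (dec (npair (enc a) n)) by rewrite E okn.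
    exact: (Hr [:: n; enc a] erefl).
  move=> m lt; exists 0.
  have -> : 1 = 1 - ok (dec (npair (enc a) m)).
    by rewrite E; case: (boolP (ok _)) => // /minn; rewrite leqNgt lt.
  exact: (Hr [:: m; enc a] erefl).
have -> : (a, @dec T nT n) = dec (npair (enc a) n) by rewrite /= nfstK nsndK encK.
exact: (Ho [:: enc a; n] erefl).
Qed.

(** * Certificates

    Paths are lists of numbers of darts and words are lists of numbers of letters; in
    both the inverse of a letter is obtained by changing its parity. *)

Definition flip_letter (x : nat) : nat := if odd x then x.-1 else x.+1.
Definition inv_word (a : seq nat) : seq nat := rev (map flip_letter a).

Definition lookup (K : eqType) V (L : seq (K * V)) (k : K) : option V :=
  foldr (fun e r => if e.1 == k then Some e.2 else r) None L.

Section Transducers.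
Variables (St A O : Type) (delta : St -> A -> option (St * seq O)).

Definition tstep (o : option (St * seq O)) (d : A) : option (St * seq O) :=
  obind (fun x => omap (fun y => (y.1, x.2 ++ y.2)) (delta x.1 d)) o.

Definition trun (u : St) (s : seq A) : option (St * seq O) :=
  foldl tstep (Some (u, [::])) s.

End Transducers.

(** An entry [((u, d), (v, a))] is an edge of a finite graph from the state [u] to the
    state [v], mapped to the dart [d] of X and labelled with a word [a] in the
    generators. *)
Definition transducer := seq ((nat * nat) * (nat * seq nat)).
Definition trans (L : transducer) (u d : nat) := lookup L (u, d).

Definition eval_letter (gens : seq (seq nat)) (x : nat) : seq nat :=
  if odd x then inv_word (nth [::] gens x./2) else nth [::] gens x./2.
Definition eval_nword (gens : seq (seq nat)) (a : seq nat) : seq nat :=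
  flatten (map (eval_letter gens) a).

(** A step need not record whether it deletes or inserts [r]: as the words [r] in use
    are not empty, at most one of the two applies to the current word. *)
Definition insdel_step (Rl : seq (seq nat)) (cur : seq nat)
    (st : seq nat * (seq nat * seq nat)) : seq nat :=
  if st.2.1 \in Rl then
    if cur == st.1 ++ st.2.1 ++ st.2.2 then st.1 ++ st.2.2
    else if cur == st.1 ++ st.2.2 then st.1 ++ st.2.1 ++ st.2.2 else cur
  else cur.

Definition derivation := seq (seq nat * (seq nat * seq nat)).

(** The label read along a generator is to be equal to that generator. *)
Definition gen_relators (gens : seq (seq nat)) (L : transducer) : seq (seq nat) :=
  [seq if trun (trans L) 0 (nth [::] gens j) is Some y
       then y.2 ++ [:: flip_letter j.*2] else [::] | j <- iota 0 (size gens)].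

Definition face_relators (Fl : seq (seq nat)) (L : transducer) : seq (seq nat) :=
  flatten [seq flatten [seq
    if trun (trans L) e.1.1 f is Some y then
      if y.1 == e.1.1 then [:: y.2] else [::]
    else [::] | f <- Fl] | e <- L].

Definition cert_relators Fl gens L := gen_relators gens L ++ face_relators Fl L.

Definition certificate := (transducer * seq derivation)%type.

Section Check.
Variables (Tl : seq (seq nat * seq nat)) (Fl Rl : seq (seq nat)).

Definition check_inverse (L : transducer) :=
  all (fun e => lookup L (e.2.1, flip_letter e.1.2) == Some (e.1.1, inv_word e.2.2)) L.

(** The pairs in [Tl] will be a reducing subpath and the whole of the boundary of a
    2-cell, read from the same corner.  Only states with an entry are tested: a reducing
    subpath is not empty, so it cannot be read elsewhere. *)
Definition check_closed (L : transducer) :=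
  all (fun e => all (fun t => if trun (trans L) e.1.1 t.1 is Some _ then
    (if trun (trans L) e.1.1 t.2 is Some y then y.1 == e.1.1 else false) else true) Tl) L.

Definition check_gens (gens : seq (seq nat)) (L : transducer) :=
  all (fun g => if trun (trans L) 0 g is Some y then y.1 == 0 else false) gens.

Definition check_letters (gens : seq (seq nat)) (L : transducer) :=
  all (all (fun x => x./2 < size gens)) (cert_relators Fl gens L).

Definition check_trivial (gens : seq (seq nat)) (c : certificate) :=
  all (fun a => has (fun D => foldl (insdel_step Rl) (eval_nword gens a) D == [::]) c.2)
    (cert_relators Fl gens c.1).

Definition check (x : seq (seq nat) * certificate) : bool :=
  [&& check_inverse x.2.1, check_closed x.2.1, check_gens x.1 x.2.1,
      check_letters x.1 x.2.1 & check_trivial x.1 x.2].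

End Check.

Section ComputableCheck.

Let input := (seq (seq nat) * certificate)%type.
Let entry := ((nat * nat) * (nat * seq nat))%type.

Lemma computable_flip C `{numbered C} (f : C -> nat) : computable f ->
  computable (fun c => flip_letter (f c)).
Proof.
move=> cf; apply: computable_if; first exact: computable_odd.
  exact: computable_pred.
exact: computable_succ.
Qed.

Lemma computable_inv_word C `{numbered C} (f : C -> seq nat) : computable f ->
  computable (fun c => inv_word (f c)).
Proof.
move=> cf; apply: computable_rev.
apply: (@computable_map _ _ _ _ _ _ (fun z => flip_letter z.2)) => //.
by apply: computable_flip; comp_var.
Qed.

Lemma computable_lookup C (K : eqType) V `{numbered C} `{numbered K} `{numbered V}
    (L : C -> seq (K * V)) k :
  computable L -> computable k -> computable (fun c => lookup (L c) (k c)).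
Proof.
move=> cL ck; apply: (@computable_foldr _ _ _ _ _ _ L
  (fun z => if z.2.1.1 == k z.1 then Some z.2.1.2 else z.2.2)) => //; last comp_var.
apply: computable_if; last comp_var.
  by apply: computable_eq; [comp_var | apply: computable_comp => //; comp_var].
by apply: computable_Some; comp_var.
Qed.

Lemma computable_trun C `{numbered C} (L : C -> transducer) u s :
  computable L -> computable u -> computable s ->
  computable (fun c => trun (trans (L c)) (u c) (s c)).
Proof.
move=> cL cu cs.
apply: (@computable_foldl _ _ _ _ _ _ s
  (fun z => tstep (trans (L z.1)) z.2.1 z.2.2)) => //; last first.
  by apply: computable_Some; apply: computable_pair => //; comp_var.
pose lk (z : C * (option (nat * seq nat) * nat) * (nat * seq nat)) :=
  lookup (L z.1.1) (z.2.1, z.1.2.2).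
apply: (@computable_ext _ _ _ _ (fun z => if z.2.1 is Some x then
    (if lk (z, x) is Some y then Some (y.1, x.2 ++ y.2) else None) else None)).
  by case=> c [[x|] d].
apply: (@computable_match _ _ _ _ _ _ _
   (fun z => if lk z is Some y then Some (y.1, z.2.2 ++ y.2) else None)); [comp_var| |comp_var].
apply: (@computable_match _ _ _ _ _ _ lk
   (fun w => Some (w.2.1, w.1.2.2 ++ w.2.2))); last comp_var.
  apply: computable_lookup; first by apply: computable_comp => //; comp_var.
  by apply: computable_pair; comp_var.
apply: computable_Some; apply: computable_pair; first comp_var.
by apply: computable_cat; comp_var.
Qed.

Lemma computable_eval_nword C `{numbered C} (g : C -> seq (seq nat)) a :
  computable g -> computable a -> computable (fun c => eval_nword (g c) (a c)).
Proof.
move=> cg ca; apply: computable_flatten.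
apply: (@computable_map _ _ _ _ _ _ (fun z => eval_letter (g z.1) z.2)) => //.
have cn : computable (fun z => nth [::] (g z.1) z.2./2).
  apply: computable_nth; first by apply: computable_comp => //; comp_var.
  by apply: computable_half; comp_var.
apply: computable_if => //; first by apply: computable_odd; comp_var.
exact: computable_inv_word.
Qed.

Lemma computable_gen_relators C `{numbered C} (g : C -> seq (seq nat)) L :
  computable g -> computable L -> computable (fun c => gen_relators (g c) (L c)).
Proof.
move=> cg cL; apply: (@computable_map _ _ _ _ _ _ (fun z =>
   if trun (trans (L z.1)) 0 (nth [::] (g z.1) z.2) is Some y
       then y.2 ++ [:: flip_letter z.2.*2] else [::])); last first.
  by apply: computable_iota0; apply: computable_size.
apply: (@computable_match _ _ _ _ _ _ _ (fun w => w.2.2 ++ [:: flip_letter w.1.2.*2]));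
  last comp_var.
  apply: computable_trun; [by apply: computable_comp => //; comp_var | comp_var |].
  by apply: computable_nth; [apply: computable_comp => //|]; comp_var.
apply: computable_cat; first comp_var.
apply: computable_cons; last comp_var.
by apply: computable_flip; apply: computable_double; comp_var.
Qed.

Lemma computable_face_relators C `{numbered C} Fl (L : C -> transducer) :
  computable L -> computable (fun c => face_relators Fl (L c)).
Proof.
move=> cL; apply: computable_flatten.
apply: (@computable_map _ _ _ _ _ _ (fun z => flatten [seq
    if trun (trans (L z.1)) z.2.1.1 f is Some y then
      if y.1 == z.2.1.1 then [:: y.2] else [::]
    else [::] | f <- Fl])) => //.
apply: computable_flatten.
apply: (@computable_map _ _ _ _ _ _ (fun w =>
    if trun (trans (L w.1.1)) w.1.2.1.1 w.2 is Some y then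
      if y.1 == w.1.2.1.1 then [:: y.2] else [::]
    else [::])); last comp_var.
apply: (@computable_match _ _ _ _ _ _ _
    (fun v => if v.2.1 == v.1.1.2.1.1 then [:: v.2.2] else [::])); last comp_var.
  by apply: computable_trun; [apply: computable_comp => // |..]; comp_var.
apply: computable_if; [apply: computable_eq | apply: computable_cons |]; comp_var.
Qed.

Lemma computable_cert_relators C `{numbered C} Fl (g : C -> seq (seq nat)) L :
  computable g -> computable L -> computable (fun c => cert_relators Fl (g c) (L c)).
Proof.
move=> cg cL; apply: computable_cat; first exact: computable_gen_relators.
exact: computable_face_relators.
Qed.

Lemma computable_derives C `{numbered C} Rl (s : C -> seq nat) (D : C -> derivation) :
  computable s -> computable D ->
  computable (fun c => foldl (insdel_step Rl) (s c) (D c)).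
Proof.
move=> cs cD; apply: (@computable_foldl _ _ _ _ _ _ D
  (fun z => insdel_step Rl z.2.1 z.2.2)) => //.
have c1 : computable (fun z : C * (seq nat * (seq nat * (seq nat * seq nat))) =>
    z.2.2.1 ++ z.2.2.2.1 ++ z.2.2.2.2).
  by apply: computable_cat; last apply: computable_cat; comp_var.
have c2 : computable (fun z : C * (seq nat * (seq nat * (seq nat * seq nat))) =>
    z.2.2.1 ++ z.2.2.2.2).
  by apply: computable_cat; comp_var.
apply: computable_if; [by apply: computable_mem; comp_var| |comp_var].
apply: computable_if; [by apply: computable_eq => //; comp_var| by [] |].
by apply: computable_if; [apply: computable_eq => //; comp_var | |comp_var].
Qed.

Lemma computable_check Tl Fl Rl :
  computable (fun x => check Tl Fl Rl x : nat).
Proof.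
do 4?[apply: computable_and].
- apply: (@computable_all _ _ _ _ (fun z : input * entry =>
    lookup z.1.2.1 (z.2.2.1, flip_letter z.2.1.2) == Some (z.2.1.1, inv_word z.2.2.2)));
    last comp_var.
  apply: computable_eq.
    apply: computable_lookup; first comp_var.
    by apply: computable_pair; [|apply: computable_flip]; comp_var.
  apply: computable_Some; apply: computable_pair; first comp_var.
  by apply: computable_inv_word; comp_var.
- apply: (@computable_all _ _ _ _ (fun z : input * entry =>
    all (fun t => if trun (trans z.1.2.1) z.2.1.1 t.1 is Some _ then
    (if trun (trans z.1.2.1) z.2.1.1 t.2 is Some y then y.1 == z.2.1.1 else false)
     else true) Tl)); last comp_var.
  apply: (@computable_all _ _ _ _ (fun w =>
    if trun (trans w.1.1.2.1) w.1.2.1.1 w.2.1 is Some _ then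
    (if trun (trans w.1.1.2.1) w.1.2.1.1 w.2.2 is Some y then y.1 == w.1.2.1.1 else false)
     else true)); last comp_var.
  pose b (w : input * entry * (seq nat * seq nat)) : nat :=
    if trun (trans w.1.1.2.1) w.1.2.1.1 w.2.2 is Some y
     then y.1 == w.1.2.1.1 else 0.
  apply: (@computable_ext _ _ _ _ (fun w : input * entry * (seq nat * seq nat) =>
    if trun (trans w.1.1.2.1) w.1.2.1.1 w.2.1 is Some y then b (w, y).1 else 1)).
    by move=> w; rewrite /b; case: (trun _ _ _) => [y|] //; case: (trun _ _ _).
  apply: (@computable_match _ _ _ _ _ _ _ (fun v => b v.1)); last comp_var.
    by apply: computable_trun; comp_var.
  apply: (@computable_match _ _ _ _ _ _ _ (fun v => v.2.1 == v.1.1.1.2.1.1 : nat)); last comp_var.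
    by apply: computable_trun; comp_var.
  by apply: computable_eq; comp_var.
- apply: (@computable_all _ _ _ _ (fun z : input * seq nat =>
    if trun (trans z.1.2.1) 0 z.2 is Some y then y.1 == 0 else false)); last comp_var.
  apply: (@computable_ext _ _ _ _ (fun z : input * seq nat =>
    if trun (trans z.1.2.1) 0 z.2 is Some y then y.1 == 0 : nat else 0)).
    by move=> z; case: (trun _ _ _).
  apply: (@computable_match _ _ _ _ _ _ _ (fun v => v.2.1 == 0 : nat)); last comp_var.
    by apply: computable_trun; comp_var.
  by apply: computable_eq; comp_var.
- apply: (@computable_all _ _ _ _ (fun z : input * seq nat =>
    all (fun x => x./2 < size z.1.1) z.2)).
    apply: (@computable_all _ _ _ _ (fun w : input * seq nat * nat =>
       w.2./2 < size w.1.1.1)); last comp_var.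
    apply: computable_leq; first by apply: computable_succ; apply: computable_half; comp_var.
    by apply: computable_size; comp_var.
  by apply: computable_cert_relators; comp_var.
- apply: (@computable_all _ _ _ _ (fun z : input * seq nat =>
    has (fun D => foldl (insdel_step Rl) (eval_nword z.1.1 z.2) D == [::]) z.1.2.2)).
    apply: (@computable_has _ _ _ _ (fun w =>
      foldl (insdel_step Rl) (eval_nword w.1.1.1 w.1.2) w.2 == [::])); last comp_var.
    apply: computable_eq; last comp_var.
    apply: computable_derives; last comp_var.
    by apply: computable_eval_nword; comp_var.
  by apply: computable_cert_relators; comp_var.
Qed.

End ComputableCheck.

(** The program that the main theorem asks for: it searches for a certificate and
    outputs the relators that it determines.  The tables [Tl], [Fl] and [Rl] are
    constants of the program. *)
Theorem certificate_search Tl Fl Rl : exists p, forall gens : seq (seq nat),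
  (exists c, check Tl Fl Rl (gens, c)) ->
  exists c, check Tl Fl Rl (gens, c) /\
    reval p [:: enc gens] (CodeSeq.code (size gens ::
      map (@CodeSeq.code) (cert_relators Fl gens c.1))).
Proof.
have [|p Hp] := @computable_search _ _ (seq nat) _ _ _ (check Tl Fl Rl)
   (fun x => size x.1 :: map (fun a => enc a) (cert_relators Fl x.1 x.2.1))
   (computable_check Tl Fl Rl).
  apply: computable_cons; first by apply: computable_size; comp_var.
  apply: (@computable_recode _ (seq (seq nat)) (seq nat) _ _ _ (map (fun a => enc a))).
    by move=> s /=; rewrite map_id.
  by apply: computable_cert_relators; comp_var.
exists p => gens /Hp [c [ok r]]; exists c; split=> //; move: r.
rewrite /= map_id; congr (reval _ _ (CodeSeq.code (_ :: _))).
by apply: eq_map => s /=; rewrite map_id.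
Qed.

(** * Edge paths and homotopy *)

Notation rst R := (Relation_Operators.clos_refl_sym_trans _ R).

Lemma rst_map T T' (R : T -> T -> Prop) (R' : T' -> T' -> Prop) (h : T -> T') :
  (forall x y, R x y -> rst R' (h x) (h y)) ->
  forall x y, rst R x y -> rst R' (h x) (h y).
Proof.
move=> RR' x y; elim=> {x y} [x y /RR' //|x|x y _|x y z _ IH1 _ IH2].
- exact: rst_refl.
- exact: rst_sym.
- exact: rst_trans IH1 IH2.
Qed.

Lemma dflipK E : involutive (@dflip E).
Proof. by case=> e b; rewrite /dflip /= negbK. Qed.

Section Paths.
Variable X : complex.
Implicit Types (u v x y : vert X) (s t : seq (dart X)) (d : dart X) (f : face X).

Lemma dtgt_flip d : dtgt (dflip d) = dsrc d.
Proof. by rewrite /dtgt dflipK. Qed.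

Lemma dsrc_flip d : dsrc (dflip d) = dtgt d.
Proof. by []. Qed.

Definition pend u s : vert X := foldl (fun _ d => dtgt d) u s.

Lemma walk_end u s v : walk u s v -> pend u s = v.
Proof. by elim: s u => [|d s IH] u /= => [/eqP|/andP [_ /IH]]. Qed.

Lemma walk_cat u s1 s2 v :
  walk u (s1 ++ s2) v = walk u s1 (pend u s1) && walk (pend u s1) s2 v.
Proof. by elim: s1 u => [|d s1 IH] u /=; rewrite ?eqxx // IH andbA. Qed.

Lemma walk_catI u s1 w s2 v : walk u s1 w -> walk w s2 v -> walk u (s1 ++ s2) v.
Proof. by move=> w1 w2; rewrite walk_cat (walk_end w1) w1. Qed.

Lemma walk_rcons u s d v :
  walk u (rcons s d) v = [&& walk u s (dsrc d), pend u s == dsrc d & dtgt d == v].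
Proof.
rewrite -cats1 walk_cat /= [dsrc d == _]eq_sym andbC -!andbA.
by case: eqP => [<-|_]; rewrite /= ?andbF // andbC.
Qed.

Lemma inv_path_cat s t : inv_path (s ++ t) = inv_path t ++ inv_path s.
Proof. by rewrite /inv_path map_cat rev_cat. Qed.

Lemma inv_pathK : involutive (@inv_path X).
Proof. by move=> s; rewrite /inv_path map_rev revK (mapK (@dflipK _)). Qed.

Lemma inv_path_cons d s : inv_path (d :: s) = rcons (inv_path s) (dflip d).
Proof. by rewrite /inv_path /= rev_cons. Qed.

Lemma walk_inv u s v : walk u s v -> walk v (inv_path s) u.
Proof.
elim: s u => [|d s IH] u /= => [/eqP -> //|/andP [/eqP <- /IH w]].
rewrite inv_path_cons -cats1; apply: walk_catI w _.
by rewrite /= dsrc_flip dtgt_flip !eqxx.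
Qed.

Lemma hstep_walk u v s t : hstep u v s t -> walk u s v /\ walk u t v.
Proof.
case=> s1 => [d|f] s2 w; split=> //; move: w; rewrite !walk_cat => /andP [-> ] /=.
  by move=> /andP [/andP [/eqP <- _]]; rewrite dtgt_flip.
move=> /andP [w1 w2].
have [W [y [wW E]]] := bd_power1 f.
rewrite /= cats0 in E; rewrite -E in wW.
suff <- : pend (pend u s1) (bdpath f) = pend u s1 by [].
move: w1 wW; rewrite /bdpath codomE enum_ordSl /=.
move=> /andP [/eqP <- _] /andP [/eqP e w]; rewrite e.
exact: walk_end w.
Qed.

(** Only reflexivity relates lists of darts which are not paths. *)
Lemma homotopic_walk u v s t : homotopic u v s t -> s = t \/ walk u s v /\ walk u t v.
Proof.
elim=> {s t} [s t /hstep_walk|s|s t _|s t z _ IH1 _ IH2]; first by right.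
- by left.
- by case=> [->|[]]; [left|right].
- case: IH1 IH2 => [->|[ws wt]] //; case=> [<-|[_ wz]]; by right.
Qed.

Lemma homotopic_refl u v s : homotopic u v s s.
Proof. exact: rst_refl. Qed.

Lemma homotopic_sym u v s t : homotopic u v s t -> homotopic u v t s.
Proof. exact: rst_sym. Qed.

Lemma homotopic_trans u v s t z :
  homotopic u v s t -> homotopic u v t z -> homotopic u v s z.
Proof. exact: rst_trans. Qed.

Lemma homotopic_ctx x u v y a b s t : walk x a u -> walk v b y ->
  homotopic u v s t -> homotopic x y (a ++ s ++ b) (a ++ t ++ b).
Proof.
move=> wa wb; apply: (rst_map (h := fun s => a ++ s ++ b)) => {}s {}t st.
apply: rst_step.
have [ws _] := hstep_walk st.
have := walk_catI wa (walk_catI ws wb).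
case: st => s1 => [d|f] s2 _ w.
  by have := @HBacktrack X x y (a ++ s1) d (s2 ++ b); rewrite -!catA in w *; apply.
by have := @HCell X x y (a ++ s1) f (s2 ++ b); rewrite -!catA in w *; apply.
Qed.

Lemma homotopic_catl x u v a s t : walk x a u ->
  homotopic u v s t -> homotopic x v (a ++ s) (a ++ t).
Proof.
move=> wa st; have wb : walk v [::] v by rewrite /=.
by have := homotopic_ctx wa wb st; rewrite !cats0.
Qed.

Lemma homotopic_catr u v y b s t : walk v b y ->
  homotopic u v s t -> homotopic u y (s ++ b) (t ++ b).
Proof. by move=> wb; apply: (@homotopic_ctx u u v y [::]); rewrite /=. Qed.

Lemma homotopic_cat u v y s t s' t' : walk u t v -> walk v s' y ->
  homotopic u v s t -> homotopic v y s' t' -> homotopic u y (s ++ s') (t ++ t').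
Proof.
move=> wt ws' h h'; apply: homotopic_trans (homotopic_catr ws' h) _.
exact: homotopic_catl wt h'.
Qed.

Lemma homotopic_inv u s v : walk u s v -> homotopic u u (s ++ inv_path s) [::].
Proof.
elim: s u => [|d s IH] u /=; first by move=> _; apply: homotopic_refl.
move=> /andP [/eqP <- w]; rewrite inv_path_cons -cats1.
have wd : walk (dsrc d) [:: d] (dtgt d) by rewrite /= !eqxx.
have wd' : walk (dtgt d) [:: dflip d] (dsrc d) by have := walk_inv wd.
have := homotopic_ctx wd wd' (IH _ w); rewrite /= catA => h.
apply: homotopic_trans h _; apply: rst_step.
apply: (@HBacktrack X _ _ [::] d [::]).
exact: walk_catI wd wd'.
Qed.

Lemma homotopic_invl u s v : walk u s v -> homotopic v v (inv_path s ++ s) [::].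
Proof. by move=> /walk_inv /homotopic_inv; rewrite inv_pathK. Qed.

Lemma homotopic_inv_path u v s t :
  homotopic u v s t -> homotopic v u (inv_path s) (inv_path t).
Proof.
move=> h; case: (homotopic_walk h) => [->|[ws wt]]; first exact: homotopic_refl.
apply: (@homotopic_trans _ _ _ (inv_path s ++ (t ++ inv_path t))).
  rewrite -{1}[inv_path s]cats0; apply: homotopic_catl (walk_inv ws) _.
  exact/homotopic_sym/(homotopic_inv wt).
rewrite catA -[X in homotopic _ _ _ X]cat0s.
apply: homotopic_catr (walk_inv wt) _.
apply: homotopic_trans (homotopic_invl ws).
exact: homotopic_catl (walk_inv ws) (homotopic_sym h).
Qed.

(** The length [m] may exceed the degree of [f]: the path then winds around, and
    concatenation needs no side condition. *)

Definition bdsub f (i : 'I_(degm1 f).+1) (m : nat) : seq (dart X) :=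
  [seq bd f (i + inZp k)%R | k <- iota 0 m].

Lemma inZpD n a b : inZp (a + b) = (inZp a + inZp b)%R :> 'I_n.+1.
Proof. by apply: val_inj; rewrite /= modnDm. Qed.

Lemma inZp_deg f : inZp (deg f) = 0%R :> 'I_(degm1 f).+1.
Proof. by apply: val_inj; rewrite /= modnn. Qed.

Lemma inZp_val n (i : 'I_n.+1) : inZp i = i.
Proof. by apply: val_inj; rewrite /= modn_small. Qed.

Lemma ordS_inZp n (i : 'I_n.+1) : ordS i = (i + inZp 1)%R.
Proof. by apply: val_inj; rewrite /= modnDmr addn1. Qed.

Lemma bdsub_cat f i m1 m2 :
  bdsub i (m1 + m2) = bdsub i m1 ++ bdsub (f := f) (i + inZp m1)%R m2.
Proof.
rewrite /bdsub iotaD map_cat add0n; congr (_ ++ _).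
rewrite -{1}[m1]addn0 iotaDl -map_comp; apply: eq_map => k /=.
by rewrite inZpD addrA.
Qed.

Lemma bdsub1 f i : bdsub (f := f) i 1 = [:: bd f i].
Proof. by rewrite /bdsub /= (_ : inZp 0 = 0%R) ?addr0 //; apply: val_inj. Qed.

Lemma bdsubS f i m : bdsub i m.+1 = bd f i :: bdsub (ordS i) m.
Proof. by rewrite -add1n bdsub_cat bdsub1 ordS_inZp. Qed.

Lemma bdsub_rcons f (i : 'I_(degm1 f).+1) m :
  bdsub i m.+1 = rcons (bdsub i m) (bd f (i + inZp m)%R).
Proof. by rewrite -addn1 bdsub_cat bdsub1 cats1. Qed.

Lemma bdpathE f : bdpath f = bdsub (0%R : 'I_(degm1 f).+1) (deg f).
Proof.
rewrite /bdpath /bdsub codomE -val_enum_ord -map_comp; apply: eq_map => i /=.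
by rewrite add0r inZp_val.
Qed.

Lemma dtgt_bd f (i : 'I_(degm1 f).+1) : dtgt (bd f i) = dsrc (bd f (ordS i)).
Proof. by rewrite /dtgt /dsrc bd_closed. Qed.

Lemma walk_bdsub f i m :
  walk (dsrc (bd f i)) (bdsub i m) (dsrc (bd f (i + inZp m)%R)).
Proof.
elim: m i => [|m IH] i; first by rewrite /= (_ : inZp 0 = 0%R) ?addr0 //; apply: val_inj.
rewrite bdsubS /= eqxx dtgt_bd /=.
have -> : (i + inZp m.+1)%R = (ordS i + inZp m)%R; last exact: IH.
by rewrite ordS_inZp -addrA -inZpD.
Qed.

Lemma walk_bdloop f i : walk (dsrc (bd f i)) (bdsub i (deg f)) (dsrc (bd f i)).
Proof. by have := walk_bdsub i (deg f); rewrite inZp_deg addr0. Qed.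

Lemma bdsub_turn f (i : 'I_(degm1 f).+1) m :
  bdsub i m ++ bdsub (i + inZp m)%R (deg f) = bdsub i (deg f) ++ bdsub i m.
Proof. by rewrite -bdsub_cat addnC bdsub_cat inZp_deg addr0. Qed.

Lemma bdsub_rotate f (k : 'I_(degm1 f).+1) :
  bdsub (f := f) 0%R k ++ bdsub k (deg f) = bdsub (f := f) 0%R (deg f) ++ bdsub (f := f) 0%R k.
Proof. by rewrite -bdsub_turn add0r inZp_val. Qed.

(** Moves delete boundary paths read from corner 0 only; a boundary path read from
    corner [i] is conjugate to it by the arc from corner 0 to corner [i]. *)
Lemma homotopic_bdloop f i :
  homotopic (dsrc (bd f i)) (dsrc (bd f i)) (bdsub i (deg f)) [::].
Proof.
set v := dsrc (bd f i); set v0 := dsrc (bd f 0%R).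
have w0 : walk v0 (bdsub (f := f) 0%R i) v.
  by have := walk_bdsub (0%R : 'I_(degm1 f).+1) i; rewrite add0r inZp_val.
have wi := walk_bdloop i; have w0l := walk_bdloop (0%R : 'I_(degm1 f).+1).
have h1 : homotopic v0 v (bdsub (f := f) 0%R i ++ bdsub i (deg f)) (bdsub (f := f) 0%R i).
  rewrite bdsub_rotate -[X in homotopic _ _ _ X]cat0s; apply: homotopic_catr w0 _.
  apply: rst_step; have := @HCell X v0 v0 [::] f [::].
  by rewrite /= cats0 bdpathE; apply.
apply: (@homotopic_trans _ _ _ 
  (inv_path (bdsub (f := f) 0%R i) ++ (bdsub (f := f) 0%R i ++ bdsub i (deg f)))).
  rewrite catA -{1}[bdsub i (deg f)]cat0s; apply: homotopic_catr wi _.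
  exact: homotopic_sym (homotopic_invl w0).
apply: homotopic_trans (homotopic_catl (walk_inv w0) h1) _.
exact: homotopic_invl w0.
Qed.

Lemma bdsub_period f i j m :
  bdsub (f := f) (i + inZp (j * period f))%R m = bdsub i m.
Proof. by apply: eq_map => k; rewrite addrAC bd_period. Qed.

Lemma bdsub_packet f (j : 'I_(exponent f)) m :
  bdsub (f := f) (packet_rot j) m = bdsub (f := f) 0%R m.
Proof. by rewrite -[packet_rot j]add0r bdsub_period. Qed.

Lemma inZp_0 f : inZp 0 = 0%R :> 'I_(degm1 f).+1.
Proof. exact: val_inj. Qed.

End Paths.

(** * The full complex over a partial action of the darts

    A graph immersed in the 1-skeleton of X is a set of states on which darts act
    partially, inverse darts by inverse partial maps.  Attaching all the 2-cells whose
    boundary is closed in the graph gives a packed complex: the packet of a 2-cell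
    consists of 2-cells with the same boundary circle. *)

Section Runs.
Variables (St A : Type) (delta : St -> A -> option St).

Definition run (u : St) (s : seq A) : option St :=
  foldl (fun o d => obind (delta^~ d) o) (Some u) s.

Lemma run_none s : foldl (fun o d => obind (delta^~ d) o) None s = None.
Proof. by elim: s. Qed.

Lemma run_cons u d s : run u (d :: s) = obind (run^~ s) (delta u d).
Proof. by rewrite /run /=; case: (delta u d) => //; apply: run_none. Qed.

Lemma run_cat u s t : run u (s ++ t) = obind (run^~ t) (run u s).
Proof. by rewrite /run foldl_cat; case: (foldl _ (Some u) s) => //; apply: run_none. Qed.

Lemma run_rcons u s d : run u (rcons s d) = obind (delta^~ d) (run u s).
Proof. by rewrite /run foldl_rcons. Qed.

End Runs.

Section FullComplex.
Variables (X : complex) (St : choiceType) (delta : St -> dart X -> option St).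
Hypothesis delta_inv : forall u d v, delta u d = Some v -> delta v (dflip d) = Some u.
Variables (u0 : St) (x0 : vert X).

Implicit Types (u : St) (d : dart X) (f : face X).

Definition reach (p : St * vert X) : Prop :=
  exists s, walk x0 s p.2 /\ run delta u0 s = Some p.1.

Lemma reach_step u d v : reach (u, dsrc d) -> delta u d = Some v -> reach (v, dtgt d).
Proof.
move=> [s /= [w r]] E; exists (rcons s d); rewrite run_rcons r /= E; split=> //.
by rewrite walk_rcons w (walk_end w) !eqxx.
Qed.

(** A vertex is a state together with its image in X, so that a partial action need
    not record to which vertices of X its states belong. *)
Definition fvert : choiceType := {p : St * vert X | `[< reach p >]}.
Definition fedge : choiceType := {p : St * edge X |
  `[< reach (p.1, esrc p.2) >] && isSome (delta p.1 (p.2, false))}.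
Definition fface : choiceType := {p : St * face X |
  `[< reach (p.1, dsrc (bd p.2 0%R)) >] &&
  (run delta p.1 (bdsub (f := p.2) 0%R (deg p.2)) == Some p.1)}.

Definition mkvert p (r : reach p) : fvert := exist _ p (introT (asboolP _) r).

Lemma fvert_reach (y : fvert) : reach (val y).
Proof. exact/asboolP/(valP y). Qed.

Fact fsrc_reach (e : fedge) : reach ((val e).1, esrc (val e).2).
Proof. by case/andP: (valP e) => /asboolP. Qed.

Definition fsrc (e : fedge) : fvert := mkvert (fsrc_reach e).

Fact ftgt_reach (e : fedge) :
  reach (odflt u0 (delta (val e).1 ((val e).2, false)), etgt (val e).2).
Proof.
case/andP: (valP e); case E: (delta _ _) => [v|] // _ _ /=.
exact: (reach_step (d := ((val e).2, false)) (fsrc_reach e) E).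
Qed.

Definition ftgt (e : fedge) : fvert := mkvert (ftgt_reach e).

Definition down (y : dartT fedge) : dart X := ((val y.1).2, y.2).

Lemma delta_edge (e : fedge) :
  delta (val e).1 ((val e).2, false) = Some (val (ftgt e)).1.
Proof. by case/andP: (valP e) => /=; case: (delta _ _). Qed.

Lemma delta_down (y : dartT fedge) :
  delta (val (dfrom fsrc ftgt y)).1 (down y) =
  Some (val (dfrom fsrc ftgt (dflip y))).1.
Proof.
case: y => e []; rewrite /dfrom /down; last exact: delta_edge.
exact: (delta_inv (delta_edge e)).
Qed.

Lemma dfrom_down (y : dartT fedge) : (val (dfrom fsrc ftgt y)).2 = dsrc (down y).
Proof. by case: y => e []. Qed.

Lemma down_flip (y : dartT fedge) : down (dflip y) = dflip (down y).
Proof. by []. Qed.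

(** The map to X is an immersion of 1-skeleta because darts act as functions. *)
Lemma down_inj (y z : dartT fedge) :
  dfrom fsrc ftgt y = dfrom fsrc ftgt z -> down y = down z -> y = z.
Proof.
move=> yz dyz; have E1 := delta_down y; have E2 := delta_down z.
rewrite -yz -dyz E1 in E2; case: E2 => E2.
suff : fsrc y.1 = fsrc z.1.
  move=> /(congr1 (fun p => (val p).1)) /= Es.
  case: y z dyz {yz E1 E2} Es => e b [e' b'] /= [Ee ->] Es.
  congr (_, _); apply: val_inj.
  by rewrite [LHS]surjective_pairing [RHS]surjective_pairing; congr (_, _).
apply: val_inj => /=; have := congr1 (fun d : dart X => d.1) dyz => /= ->.
congr (_, _).
move: yz E2 (congr1 (fun d : dart X => d.2) dyz) => /=.
rewrite /dfrom; case: y {E1 dyz} => e [] /=; case: z => e' b' /= yz E2 b; subst b' => //=.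
by have /= := congr1 (fun p => (val p).1) yz.
Qed.

Lemma lift_dart (p : fvert) d :
  (val p).2 = dsrc d -> isSome (delta (val p).1 d) ->
  exists y : dartT fedge, dfrom fsrc ftgt y = p /\ down y = d.
Proof.
case: d => e b pd; case E: (delta _ _) => [v|] // _.
have rp : reach ((val p).1, dsrc (e, b)) by rewrite -pd -surjective_pairing; apply: fvert_reach.
have E' := delta_inv E; have rv := reach_step rp E.
case: b => [|] in pd E E' rp rv *.
  have H : `[< reach (v, esrc e) >] && isSome (delta v (e, false)).
    by rewrite (asboolT rv) /=; move: E'; rewrite /dflip /= => ->.
  exists (exist _ (v, e) H, true); split=> //; apply: val_inj => /=.
  by move: E'; rewrite /dflip /= => ->; rewrite /= (surjective_pairing (val p)) pd.
have H : `[< reach ((val p).1, esrc e) >] && isSome (delta (val p).1 (e, false)).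
  by rewrite (asboolT rp) E.
exists (exist _ ((val p).1, e) H, false); split=> //; apply: val_inj => /=.
by rewrite (surjective_pairing (val p)) pd.
Qed.

Section Face.
Variable F : fface.
Let f := (val F).2.
Let u := (val F).1.

Lemma fface_run : run delta u (bdsub (f := f) 0%R (deg f)) = Some u.
Proof. by case/andP: (valP F) => _ /eqP. Qed.

Lemma fface_reach : reach (u, dsrc (bd f 0%R)).
Proof. by case/andP: (valP F) => /asboolP. Qed.

Definition fstate (i : 'I_(degm1 f).+1) : St :=
  odflt u0 (run delta u (bdsub (f := f) 0%R i)).

Lemma run_prefix m : m <= deg f -> isSome (run delta u (bdsub (f := f) 0%R m)).
Proof.
move=> le; have := fface_run; rewrite -(subnKC le) bdsub_cat run_cat.
by case: (run delta u _).
Qed.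

Lemma run_fstate (i : 'I_(degm1 f).+1) :
  run delta u (bdsub (f := f) 0%R i) = Some (fstate i).
Proof.
by rewrite /fstate; have := run_prefix (ltnW (ltn_ord i)); case: (run _ _ _).
Qed.

Lemma fstate0 : fstate 0%R = u. Proof. by []. Qed.

Lemma fstateS (i : 'I_(degm1 f).+1) :
  delta (fstate i) (bd f i) = Some (fstate (ordS i)).
Proof.
have : run delta u (bdsub (f := f) 0%R i.+1) = Some (fstate (ordS i)).
  case: (ltnP i.+1 (deg f)) => lt.
    have e : ordS i = i.+1 :> nat by rewrite /= modn_small.
    by rewrite -e run_fstate.
  have e : i.+1 = deg f by apply/eqP; rewrite eqn_leq lt ltn_ord.
  have -> : ordS i = 0%R by apply: val_inj; rewrite /= e modnn.
  by rewrite e fface_run fstate0.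
by rewrite bdsub_rcons run_rcons run_fstate /= add0r inZp_val.
Qed.

Lemma fcorner_reach i : reach (fstate i, dsrc (bd f i)).
Proof.
have [s [w r]] := fface_reach; exists (s ++ bdsub (f := f) 0%R i).
rewrite run_cat r /= run_fstate; split=> //; apply: walk_catI w _.
by have := walk_bdsub (0%R : 'I_(degm1 f).+1) i; rewrite add0r inZp_val.
Qed.

Definition fcorner i : fvert := mkvert (fcorner_reach i).

Fact fbd_exists i : exists y : dartT fedge,
  dfrom fsrc ftgt y = fcorner i /\ down y = bd f i.
Proof. by apply: lift_dart => //=; rewrite fstateS. Qed.

Definition fbd i : dartT fedge := projT1 (cid (fbd_exists i)).

Lemma fbd_from i : dfrom fsrc ftgt (fbd i) = fcorner i.
Proof. by rewrite /fbd; case: cid => y [/= -> _]. Qed.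

Lemma fbd_down i : down (fbd i) = bd f i.
Proof. by rewrite /fbd; case: cid => y [/= _ ->]. Qed.

End Face.

Fact fbd_closed (F : fface) i :
  dfrom fsrc ftgt (fbd (F := F) (ordS i)) = dfrom fsrc ftgt (dflip (fbd i)).
Proof.
rewrite fbd_from; apply: val_inj; apply/eqP; rewrite -pair_eqE /=.
rewrite dfrom_down down_flip fbd_down -dtgt_bd eqxx andbT.
have := delta_down (fbd i); rewrite fbd_from fbd_down fstateS => -[->].
by rewrite eqxx.
Qed.

Fact fbd_immersed (F : fface) i : fbd (F := F) (ordS i) <> dflip (fbd i).
Proof.
by move=> /(congr1 down); rewrite down_flip !fbd_down; apply: bd_immersed.
Qed.

(** The 2-cells of the full complex are all the closed lifts of 2-cells of X; only
    the component of the base point is kept, so that it is connected. *)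
Definition full_complex : complex := Complex fbd_closed fbd_immersed.

Let Y := full_complex.

Fact fphi_src (d : dart Y) :
  (val (dsrc d)).2 = dsrc (dmap_of (fun e : edge Y => ((val e).2, false) : dart X) d).
Proof. by case: d => e []. Qed.

Fact fphi_bij (F : face Y) :
  bijective (id : 'I_(degm1 F).+1 -> 'I_(degm1 (val F).2).+1).
Proof. by exists id. Qed.

Fact fphi_cyc (F : face Y) (i : 'I_(degm1 F).+1) :
  if false then ordS (id (ordS i)) = id i else id (ordS i) = ordS (id i).
Proof. by []. Qed.

Fact fphi_bd (F : face Y) (i : 'I_(degm1 F).+1) :
  dmap_of (fun e : edge Y => ((val e).2, false) : dart X) (bd F i) =
  dturn false (bd (val F).2 (id i)).
Proof.
rewrite /= -(fbd_down i) /dmap_of /dturn /down /=.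
by case: (fbd i) => e b /=; rewrite addbF.
Qed.

Definition fphi : cmap Y X := @CMap Y X (fun y => (val y).2)
  (fun e => ((val e).2, false)) (fun F => (val F).2) (fun=> false)
  (fun F => id) fphi_src fphi_bij fphi_cyc fphi_bd.

Lemma fphi_down (y : dart Y) : dmap fphi y = down y.
Proof. by case: y => e b; rewrite /dmap /dmap_of /dturn /= addbF. Qed.

Lemma fphi_immersion : immersion1 fphi.
Proof. by move=> y z; rewrite !fphi_down; apply: down_inj. Qed.

Definition state (y : vert Y) : St := (val y).1.

Lemma state_eq (y z : vert Y) : state y = state z -> vmap fphi y = vmap fphi z -> y = z.
Proof.
move=> e1 e2; apply: val_inj.
by rewrite [LHS]surjective_pairing [RHS]surjective_pairing; congr (_, _).
Qed.

Lemma run_walk (y z : vert Y) (s : seq (dart Y)) : walk y s z ->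
  run delta (state y) (map (dmap fphi) s) = Some (state z).
Proof.
elim: s y => [|d s IH] y /=; first by move/eqP->.
move=> /andP [/eqP <- /IH r]; rewrite run_cons fphi_down.
by rewrite [delta _ _](delta_down d).
Qed.

Lemma walk_lift (y : vert Y) s v u : walk (vmap fphi y) s v ->
  run delta (state y) s = Some u ->
  exists t z, [/\ walk y t z, map (dmap fphi) t = s, state z = u & vmap fphi z = v].
Proof.
elim: s y => [|d s IH] y /=.
  by move=> /eqP <- [<-]; exists [::], y; rewrite /= eqxx.
rewrite run_cons => /andP [/eqP pd w]; case E: (delta _ _) => [u'|] //= r.
have [|e [ey ed]] := @lift_dart y d (esym pd); first by rewrite E.
have /= D := delta_down e; rewrite ey ed E in D; case: D => D.
have [||t [z [wt mt sz vz]]] := IH (dtgt (e : dart Y)).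
- by rewrite [vmap _ _]dfrom_down down_flip ed.
- by rewrite [state _](esym D).
exists (e :: t), z; split=> //=; last by rewrite fphi_down ed mt.
by rewrite wt andbT; apply/eqP.
Qed.

Fact base_reach : reach (u0, x0).
Proof. by exists [::]; rewrite /= eqxx. Qed.

Definition base : vert Y := mkvert base_reach.

Lemma full_connected : connected Y.
Proof.
split; first by split; exact: base.
have from_base y : exists s, walk base s y.
  have [s [w r]] := fvert_reach y.
  have [t [z [wt _ sz vz]]] := @walk_lift base _ _ _ w r.
  by exists t; rewrite -(state_eq sz vz).
move=> y z; have [[s ws] [t wt]] := (from_base y, from_base z).
by exists (inv_path s ++ t); apply: walk_catI (walk_inv ws) wt.
Qed.

Lemma run_fcorner (F : face Y) i m :
  run delta (fstate (F := F) i) (bdsub i m) = Some (fstate (F := F) (i + inZp m)%R).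
Proof.
elim: m => [|m IH]; first by rewrite (_ : inZp 0 = 0%R) ?addr0 //; apply: val_inj.
by rewrite bdsub_rcons run_rcons IH /= fstateS ordS_inZp -addrA -inZpD addn1.
Qed.

Lemma run_face (F : face Y) m :
  run delta (val F).1 (bdsub (f := (val F).2) 0%R m) = Some (fstate (F := F) (inZp m)).
Proof. by have := @run_fcorner F 0%R m; rewrite add0r. Qed.

Section PacketLift.
Variable F : face Y.
Let f := (val F).2.

(** The lift of the packet of [f] extending [F]: its copy [j] of [f] is the 2-cell
    closed at the state reached from that of [F] after [j] periods. *)
Fact rotated_face (j : 'I_(exponent f)) :
  `[< reach (fstate (F := F) (packet_rot j), dsrc (bd f 0%R)) >] &&
  (run delta (fstate (F := F) (packet_rot j)) (bdsub (f := f) 0%R (deg f))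
     == Some (fstate (F := F) (packet_rot j))).
Proof.
have := @fcorner_reach F (packet_rot j).
have E : bd (val F).2 (packet_rot j) = bd f 0%R.
  by rewrite -[packet_rot j]add0r packet_rotP.
rewrite E => /asboolT -> /=.
have := @run_fcorner F (packet_rot j) (deg f); rewrite inZp_deg addr0.
by rewrite bdsub_packet => ->.
Qed.

Definition rotate_face j : face Y := exist _ (fstate (F := F) (packet_rot j), f) (rotated_face j).

Let sv (i : vert (packet f)) : vert Y := fcorner (F := F) i.
Let se (i : edge (packet f)) : dart Y := fbd (F := F) i.
Let sf (j : face (packet f)) : face Y := rotate_face j.
Let ss (j : face (packet f)) (i : 'I_(degm1 j).+1) : 'I_(degm1 (sf j)).+1 := i.

Fact pl_src (d : dart (packet f)) : sv (dsrc d) = dsrc (dmap_of se d).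
Proof.
case: d => i []; rewrite /dmap_of /dturn; last first.
  by rewrite [dsrc _]/= addFb -surjective_pairing; apply/esym/fbd_from.
exact: etrans (esym (fbd_from _)) (fbd_closed i).
Qed.

Fact pl_bij (j : face (packet f)) : bijective (@ss j).
Proof. by exists id. Qed.

Fact pl_cyc (j : face (packet f)) (i : 'I_(degm1 j).+1) :
  if false then ordS (ss (ordS i)) = ss i else ss (ordS i) = ordS (ss i).
Proof. by []. Qed.

Fact pl_bd (j : face (packet f)) (i : 'I_(degm1 j).+1) :
  dmap_of se (bd j i) = dturn false (bd (sf j) (ss i)).
Proof.
rewrite /dmap_of /dturn /= ?addFb -!surjective_pairing.
apply: down_inj; last by rewrite !fbd_down packet_rotP.
rewrite !fbd_from; apply: state_eq; last by rewrite /= packet_rotP.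
apply: Some_inj; rewrite addrC -{1}[i]inZp_val -run_fcorner.
have := run_face (sf j) i; rewrite inZp_val => <-.
by rewrite -(bdsub_packet j).
Qed.

Definition packet_lift : cmap (packet f) Y :=
  @CMap (packet f) Y sv se sf (fun=> false) ss pl_src pl_bij pl_cyc pl_bd.

Lemma packet_lift_over : ceq (ccomp fphi packet_lift) (packet_map f).
Proof. by split=> // e; rewrite /= fphi_down fbd_down. Qed.

Lemma rotate_face0 : rotate_face (Ordinal (exponent_gt0 f)) = F.
Proof.
apply: val_inj; rewrite /= [RHS]surjective_pairing; congr (_, _).
Qed.

End PacketLift.

Lemma dmap_fwd (Z W : complex) (rho : cmap Z W) (e : edge Z) : dmap rho (e, false) = emap rho e.
Proof. by rewrite /dmap /dmap_of /dturn /= -surjective_pairing. Qed.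

Lemma fphi_packed : packed fphi.
Proof.
move=> f rho H.
pose y (k : 'I_(degm1 f).+1) : vert Y := vmap rho (k : vert (cell f)).
pose e (k : 'I_(degm1 f).+1) : dart Y := emap rho (k : edge (cell f)).
have srcE k : dsrc (e k) = y k.
  by rewrite /e -dmap_fwd; apply: (esym (vmap_src rho (k, false))).
have tgtE k : dtgt (e k) = y (ordS k) by exact: (esym (vmap_src rho (k, true))).
have downE k : down (e k) = bd f k.
  by rewrite -fphi_down; apply: (ceq_e H k).
have yE k : vmap fphi (y k) = dsrc (bd f k) by exact: (ceq_v H k).
have runE i m : run delta (state (y i)) (bdsub i m) = Some (state (y (i + inZp m)%R)).
  elim: m => [|m IH]; first by rewrite inZp_0 addr0.
  rewrite bdsub_rcons run_rcons IH /=.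
  have := delta_down (e (i + inZp m)%R); rewrite downE [dfrom _ _ _]srcE.
  by rewrite [dfrom _ _ _]tgtE ordS_inZp -addrA -inZpD addn1.
have HF : `[< reach (state (y 0%R), dsrc (bd f 0%R)) >] &&
  (run delta (state (y 0%R)) (bdsub (f := f) 0%R (deg f)) == Some (state (y 0%R))).
  rewrite runE inZp_deg addr0 eqxx andbT; apply/asboolP.
  by rewrite -yE -surjective_pairing; apply: fvert_reach.
pose F : face Y := exist _ (state (y 0%R), f) HF.
have cornerE (k : 'I_(degm1 f).+1) : fcorner (F := F) k = y k.
  apply: state_eq; last by rewrite yE.
  have := run_face F k; rewrite inZp_val => E; apply: Some_inj.
  by rewrite -[LHS]E runE add0r inZp_val.
have bdE (k : 'I_(degm1 f).+1) : fbd (F := F) k = e k.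
  by apply: down_inj; rewrite ?fbd_from ?cornerE ?fbd_down ?downE // [RHS]srcE.
have oriE g : fori rho g = false by have := ceq_o H g.
have sideE g (i : 'I_(degm1 f).+1) : fside rho g i = i :> nat by exact: (ceq_s H i).
exists (packet_lift F); split; first exact (packet_lift_over F).
split.
- by move=> v; apply: cornerE.
- by move=> k; rewrite [LHS]dmap_fwd; apply: bdE.
- move=> g; rewrite [LHS](rotate_face0 F); apply: val_inj.
  rewrite [RHS]surjective_pairing; congr (_, _); last exact (esym (ceq_f H g)).
  have E0 : fside rho g (0%R : 'I_(degm1 f).+1) = 0%R by apply: val_inj; rewrite /= sideE.
  have := @fside_bd _ _ rho g (0%R : 'I_(degm1 f).+1); rewrite E0 oriE.
  move=> /(congr1 (fun d : dart Y => state (dsrc d))).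
  rewrite /dmap_of /dturn /= ?addFb -!surjective_pairing addr0 srcE => ->.
  by rewrite [dsrc _]fbd_from.
- by move=> g; rewrite oriE.
- by move=> g i; rewrite sideE.
Qed.

Section Reduction.
Variable w : weighting X.

(** Whether an attachment is a perimeter reduction depends on the 2-cell and the subpath
    alone, and for these there are finitely many choices when X is compact. *)
Definition reducing f (i : 'I_(degm1 f).+1) m : Prop :=
  m <= deg f /\
  perimeter w (packet_map f) < perimeter w (ccomp (cell_map f) (subpath i m)).

Hypothesis closedT : forall f (i : 'I_(degm1 f).+1) m, reducing i m ->
  forall u, isSome (run delta u (bdsub i m)) -> run delta u (bdsub i (deg f)) = Some u.

(** If the boundary of [f] closes up wherever a reducing subpath of it can be read,
    then every such subpath in the full complex extends to a lift of the packet. *)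
Lemma no_reduction f (i : 'I_(degm1 f).+1) (m : nat) (q : cmap (Defs.interval m) Y) :
  ~ perimeter_reduction w fphi i q.
Proof.
case=> -[lem H nosigma] ltP; apply: nosigma.
pose y (k : 'I_m.+1) : vert Y := vmap q (k : vert (Defs.interval m)).
pose e (k : 'I_m) : dart Y := emap q (k : edge (Defs.interval m)).
have srcE k : dsrc (e k) = y (widen_ord (leqnSn m) k).
  by rewrite /e -dmap_fwd; apply: (esym (vmap_src q (k, false))).
have tgtE k : dtgt (e k) = y (lift ord0 k) by exact: (esym (vmap_src q (k, true))).
have downE (k : 'I_m) : down (e k) = bd f (i + inZp k)%R.
  rewrite -fphi_down [LHS](ceq_e H k).
  by rewrite /= /dmap /dmap_of /dturn /= -surjective_pairing.
have yE (k : 'I_m.+1) : vmap fphi (y k) = dsrc (bd f (i + inZp k)%R).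
  exact: (ceq_v H k).
pose u := state (y ord0).
have runE k (lt : k < m.+1) : run delta u (bdsub i k) = Some (state (y (Ordinal lt))).
  elim: k lt => [|k IH] lt.
    by congr (Some (state (y _))); apply: val_inj.
  have lt' : k < m by [].
  rewrite bdsub_rcons run_rcons (IH (ltnW lt)) /=.
  have := delta_down (e (Ordinal lt')); rewrite downE [dfrom _ _ _]srcE.
  rewrite [dfrom _ _ _]tgtE (_ : widen_ord _ _ = Ordinal (ltnW lt)); last exact: val_inj.
  by move=> ->; congr (Some (state (y _))); apply: val_inj.
have loop : run delta u (bdsub i (deg f)) = Some u.
  by apply: (closedT (conj lem ltP)); rewrite (runE m (ltnSn m)).
have lei : i <= deg f by apply: ltnW.
have [u' ru'] : exists u', run delta u (bdsub i (deg f - i)) = Some u'.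
  move: loop; rewrite -{1}(subnK lei) bdsub_cat run_cat.
  by case: (run delta u _) => // u' _; exists u'.
have i0 : (i + inZp (deg f - i) = 0 :> 'I_(degm1 f).+1)%R.
  by rewrite -{1}[i]inZp_val -inZpD subnKC // inZp_deg.
have HF : `[< reach (u', dsrc (bd f 0%R)) >] &&
  (run delta u' (bdsub (f := f) 0%R (deg f)) == Some u').
  apply/andP; split; last first.
    have := congr1 (run delta u) (bdsub_turn i (deg f - i)).
    by rewrite !run_cat loop ru' /= i0 ru' => ->.
  apply/asboolP; have [s [/= ws rs]] := fvert_reach (y ord0).
  exists (s ++ bdsub i (deg f - i)); rewrite run_cat rs /=; split; last exact: ru'.
  have := yE ord0; rewrite /= inZp_0 addr0 => yE0; rewrite yE0 in ws.
  by apply: walk_catI ws _; have := walk_bdsub i (deg f - i); rewrite i0.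
pose F : face Y := exist _ (u', f) HF.
have st_i : fstate (F := F) i = u.
  apply: Some_inj; have := run_face F i; rewrite inZp_val => <-; rewrite -loop.
  by rewrite -[in RHS](subnK lei) bdsub_cat run_cat ru' i0.
have cornerE (k : 'I_m.+1) : fcorner (F := F) (i + inZp k)%R = y k.
  apply: state_eq; last by rewrite yE.
  apply: Some_inj; have := @run_fcorner F i k; rewrite st_i => E; rewrite -[LHS]E.
  by case: k {E} => k lt; rewrite (runE k lt).
exists (packet_lift F); split; first exact (packet_lift_over F).
split=> //.
move=> k; rewrite [LHS]/= dmap_fwd; apply: down_inj; last first.
  rewrite [RHS]downE -[in RHS](fbd_down (F := F)).
  by rewrite /= /dmap /dmap_of /dturn /= ?addFb -!surjective_pairing.
rewrite [RHS]srcE.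
have -> : emap (ccomp (packet_lift F) (cell_incl f)) (i + inZp k)%R = fbd (F := F) (i + inZp k)%R.
  exact: (dmap_fwd (packet_lift F)).
by rewrite fbd_from -cornerE.
Qed.

Inductive lstep : seq (dart X) -> seq (dart X) -> Prop :=
| LBack s1 d s2 : isSome (run delta u0 (s1 ++ [:: d; dflip d] ++ s2)) ->
    lstep (s1 ++ [:: d; dflip d] ++ s2) (s1 ++ s2)
| LCell s1 f s2 u : run delta u0 s1 = Some u -> run delta u (bdpath f) = Some u ->
    lstep (s1 ++ bdpath f ++ s2) (s1 ++ s2).

(** The reduction hypothesis makes the map from the full complex to X injective on
    fundamental groups, and a homotopy in the full complex is a sequence of moves on
    paths of X along which the partial action can follow. *)
Theorem full_pi1_injective : reduction_hypothesis w -> forall s1 s2,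
  walk x0 s1 x0 -> walk x0 s2 x0 ->
  run delta u0 s1 = Some u0 -> run delta u0 s2 = Some u0 ->
  homotopic x0 x0 s1 s2 -> rst lstep s1 s2.
Proof.
move=> RH s1 s2 w1 w2 r1 r2 h12.
have inj : pi1_injective fphi.
  apply: contrapT => ninj.
  have [f [i [m [q]]]] := RH _ _ full_connected fphi_packed fphi_immersion ninj.
  exact: no_reduction.
have [t1 [z1 [wt1 mt1 sz1 vz1]]] := @walk_lift base _ _ _ w1 r1.
have [t2 [z2 [wt2 mt2 sz2 vz2]]] := @walk_lift base _ _ _ w2 r2.
rewrite (state_eq (y := z1) (z := base) sz1 vz1) in wt1.
rewrite (state_eq (y := z2) (z := base) sz2 vz2) in wt2.
rewrite -mt1 -mt2 in h12 *.
have := inj base t1 t2 wt1 wt2 h12.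
apply: rst_map => s s' st; apply: rst_step.
have [ws _] := hstep_walk st.
case: st ws => a => [d|F] b _ ws.
  have := run_walk ws; rewrite !map_cat /= [dmap fphi (dflip d)](_ : _ = dflip (dmap fphi d)).
    by move=> r; apply: LBack; rewrite r.
  by rewrite !fphi_down.
rewrite !map_cat.
have -> : map (dmap fphi) (bdpath F) = bdpath (val F).2.
  by rewrite /bdpath /codom /image_mem -map_comp; apply: eq_map => i /=;
    rewrite fphi_down fbd_down.
move: ws; rewrite walk_cat => /andP [wa wb].
apply: LCell (run_walk wa) _; set y := pend _ _.
have -> : state y = (val F).1; last by rewrite bdpathE; apply: fface_run.
move: wb; rewrite /bdpath codomE enum_ordSl /= => /andP [/eqP E _]; rewrite -[y]E.
by rewrite [dsrc _]fbd_from.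
Qed.

End Reduction.

End FullComplex.

(** * Words and presentations *)

Lemma flip_letterK : involutive flip_letter.
Proof.
move=> x; rewrite /flip_letter; case: (boolP (odd x)) => o; last by rewrite /= o.
by case: x o => // x /= /negbTE ->.
Qed.

Lemma odd_flip x : odd (flip_letter x) = ~~ odd x.
Proof.
rewrite /flip_letter; case: ifP => o; last by rewrite /= o.
by case: x o => //= x /negbTE.
Qed.

Lemma half_flip x : (flip_letter x)./2 = x./2.
Proof.
rewrite /flip_letter; case: (boolP (odd x)) => o.
  by case: x o => //= x; rewrite uphalf_half => /negbTE ->.
by rewrite -[x.+1./2]/(uphalf x) uphalf_half (negbTE o).
Qed.

Lemma flip_code_letter i b : flip_letter (code_letter (i, b)) = code_letter (i, ~~ b).
Proof.
by rewrite /flip_letter /code_letter /= oddD odd_double /=; case: b; rewrite ?addn0 ?addn1.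
Qed.

Lemma code_letter_inj : injective code_letter.
Proof.
move=> [i b] [j c] E; have := congr1 odd E; have := congr1 half E.
rewrite /code_letter /= !oddD !odd_double /= ![_.*2 + _]addnC !half_bit_double.
by move=> -> /=; case: b {E}; case: c.
Qed.

Lemma inv_wordK : involutive inv_word.
Proof. by move=> a; rewrite /inv_word map_rev revK (mapK flip_letterK). Qed.

Section Presentation.
Variable P : fin_pres.
Local Notation k := (ngen P).
Implicit Types a b c : word k.

Lemma pres_refl a : pres_eq (P := P) a a.
Proof. exact: rst_refl. Qed.

Lemma pres_sym a b : pres_eq (P := P) a b -> pres_eq (P := P) b a.
Proof. exact: rst_sym. Qed.

Lemma pres_trans a b c :
  pres_eq (P := P) a b -> pres_eq (P := P) b c -> pres_eq (P := P) a c.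
Proof. exact: rst_trans. Qed.

Lemma pres_ctx a b c d : pres_eq (P := P) a b -> pres_eq (P := P) (c ++ a ++ d) (c ++ b ++ d).
Proof.
apply: (rst_map (h := fun s => c ++ s ++ d)) => {}a {}b st; apply: rst_step.
case: st => w1 => [x|r] w2.
  by have := @WCancel P (c ++ w1) x (w2 ++ d); rewrite -!catA.
by move=> rr; have := @WRelator P (c ++ w1) r (w2 ++ d) rr; rewrite -!catA.
Qed.

Lemma pres_cat a b c d : pres_eq (P := P) a b -> pres_eq (P := P) c d ->
  pres_eq (P := P) (a ++ c) (b ++ d).
Proof.
move=> ab cd; apply: (rst_trans _ _ _ (b ++ c)); first exact: (pres_ctx [::] c ab).
by have := pres_ctx b [::] cd; rewrite !cats0.
Qed.

Definition inv_sword (a : word k) : word k := rev (map (@dflip _) a).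

Lemma inv_swordK : involutive inv_sword.
Proof. by move=> a; rewrite /inv_sword map_rev revK (mapK (@dflipK _)). Qed.

Lemma pres_mulV a : pres_eq (P := P) (a ++ inv_sword a) [::].
Proof.
elim: a => [|x a IH]; first exact: rst_refl.
rewrite /inv_sword /= rev_cons -cats1 -[_ :: _]cat1s catA.
have := pres_ctx [:: x] [:: dflip x] IH; rewrite /= catA => h.
by apply: rst_trans h _; apply: rst_step; apply: (@WCancel P [::] x [::]).
Qed.

Lemma pres_inv a b : pres_eq (P := P) a b -> pres_eq (P := P) (inv_sword a) (inv_sword b).
Proof.
move=> ab; apply: (rst_trans _ _ _ (inv_sword a ++ (b ++ inv_sword b))).
  rewrite -{1}[inv_sword a]cats0; apply: rst_sym.
  by have := pres_ctx (inv_sword a) [::] (pres_mulV b); rewrite !cats0.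
rewrite catA -[X in rst _ _ X]cat0s; apply: pres_cat (rst_refl _ _ _).
apply: (rst_trans _ _ _ (inv_sword a ++ a)).
  by apply: pres_cat (rst_refl _ _ _) _; apply: rst_sym.
by have := pres_mulV (inv_sword a); rewrite inv_swordK.
Qed.

End Presentation.

Section DecodeWord.
Variable k : nat.

Definition decode_letter (x : nat) : option ('I_k * bool) :=
  omap (fun i => (i, odd x)) (insub x./2).
(** Numbers which are not numbers of letters are dropped; this makes decoding a
    morphism on all lists of numbers. *)
Definition decode_word (a : seq nat) : word k := pmap decode_letter a.

Lemma decode_word_cat a b : decode_word (a ++ b) = decode_word a ++ decode_word b.
Proof. exact: pmap_cat. Qed.

Lemma decode_word_inv a : decode_word (inv_word a) = rev (map (@dflip _) (decode_word a)).
Proof.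
elim: a => //= x a IH.
rewrite /inv_word /= rev_cons -cats1 decode_word_cat -/(inv_word a) IH.
rewrite /= /decode_letter half_flip odd_flip.
by case: insub => [i|] /=; rewrite ?cats0 // rev_cons -cats1.
Qed.

Lemma code_decode_word a : all (fun x => x./2 < k) a ->
  [seq code_letter (nat_of_ord x.1, x.2) | x : 'I_k * bool <- decode_word a] = a.
Proof.
elim: a => //= x a IH /andP [lt /IH E]; rewrite /decode_letter insubT /= E.
by congr (_ :: _); rewrite /code_letter /= addnC odd_double_half.
Qed.

Lemma decode_code_letter (i : 'I_k) b : decode_letter (code_letter (val i, b)) = Some (i, b).
Proof.
rewrite /decode_letter /code_letter /= addnC half_bit_double oddD odd_double addbF.
by rewrite valK /=; case: b.
Qed.

End DecodeWord.

Lemma lookup_in (K : eqType) (V : eqType) (L : seq (K * V)) k v :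
  lookup L k = Some v -> (k, v) \in L.
Proof.
elim: L => //= -[k' v'] L IH /=; case: eqP => [<- [->]|_ /IH]; rewrite inE ?eqxx //.
by move=> ->; rewrite orbT.
Qed.

Section TransducerRuns.
Variables (St A O : Type) (delta : St -> A -> option (St * seq O)).

Lemma foldl_tstep_none s : foldl (tstep delta) None s = None.
Proof. by elim: s. Qed.

Lemma foldl_tstep u a s : foldl (tstep delta) (Some (u, a)) s =
  omap (fun y => (y.1, a ++ y.2)) (trun delta u s).
Proof.
rewrite /trun; elim: s u a => [|d s IH] u a /=; first by rewrite cats0.
case: (delta u d) => [[v b]|] /=; last by rewrite !foldl_tstep_none.
rewrite IH [in RHS]IH ?cat0s; case: (foldl _ _ _) => [y|] //=; by rewrite catA.
Qed.

Lemma trun_cat u s t : trun delta u (s ++ t) =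
  obind (fun x => omap (fun y => (y.1, x.2 ++ y.2)) (trun delta x.1 t)) (trun delta u s).
Proof.
rewrite {1}/trun foldl_cat -/(trun delta u s).
case: (trun delta u s) => [[v a]|] /=; last exact: foldl_tstep_none.
exact: foldl_tstep.
Qed.

Lemma trun1 u d : trun delta u [:: d] = delta u d.
Proof. by rewrite /trun /=; case: (delta u d) => [[]|]. Qed.

Lemma trun_cons u d t : trun delta u (d :: t) =
  obind (fun x => omap (fun y => (y.1, x.2 ++ y.2)) (trun delta x.1 t)) (delta u d).
Proof. by rewrite -cat1s trun_cat trun1. Qed.

End TransducerRuns.

(** * Numbers of paths *)

Section Coding.
Variables (X : complex) (num : edge X -> nat).

Definition code_dart (d : dart X) : nat := code_letter (num d.1, d.2).
Definition code_darts (s : seq (dart X)) : seq nat := map code_dart s.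

Hypothesis num_inj : injective num.

Lemma code_dart_inj : injective code_dart.
Proof. by move=> [e b] [e' b'] /code_letter_inj [/num_inj -> ->]. Qed.

Lemma code_darts_inj : injective code_darts.
Proof. exact: inj_map code_dart_inj. Qed.

Lemma code_dart_flip d : code_dart (dflip d) = flip_letter (code_dart d).
Proof. by rewrite /code_dart flip_code_letter. Qed.

Lemma code_darts_inv s : code_darts (inv_path s) = inv_word (code_darts s).
Proof.
rewrite /code_darts /inv_path /inv_word map_rev -!map_comp; congr rev.
by apply: eq_map => d /=; rewrite code_dart_flip.
Qed.

Lemma code_darts_split s a b : code_darts s = a ++ b ->
  exists s1 s2, [/\ s = s1 ++ s2, a = code_darts s1 & b = code_darts s2].
Proof.
move=> E; exists (take (size a) s), (drop (size a) s); rewrite cat_take_drop.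
by rewrite /code_darts map_take map_drop -/(code_darts s) E take_size_cat // drop_size_cat.
Qed.

Lemma code_darts_eval (gens : seq (seq (dart X))) a :
  eval_nword (map code_darts gens) a =
  code_darts (eval_word (tnth (in_tuple gens)) (decode_word (size gens) a)).
Proof.
elim: a => //= x a IH.
rewrite /eval_nword /= -/(eval_nword _ a) IH /decode_letter /eval_letter.
case: (ltnP x./2 (size gens)) => [lt|le]; last first.
  by rewrite insubF ?ltnNge ?le //= nth_default ?size_map //; case: odd.
rewrite insubT /= /eval_word /= /code_darts map_cat; congr (_ ++ _).
rewrite (nth_map [::]) // (tnth_nth [::]) /=.
by case: odd; rewrite // -/(code_darts (inv_path _)) code_darts_inv.
Qed.

End Coding.

(** Derivations in certificates do not record vertices, so they may pass through lists
    of darts which are not paths.  No more closed paths become trivial: sending a dart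
    to itself conjugated by chosen paths from the base point makes every list of darts
    a closed path, and every move a homotopy. *)
Section FreeMoves.
Variables (X : complex) (x0 : vert X).

Inductive free_move : seq (dart X) -> seq (dart X) -> Prop :=
| FBack s1 d s2 : free_move (s1 ++ [:: d; dflip d] ++ s2) (s1 ++ s2)
| FCell s1 f s2 : free_move (s1 ++ bdpath f ++ s2) (s1 ++ s2).

Lemma free_homotopic s : connected X -> walk x0 s x0 -> rst free_move s [::] ->
  homotopic x0 x0 s [::].
Proof.
move=> [_ conn] ws.
have [tau [tw tau0]] : exists tau : vert X -> seq (dart X),
    (forall v, walk x0 (tau v) v) /\ tau x0 = [::].
  exists (fun v => if v == x0 then [::] else projT1 (cid (conn x0 v))).
  by split=> [v|]; rewrite ?eqxx //; case: eqP => [->|_]; rewrite /= ?eqxx //; case: cid.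
pose ret d := tau (dsrc d) ++ [:: d] ++ inv_path (tau (dtgt d)).
pose retp s := flatten (map ret s).
have wd (d : dart X) : walk (dsrc d) [:: d] (dtgt d) by rewrite /= !eqxx.
have wret d : walk x0 (ret d) x0.
  by apply: walk_catI (tw _) (walk_catI (wd d) (walk_inv (tw _))).
have wretp t : walk x0 (retp t) x0.
  by elim: t => [|d t IH]; rewrite /retp /= ?eqxx //; apply: walk_catI (wret d) IH.
have retpE t u v : walk u t v ->
    homotopic x0 x0 (retp t) (tau u ++ t ++ inv_path (tau v)).
  elim: t u => [|d t IH] u /=.
    by move=> /eqP ->; apply/homotopic_sym/homotopic_inv.
  move=> /andP [/eqP <- wt].
  apply: homotopic_trans (homotopic_catl (wret d) (IH _ wt)) _.
  rewrite /ret -!catA -[d :: _]cat1s.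
  apply: homotopic_catl (tw _) _; apply: homotopic_catl (wd d) _.
  rewrite catA -[X in homotopic _ _ _ X]cat0s.
  apply: homotopic_catr (walk_catI wt (walk_inv (tw v))) _.
  exact: homotopic_invl (tw _).
have retp_cat s1 s2 : retp (s1 ++ s2) = retp s1 ++ retp s2.
  by rewrite /retp map_cat flatten_cat.
have ctx s1 t s2 u : walk u t u -> homotopic u u t [::] ->
    homotopic x0 x0 (retp (s1 ++ t ++ s2)) (retp (s1 ++ s2)).
  move=> wt ht; rewrite !retp_cat; apply: homotopic_catl (wretp _) _.
  rewrite -[X in homotopic _ _ _ X]cat0s; apply: homotopic_catr (wretp _) _.
  apply: homotopic_trans (retpE _ _ _ wt) _.
  apply: homotopic_trans (homotopic_ctx (tw u) (walk_inv (tw u)) ht) _.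
  exact: homotopic_inv (tw u).
have move_ret t t' : free_move t t' -> homotopic x0 x0 (retp t) (retp t').
  case=> s1 => [d|f] s2; apply: ctx.
  - by apply: (walk_catI (wd d)); rewrite /= dsrc_flip dtgt_flip !eqxx.
  - exact: homotopic_inv (wd d).
  - by rewrite bdpathE; apply: walk_bdloop.
  - by rewrite bdpathE; apply: homotopic_bdloop.
move=> h; apply: homotopic_trans (rst_map (R := free_move) move_ret h).
apply: homotopic_sym; apply: homotopic_trans (retpE _ _ _ ws) _.
by rewrite tau0 /= cats0; apply: homotopic_refl.
Qed.

End FreeMoves.

(** * Soundness of certificates *)

Section Tables.
Variables (X : complex) (num : edge X -> nat) (w : weighting X).
Variables (Es : seq (edge X)) (Fs : seq (face X)).

Definition face_codes : seq (seq nat) := [seq code_darts num (bdpath f) | f <- Fs].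

Definition trivial_codes : seq (seq nat) :=
  [seq code_darts num [:: (e, b); dflip (e, b)] | e <- Es, b <- [:: true; false]]
  ++ face_codes.

(** The reducing triples are finitely many, so that the perimeters need not be
    computed by the program: the list is a constant of it. *)
Definition reducing_pairs : seq (seq nat * seq nat) :=
  flatten [seq flatten [seq
    [seq (code_darts num (bdsub i m), code_darts num (bdsub i (deg f)))
      | m <- iota 1 (deg f) & `[< reducing w i m >]] | i <- enum 'I_(degm1 f).+1] | f <- Fs].

Hypothesis Es_all : forall e, e \in Es.
Hypothesis Fs_all : forall f, f \in Fs.

Lemma face_codes_in f : code_darts num (bdpath f) \in face_codes.
Proof. exact: map_f. Qed.

Lemma trivial_codesP r : r \in trivial_codes ->
  (exists d, r = code_darts num [:: d; dflip d]) \/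
  (exists f, r = code_darts num (bdpath f)).
Proof.
rewrite mem_cat => /orP [/allpairsP [[e b] [_ _ ->]]|/mapP [f _ ->]]; last by right; exists f.
by left; exists (e, b).
Qed.

Lemma trivial_codes_back d : code_darts num [:: d; dflip d] \in trivial_codes.
Proof.
rewrite mem_cat; apply/orP; left; apply/allpairsP; exists d; split => //.
  by case: d => e [] /=; rewrite !inE.
Qed.

Lemma trivial_codes_face f : code_darts num (bdpath f) \in trivial_codes.
Proof. by rewrite mem_cat face_codes_in orbT. Qed.

Lemma reducing_gt0 f (i : 'I_(degm1 f).+1) m : reducing w i m -> 0 < m.
Proof.
case=> _; case: m => //; rewrite {2}/perimeter
  (_ : classical_sets.setT = classical_sets.set0) ?fsbig_set0 //.
by apply/seteqP; split=> // -[].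
Qed.

Lemma reducing_pairs_in f (i : 'I_(degm1 f).+1) m : reducing w i m ->
  (code_darts num (bdsub i m), code_darts num (bdsub i (deg f))) \in reducing_pairs.
Proof.
move=> red; apply/flattenP; eexists; first by apply: map_f (Fs_all f).
apply/flattenP; eexists; first by apply: map_f (mem_enum _ i).
apply/mapP; exists m => //; rewrite mem_filter asboolT // mem_iota.
by rewrite (reducing_gt0 red) add1n ltnS; case: red.
Qed.

Lemma reducing_pairsP t : t \in reducing_pairs -> exists f (i : 'I_(degm1 f).+1) m,
  [/\ reducing w i m, 0 < m & t = (code_darts num (bdsub i m), code_darts num (bdsub i (deg f)))].
Proof.
move=> /flattenP [_ /mapP [f _ ->] /flattenP [_ /mapP [i _ ->] /mapP [m]]].
rewrite mem_filter => /andP [/asboolP red _] ->.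
by exists f, i, m; split=> //; apply: reducing_gt0 red.
Qed.

Section Soundness.
Variables (x0 : vert X) (gens : seq (seq (dart X))) (c : certificate).
Hypothesis num_inj : injective num.
Hypothesis connX : connected X.
Hypothesis RH : reduction_hypothesis w.
Hypothesis gens_closed : forall g, g \in gens -> walk x0 g x0.
Hypothesis c_ok :
  check reducing_pairs face_codes trivial_codes (map (code_darts num) gens, c).

Let k := size gens.
Let L := c.1.
Let rels := cert_relators face_codes (map (code_darts num) gens) L.
Let P := FinPres (map (@decode_word k) rels).
Let th := tnth (in_tuple gens).
Let code := code_darts num.

Let tdelta (u : nat) (d : dart X) := trans L u (code_dart num d).
Let delta (u : nat) (d : dart X) := omap fst (tdelta u d).

Let trunE u s : trun (trans L) u (code s) = trun tdelta u s.
Proof.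
by rewrite /trun; elim: s (Some _) => //= d s IH o; rewrite -IH.
Qed.

Let run_trun u s : run delta u s = omap fst (trun tdelta u s).
Proof.
elim: s u => //= d s IH u; rewrite run_cons trun_cons /delta.
by case: (tdelta u d) => [[v a]|] //=; rewrite IH; case: (trun _ _ _).
Qed.

Let ok_inverse : check_inverse L. Proof. by case/and5P: c_ok. Qed.
Let ok_closed : check_closed reducing_pairs L. Proof. by case/and5P: c_ok. Qed.
Let ok_gens : check_gens (map code gens) L. Proof. by case/and5P: c_ok. Qed.
Let ok_letters : check_letters face_codes (map code gens) L. Proof. by case/and5P: c_ok. Qed.
Let ok_trivial : check_trivial face_codes trivial_codes (map code gens) c.
Proof. by case/and5P: c_ok. Qed.

Let tdelta_in u d y : tdelta u d = Some y -> ((u, code_dart num d), y) \in L.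
Proof. exact: lookup_in. Qed.

Let tdelta_inv u d v a : tdelta u d = Some (v, a) ->
  tdelta v (dflip d) = Some (u, inv_word a).
Proof.
by move=> /tdelta_in /(allP ok_inverse) /= /eqP; rewrite /tdelta code_dart_flip.
Qed.

Let delta_inv u d v : delta u d = Some v -> delta v (dflip d) = Some u.
Proof.
rewrite /delta; case E: (tdelta u d) => [[v' a]|] //= [<-].
by rewrite (tdelta_inv E).
Qed.

Let closedT f (i : 'I_(degm1 f).+1) m : reducing w i m ->
  forall u, isSome (run delta u (bdsub i m)) -> run delta u (bdsub i (deg f)) = Some u.
Proof.
move=> red u; have m0 := reducing_gt0 red.
have E : isSome (run delta u (bdsub i m)) -> exists y, tdelta u (bd f i) = Some y.
  case: m m0 {red} => // m _; rewrite bdsubS run_cons /delta.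
  by case: (tdelta _ _) => // y; exists y.
move=> r; have {E}[y Ey] := E r.
have /allP H := allP ok_closed _ (tdelta_in Ey).
have : if trun (trans L) u (code (bdsub i m)) is Some _ then
    if trun (trans L) u (code (bdsub i (deg f))) is Some z then z.1 == u else false
    else true := H _ (reducing_pairs_in red).
rewrite !trunE; move: r; rewrite !run_trun.
case: (trun _ _ (bdsub i m)) => // _ _.
by case: (trun _ _ _) => // -[v b] /= /eqP ->.
Qed.

Let decode_rel r : r \in rels -> decode_word k r \in relators P.
Proof. exact: map_f. Qed.

Let pres_rel r : r \in rels -> pres_eq (P := P) (decode_word k r) [::].
Proof.
move=> /decode_rel rr; apply: rst_step.
by have := @WRelator P [::] _ [::] rr; rewrite /= cats0.
Qed.

(** As an element of the presented group, the word read along the evaluation of a word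
    is that word. *)
Let output u s : word k := if trun tdelta u s is Some y then decode_word k y.2 else [::].

Let lstep_pres s t : lstep delta 0 s t -> pres_eq (P := P) (output 0 s) (output 0 t).
Proof.
case=> [s1 d s2|s1 f s2 u]; rewrite /output !run_trun !trun_cat.
  case: (trun _ 0 s1) => [[v a1]|] /=; last by move=> _; apply: rst_refl.
  rewrite trun_cons; case E: (tdelta v d) => [[v' b]|] //=.
  rewrite trun_cons (tdelta_inv E) /=.
  case: (trun _ v s2) => [[z a2]|] //= _.
  rewrite !decode_word_cat decode_word_inv.
  apply: pres_cat (@pres_refl P _) _; rewrite -[X in pres_eq _ X]cat0s catA.
  exact: pres_cat (@pres_mulV P (decode_word k b)) (@pres_refl P _).
case: (trun _ 0 s1) => [[v a1]|] //= [->].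
case E: (trun _ u (bdpath f)) => [[u' b]|] //= [uu']; rewrite {u'}uu' in E *.
rewrite trun_cat E /=; case: (trun _ u s2) => [[z a2]|] /=; last exact: rst_refl.
rewrite !decode_word_cat; apply: pres_cat (@pres_refl P _) _.
rewrite -[X in pres_eq _ X]cat0s; apply: pres_cat (@pres_refl P _); apply: pres_rel.
rewrite mem_cat; apply/orP; right.
have [y Ey] : exists y, tdelta u (bd f 0%R) = Some y.
  move: E; rewrite bdpathE /deg bdsubS trun_cons.
  by case: (tdelta _ _) => // y; exists y.
apply/flattenP; eexists; first by apply: map_f (tdelta_in Ey).
apply/flattenP; eexists; first by apply: map_f (face_codes_in f).
by rewrite /= trunE E eqxx inE.
Qed.

Let run_generator (i : 'I_k) : exists a, trun tdelta 0 (th i) = Some (0, a) /\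
  pres_eq (P := P) (decode_word k a) [:: (i, false)].
Proof.
have gi : th i \in gens by apply: mem_tnth.
have := allP ok_gens _ (map_f code gi); rewrite trunE.
case E: (trun _ _ _) => [[v a]|] //= /eqP v0; rewrite v0 in E *.
exists a; split=> //.
have : decode_word k (a ++ [:: flip_letter i.*2]) \in relators P.
  apply: decode_rel; rewrite mem_cat; apply/orP; left.
  apply/mapP; exists (val i); first by rewrite mem_iota size_map /= ltn_ord.
  have -> : nth [::] (map code gens) i = code (th i).
    by rewrite (nth_map [::]) // /th (tnth_nth [::]).
  by rewrite trunE E.
rewrite decode_word_cat -[i.*2]addn0 -[i.*2 + 0]/(code_letter (val i, false)).
rewrite flip_code_letter /= decode_code_letter /= => rr.
have h : pres_eq (P := P) (decode_word k a ++ [:: (i, true)]) [::].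
  by apply: rst_step; have := @WRelator P [::] _ [::] rr; rewrite /= cats0.
apply: (@pres_trans P _ ((decode_word k a ++ [:: (i, true)]) ++ [:: (i, false)])).
  rewrite -catA -{1}[decode_word k a]cats0.
  apply: pres_cat (@pres_refl P _) _; apply: pres_sym; apply: rst_step.
  exact: (@WCancel P [::] (i, true) [::]).
by rewrite -[X in pres_eq _ X]cat0s; apply: pres_cat h (@pres_refl P _).
Qed.

Let trun_inv s u v a : trun tdelta u s = Some (v, a) ->
  trun tdelta v (inv_path s) = Some (u, inv_word a).
Proof.
elim: s u a => [|d s IH] u a; first by case=> -> <-.
rewrite trun_cons inv_path_cons -cats1 trun_cat.
case E: (tdelta u d) => [[v' b]|] //=; case E': (trun _ _ _) => [[v'' b']|] //= [ev <-].
rewrite ev in E'; rewrite (IH _ _ E') /= trun1 (tdelta_inv E) /=.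
by rewrite /inv_word map_cat rev_cat.
Qed.

Let output_eval (a : word k) : exists b, trun tdelta 0 (eval_word th a) = Some (0, b) /\
  pres_eq (P := P) (decode_word k b) a.
Proof.
elim: a => [|[i s] a [b [rb pb]]]; first by exists [::]; split=> //; apply: rst_refl.
have [ai [ri pi]] := run_generator i.
have [ci [rci pci]] : exists ci, trun tdelta 0 (if s then inv_path (th i) else th i) = Some (0, ci)
    /\ pres_eq (P := P) (decode_word k ci) [:: (i, s)].
  case: s; last by exists ai.
  exists (inv_word ai); split; first exact: trun_inv.
  by rewrite decode_word_inv; apply: (pres_inv pi).
exists (ci ++ b); rewrite /eval_word /= trun_cat rci /= -/(eval_word th a) rb.
split=> //; rewrite decode_word_cat -cat1s; exact: pres_cat pci pb.
Qed.

Let th_closed i : walk x0 (th i) x0.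
Proof. by apply: gens_closed; apply: mem_tnth. Qed.

Let eval_closed (a : word k) : walk x0 (eval_word th a) x0.
Proof.
elim: a => [|[i s] a IH]; rewrite /eval_word /= ?eqxx //.
by apply: walk_catI IH; case: s; [apply: walk_inv|]; apply: th_closed.
Qed.

Let derivation_free D s t : foldl (insdel_step trivial_codes) (code s) D = code t ->
  rst (@free_move X) s t.
Proof.
elim: D s => [|[a [r b]] D IH] s /=.
  by move/(code_darts_inj num_inj) ->; apply: rst_refl.
rewrite /insdel_step /=.
case: ifP => [/trivial_codesP tr|_]; last exact: IH.
have [q qE mv] : exists2 q, r = code q & forall s1 s2, free_move (s1 ++ q ++ s2) (s1 ++ s2).
  case: tr => [[d ->]|[f ->]]; [exists [:: d; dflip d] | exists (bdpath f)] => // s1 s2.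
    exact: FBack.
  exact: FCell.
case: eqP => [E|_].
  have [s1 [s' [-> -> E']]] := code_darts_split E.
  have [q' [s2 [Es' Eq ->]]] := code_darts_split (esym E').
  rewrite -/(code _) -map_cat -/(code _) => /IH; apply: rst_trans.
  have -> : s' = q ++ s2 
    by rewrite Es'; congr (_ ++ _); apply: (code_darts_inj num_inj); rewrite -/code -qE Eq.
  by apply: rst_step; apply: mv.
case: eqP => [E|_]; last exact: IH.
have [s1 [s2 [-> -> ->]]] := code_darts_split E.
rewrite qE -!map_cat => /IH; apply: rst_trans.
by apply: rst_sym; apply: rst_step; apply: mv.
Qed.

Let relator_trivial r : r \in rels -> homotopic x0 x0 (eval_word th (decode_word k r)) [::].
Proof.
move=> /(allP ok_trivial) /hasP [D _ /eqP]; rewrite code_darts_eval => HD.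
apply: free_homotopic => //.
exact: (derivation_free (t := [::]) HD).
Qed.

Let eval_cat (a b : word k) : eval_word th (a ++ b) = eval_word th a ++ eval_word th b.
Proof. by rewrite /eval_word map_cat flatten_cat. Qed.

Let pres_homotopic (a b : word k) : pres_eq (P := P) a b ->
  homotopic x0 x0 (eval_word th a) (eval_word th b).
Proof.
apply: rst_map => {}a {}b st.
have [w1 [t [w2 [-> -> ht]]]] : exists w1 t w2, [/\ a = w1 ++ t ++ w2, b = w1 ++ w2 &
    homotopic x0 x0 (eval_word th t) [::]].
  case: st => w1 => [x|r] w2; [exists w1, [:: x; dflip x], w2 | move=> rr; exists w1, r, w2].
    split=> //; case: x => i s; rewrite /eval_word /= cats0.
    by case: s => /=; [apply: homotopic_invl | apply: homotopic_inv]; apply: th_closed.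
  by split=> //; case/mapP: rr => r' r'in ->; apply: relator_trivial.
rewrite !eval_cat; apply: homotopic_catl (eval_closed _) _.
rewrite -[X in homotopic _ _ _ X]cat0s.
exact: homotopic_catr (eval_closed _) ht.
Qed.

Let homotopic_pres (a b : word k) : homotopic x0 x0 (eval_word th a) (eval_word th b) ->
  pres_eq (P := P) a b.
Proof.
move=> h; have [[ca [ra pa]] [cb [rb pb]]] := (output_eval a, output_eval b).
have [r1 r2] : run delta 0 (eval_word th a) = Some 0 /\ run delta 0 (eval_word th b) = Some 0.
  by rewrite !run_trun ra rb.
have ll := full_pi1_injective delta_inv closedT RH (eval_closed a) (eval_closed b) r1 r2 h.
have := rst_map (R := lstep delta 0) (h := output 0) lstep_pres ll.
rewrite /output ra rb /= => ab.
exact (@pres_trans P _ _ _ (pres_sym pa) (@pres_trans P _ _ _ ab pb)).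
Qed.

(** A word which evaluates to a trivial path of X is read off from a path in the graph
    which is trivial in the full complex, hence the label along that path is trivial in
    the presented group; but this label is the word itself. *)
Theorem certificate_sound : presents x0 P (subgroup_gen x0 gens) /\
  code_pres P = CodeSeq.code (size gens :: map CodeSeq.code rels).
Proof.
split.
  exists th; split=> //.
  by move=> a b; split; [apply: pres_homotopic | apply: homotopic_pres].
rewrite /code_pres /= -map_comp; congr (CodeSeq.code (_ :: _)).
apply/eq_in_map => r rin /=; rewrite /code_word code_decode_word //.
by have := allP ok_letters _ rin; rewrite size_map.
Qed.

End Soundness.
End Tables.

(** * The covering graph of a subgroup *)

Section Cover.
Variables (X : complex) (x0 : vert X) (gens : seq (seq (dart X))).
Hypothesis gens_closed : forall g, g \in gens -> walk x0 g x0.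

Local Notation H := (subgroup_gen x0 gens).
Local Notation th := (tnth (in_tuple gens)).
Implicit Types (p q s v : seq (dart X)) (d : dart X).

Lemma sub_closed l : H l -> walk x0 l x0. Proof. by case. Qed.

Lemma th_walk i : walk x0 (th i) x0.
Proof. by apply: gens_closed; apply: mem_tnth. Qed.

Lemma eval_walk (a : word (size gens)) : walk x0 (eval_word th a) x0.
Proof.
elim: a => [|[i s] a IH]; rewrite /eval_word /= ?eqxx //.
by apply: walk_catI IH; case: s; [apply: walk_inv|]; apply: th_walk.
Qed.

Lemma eval_word_cat (a b : word (size gens)) :
  eval_word th (a ++ b) = eval_word th a ++ eval_word th b.
Proof. by rewrite /eval_word map_cat flatten_cat. Qed.

Lemma eval_word_inv (a : word (size gens)) :
  eval_word th (rev (map (@dflip _) a)) = inv_path (eval_word th a).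
Proof.
elim: a => [|[i s] a IH] //=.
rewrite rev_cons -cats1 eval_word_cat IH {3}/eval_word /= inv_path_cat -/(eval_word th a).
by rewrite /eval_word /= cats0; case: s; rewrite /= ?inv_pathK.
Qed.

Lemma sub_homotopic l l' : walk x0 l' x0 -> homotopic x0 x0 l' l -> H l -> H l'.
Proof.
by move=> wl' ll' [_ [a ha]]; split=> //; exists a; apply: homotopic_trans ll' ha.
Qed.

Lemma sub1 : H [::].
Proof. by split; [rewrite /= eqxx | exists [::]; apply: homotopic_refl]. Qed.

Lemma sub_mul l l' : H l -> H l' -> H (l ++ l').
Proof.
move=> [wl [a ha]] [wl' [b hb]]; split; first exact: walk_catI wl wl'.
exists (a ++ b); rewrite eval_word_cat.
exact: homotopic_cat (eval_walk a) wl' ha hb.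
Qed.

Lemma sub_inv l : H l -> H (inv_path l).
Proof.
move=> [wl [a ha]]; split; first exact: walk_inv.
by exists (rev (map (@dflip _) a)); rewrite eval_word_inv; apply: homotopic_inv_path.
Qed.

Lemma sub_generator g : g \in gens -> H g.
Proof.
move=> gin; split; first exact: gens_closed.
have lt : index g gens < size gens by rewrite index_mem.
exists [:: (Ordinal lt, false)]; rewrite /eval_word /= cats0 (tnth_nth [::]) /=.
by rewrite nth_index //; apply: homotopic_refl.
Qed.

(** Vertices of the covering graph are the classes of paths from the base point;
    each class is represented by a chosen path, the trivial one for the base. *)

Definition good p : bool := walk x0 p (pend x0 p).

Definition same p q : Prop :=
  [/\ good p, good q, pend x0 p = pend x0 q & H (p ++ inv_path q)].

Lemma good_pend p z : walk x0 p z -> good p /\ pend x0 p = z.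
Proof. by move=> w; rewrite /good (walk_end w). Qed.

Lemma same_refl p : good p -> same p p.
Proof.
move=> gp; split=> //; apply: sub_homotopic sub1; last exact: homotopic_inv gp.
exact: walk_catI gp (walk_inv gp).
Qed.

Lemma same_sym p q : same p q -> same q p.
Proof.
by move=> [gp gq e h]; split=> //; have := sub_inv h; rewrite inv_path_cat inv_pathK.
Qed.

Lemma same_trans p q s : same p q -> same q s -> same p s.
Proof.
move=> [gp gq e h] [_ gs e' h']; split=> //; first by rewrite e.
have wp : walk x0 p (pend x0 s) by rewrite -e' -e.
have wq : walk x0 q (pend x0 s) by rewrite -e'.
have ws : walk x0 s (pend x0 s) by [].
apply: sub_homotopic (sub_mul h h'); first exact: walk_catI wp (walk_inv ws).
rewrite -catA; apply: homotopic_catl wp _; rewrite catA -[X in homotopic _ _ X]cat0s.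
apply: homotopic_catr (walk_inv ws) _; apply: homotopic_sym.
exact: homotopic_invl wq.
Qed.

Lemma same_homotopic p q z : walk x0 p z -> walk x0 q z -> homotopic x0 z p q -> same p q.
Proof.
move=> wp wq h; have [[gp ep] [gq eq]] := (good_pend wp, good_pend wq).
split=> //; first by rewrite ep.
apply: sub_homotopic sub1; first exact: walk_catI wp (walk_inv wq).
apply: homotopic_trans (homotopic_catr (walk_inv wq) h) _.
exact: homotopic_inv wq.
Qed.

Lemma same_cat p q s z : same p q -> walk (pend x0 p) s z -> same (p ++ s) (q ++ s).
Proof.
move=> [gp gq e h] ws; have ws' := ws; rewrite e in ws'.
have [wps wqs] := (walk_catI gp ws, walk_catI gq ws').
have [[gps eps] [gqs eqs]] := (good_pend wps, good_pend wqs).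
split=> //; first by rewrite eps.
apply: sub_homotopic h; first exact: walk_catI wps (walk_inv wqs).
rewrite inv_path_cat -catA.
apply: homotopic_catl gp _; rewrite catA -[X in homotopic _ _ _ X]cat0s e.
apply: homotopic_catr (walk_inv gq) _.
exact: homotopic_inv ws'.
Qed.

Lemma same_sub l : H l -> same [::] l.
Proof.
move=> h; have wl := sub_closed h; have [gl el] := good_pend wl.
split=> //; first by rewrite /good /= eqxx.
exact: (sub_inv h).
Qed.

Definition rep p : seq (dart X) :=
  if `[< same p [::] >] then [::] else choose (fun q => `[< same p q >]) p.

Lemma rep_same p : good p -> same p (rep p).
Proof.
move=> gp; rewrite /rep; case: asboolP => // _.
have P : (fun q => `[< same p q >]) p by apply/asboolP; apply: same_refl.
by apply/asboolP; apply: (@chooseP _ (fun q => `[< same p q >])) P.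
Qed.

Lemma rep_eq p q : same p q -> rep p = rep q.
Proof.
move=> pq; have [gp gq _ _] := pq.
have E s : `[< same p s >] = `[< same q s >].
  apply/asboolP/asboolP => h; last exact: same_trans pq h.
  exact: same_trans (same_sym pq) h.
rewrite /rep E; case: asboolP => // _.
rewrite (@eq_choose _ (fun s => `[< same p s >]) (fun s => `[< same q s >]) E).
apply: (@choose_id _ (fun s => `[< same q s >])).
  by apply: asboolT; apply: same_sym.
by apply: asboolT; apply: same_refl.
Qed.

Lemma rep_nil : rep [::] = [::].
Proof.
by rewrite /rep; case: asboolP => // -[]; apply: same_refl; rewrite /good /= eqxx.
Qed.

Definition cvert v : bool := good v && (rep v == v).

Lemma cvert_rep p : good p -> cvert (rep p) /\ pend x0 (rep p) = pend x0 p.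
Proof.
move=> /rep_same pr; have [gp gr e _] := pr.
by rewrite /cvert gr -(rep_eq pr) eqxx.
Qed.

Lemma cvert_nil : cvert [::].
Proof. by rewrite /cvert rep_nil eqxx andbT /good /= eqxx. Qed.

Definition act v d : seq (dart X) := rep (rcons v d).
Definition actp v s : seq (dart X) := foldl act v s.

(** The dart action on classes of paths is right multiplication. *)
Lemma actp_rep v s z : cvert v -> walk (pend x0 v) s z ->
  [/\ actp v s = rep (v ++ s), cvert (actp v s) & pend x0 (actp v s) = z].
Proof.
move=> cv ws.
have [gv ev] : good v /\ rep v = v by case/andP: cv => ? /eqP.
have E : actp v s = rep (v ++ s).
  rewrite -{1}ev; have : walk x0 v (pend x0 v) by [].
  elim: s v {cv gv ev} (pend x0 v) ws => [|d s IH] v u /=; first by rewrite cats0.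
  move=> /andP [/eqP du ws] wv; have [gv ev] := good_pend wv.
  have wd : walk (pend x0 v) [:: d] (dtgt d) by rewrite /= ev du !eqxx.
  have wvd : walk x0 (v ++ [:: d]) (dtgt d) by apply: walk_catI wd; rewrite ev.
  have -> : act (rep v) d = rep (v ++ [:: d]).
    rewrite /act -cats1; apply: rep_eq; apply: same_sym.
    by apply: same_cat wd; apply: rep_same.
  by rewrite -/(actp _ s) (IH _ _ ws wvd) -catA.
have [gvs evs] := good_pend (walk_catI gv ws).
by rewrite E; have [-> ->] := cvert_rep gvs; rewrite evs.
Qed.

Lemma act_cvert v d : cvert v -> dsrc d = pend x0 v ->
  cvert (act v d) /\ pend x0 (act v d) = dtgt d.
Proof.
move=> cv e; have w : walk (pend x0 v) [:: d] (dtgt d) by rewrite /= e !eqxx.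
by have [_] := actp_rep cv w.
Qed.

Lemma actp_cat v s t : actp v (s ++ t) = actp (actp v s) t.
Proof. by rewrite /actp foldl_cat. Qed.

Lemma actp_homotopic v s t z : cvert v -> walk (pend x0 v) s z -> walk (pend x0 v) t z ->
  homotopic (pend x0 v) z s t -> actp v s = actp v t.
Proof.
move=> cv ws wt h; have [-> _ _] := actp_rep cv ws; have [-> _ _] := actp_rep cv wt.
have gv : good v by case/andP: cv.
apply: rep_eq; apply: (same_homotopic (walk_catI gv ws) (walk_catI gv wt)).
exact: homotopic_catl gv h.
Qed.

Lemma actp_loop v s : cvert v -> walk (pend x0 v) s (pend x0 v) ->
  homotopic (pend x0 v) (pend x0 v) s [::] -> actp v s = v.
Proof. by move=> cv ws h; rewrite (actp_homotopic cv ws _ h) //= eqxx. Qed.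

Lemma actpK v s z : cvert v -> walk (pend x0 v) s z -> actp (actp v s) (inv_path s) = v.
Proof.
move=> cv ws; rewrite -actp_cat; apply: actp_loop => //.
  exact: walk_catI ws (walk_inv ws).
exact: homotopic_inv ws.
Qed.

Lemma actK v d : cvert v -> dsrc d = pend x0 v -> act (act v d) (dflip d) = v.
Proof. by move=> cv e; apply: (actpK (s := [:: d]) (z := dtgt d)) => //; rewrite /= e !eqxx. Qed.

(** An unoriented edge of the covering graph is recorded by its source. *)
Definition cedge := (seq (dart X) * edge X)%type.

Definition edge_of v d : cedge := if d.2 then (act v d, d.1) else (v, d.1).

Lemma edge_of2 v d : (edge_of v d).2 = d.1.
Proof. by rewrite /edge_of; case: d.2. Qed.

Lemma edge_of_inj v v' d : cvert v -> cvert v' -> dsrc d = pend x0 v -> dsrc d = pend x0 v' ->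
  edge_of v d = edge_of v' d -> v = v'.
Proof.
move=> cv cv' e e'; rewrite /edge_of; case: d.2 => -[] // E.
by rewrite -(actK cv e) E actK.
Qed.

Lemma edge_of_flip v d : cvert v -> dsrc d = pend x0 v ->
  edge_of (act v d) (dflip d) = edge_of v d.
Proof. by move=> cv e; rewrite /edge_of; case: d e => e [] h //=; rewrite actK. Qed.

Fixpoint ledges v s : seq cedge :=
  if s is d :: s' then edge_of v d :: ledges (act v d) s' else [::].

Lemma ledges_cat v s t : ledges v (s ++ t) = ledges v s ++ ledges (actp v s) t.
Proof. by elim: s v => //= d s IH v; rewrite IH. Qed.

Definition valid_edges (S : seq cedge) : Prop :=
  forall x, x \in S -> cvert x.1 /\ pend x0 x.1 = esrc x.2.

Lemma edge_of_valid v d : cvert v -> dsrc d = pend x0 v ->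
  cvert (edge_of v d).1 /\ pend x0 (edge_of v d).1 = esrc (edge_of v d).2.
Proof.
move=> cv e; have [ca pa] := act_cvert cv e.
by rewrite /edge_of; case: d e ca pa => e [] //= h ca pa; rewrite -h.
Qed.

Lemma ledges_valid v s z : cvert v -> walk (pend x0 v) s z -> valid_edges (ledges v s).
Proof.
elim: s v => [|d s IH] v //= cv /andP [/eqP e w] x.
have [ca pa] := act_cvert cv e.
rewrite inE => /orP [/eqP ->|]; first exact: edge_of_valid.
by apply: IH => //; rewrite pa.
Qed.

Lemma edge_of_dart v d x : cvert v -> dsrc d = pend x0 v -> x = edge_of v d ->
  v = if d.2 then act x.1 (x.2, false) else x.1.
Proof.
move=> cv e ->; rewrite /edge_of; case: d e => e [] //= h.
by rewrite -[RHS]/(act (act v (e, true)) (dflip (e, true))) actK.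
Qed.

End Cover.

(** * Perimeters *)

Lemma leq_sum_subset (T : eqType) (A B : seq T) (F : T -> nat) :
  uniq A -> {subset A <= B} -> \sum_(x <- A) F x <= \sum_(x <- B) F x.
Proof.
elim: A B => [|x A IH] B /=; first by rewrite big_nil.
move=> /andP [xA uA] AB; have xB : x \in B by apply: AB; rewrite inE eqxx.
rewrite big_cons (perm_big _ (perm_to_rem xB)) big_cons leq_add2l; apply: IH => // y yA.
have : y \in B by apply: AB; rewrite inE yA orbT.
rewrite (perm_mem (perm_to_rem xB)) inE => /orP [/eqP e|] //.
by rewrite -e yA in xA.
Qed.

Section Perimeter.
Variables (X : complex) (w : weighting X) (Fs : seq (face X)).
Hypothesis Fs_uniq : uniq Fs.
Hypothesis Fs_all : forall f, f \in Fs.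
Implicit Types (f : face X).

Definition mkside f (r : 'I_(degm1 f).+1) : side X := Tagged (fun f => 'I_(degm1 f).+1) r.

Definition all_sides : seq (side X) := [seq mkside r | f <- Fs, r <- enum 'I_(degm1 f).+1].

Lemma all_sides_in s : s \in all_sides.
Proof. by case: s => f r; apply/allpairsPdep; exists f, r; rewrite mem_enum. Qed.

Lemma all_sides_uniq : uniq all_sides.
Proof.
apply: allpairs_uniq_dep => //; first by move=> f _; apply: enum_uniq.
by move=> [f r] [f' r'] _ _ E; exact: E.
Qed.

Lemma sum_all_sides (F : side X -> nat) :
  \sum_(s <- all_sides) F s = \sum_(f <- Fs) \sum_(r < (degm1 f).+1) F (mkside r).
Proof.
rewrite /all_sides big_allpairs_dep; apply: eq_bigr => f _.
by rewrite big_enum.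
Qed.

Definition side_edge (s : side X) : edge X := (bd (tag s) (tagged s)).1.

Definition edge_wt (e : edge X) : nat := \sum_(s <- all_sides | side_edge s == e) wt w s.
Definition face_wt f : nat := \sum_(r < (degm1 f).+1) wt w (mkside r).

Lemma fsum_sides (A : set (side X)) :
  \big[addn/0]_(s \in A) wt w s = \sum_(s <- all_sides | `[< A s >]) wt w s.
Proof.
rewrite -[RHS]big_filter [RHS]fsbig_seq ?filter_uniq ?all_sides_uniq //.
set B := [set` _]%classic; suff {1}-> : A = B by [].
apply/seteqP; split=> s; rewrite /B /=.
  by move=> As; rewrite mem_filter all_sides_in andbT; apply/asboolP.
by rewrite mem_filter => /andP [/asboolP].
Qed.

Lemma perimeterE (n : nat) (Y : complex) (phi : cmap Y X) (h : 'I_n -> edge Y) :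
  bijective h ->
  perimeter w phi = \sum_(k < n)
    \sum_(s <- all_sides | `[< missing_along phi (h k) s >]) wt w s.
Proof.
move=> bh; rewrite /perimeter.
have uh : uniq [seq h k | k <- enum 'I_n].
  by rewrite map_inj_uniq ?enum_uniq //; apply: bij_inj.
have -> : [set: edge Y]%classic = [set` [seq h k | k <- enum 'I_n]]%classic.
  apply/seteqP; split=> y //= _; case: bh => g hg gh.
  by rewrite -[y]gh; apply: map_f; rewrite mem_enum.
rewrite -fsbig_seq // big_map big_enum; apply: eq_bigr => k _.
exact: fsum_sides.
Qed.

Lemma perimeter_subpath f (i : 'I_(degm1 f).+1) m :
  perimeter w (ccomp (cell_map f) (subpath i m)) <=
  \sum_(k < m) edge_wt (bd f (i + inZp k)%R).1.
Proof.
rewrite (@perimeterE m (Defs.interval m) _ id); last by exists id.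
apply: leq_sum => k _; rewrite /edge_wt big_mkcond [X in _ <= X]big_mkcond /=.
apply: leq_sum => s _; case: asboolP => // -[pr _].
by rewrite (_ : side_edge s == _) //; apply/eqP.
Qed.

(** The sides present at edge [k] of the packet are those of its copies of [f], which
    are attached by rotations: copy [j] contributes side [k - packet_rot j]. *)
Lemma perimeter_packet f :
  \sum_(k < deg f) edge_wt (bd f k).1 <=
  perimeter w (packet_map f) + exponent f * face_wt f.
Proof.
rewrite (@perimeterE (deg f) (packet f) _ id); last by exists id.
have H (k : 'I_(degm1 f).+1) : edge_wt (bd f k).1 <=
   \sum_(s <- all_sides | `[< missing_along (packet_map f) k s >]) wt w s +
   \sum_(j < exponent f) wt w (mkside (k - packet_rot j)%R).
  rewrite /edge_wt (bigID (fun s => `[< missing_along (packet_map f) k s >])) /=.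
  apply: leq_add.
    rewrite big_mkcond [X in _ <= X]big_mkcond /=; apply: leq_sum => s _.
    by case: asboolP; rewrite ?andbF //; case: ifP.
  rewrite -big_filter -(big_map (fun j => mkside (k - packet_rot j)%R) xpredT (wt w)).
  rewrite -[X in _ <= \sum_(_ <- map _ X) _]/(index_enum _).
  apply: leq_sum_subset; first by rewrite filter_uniq ?all_sides_uniq.
  move=> s; rewrite mem_filter => /andP [/andP [/eqP se /asboolP nm] _].
  have [rho [rk H]] : present_along (packet_map f) k s.
    by apply: contrapT => np; apply: nm; split.
  case: s se nm rho rk H => g r /= se nm rho rk H.
  have fg : f = g := ceq_f H tt; subst g.
  have oriE : fori rho tt = false by have := ceq_o H tt.
  have sideE (i : 'I_(degm1 f).+1) : fside rho tt i = i :> nat by exact: (@ceq_s _ _ _ _ H tt i).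
  apply/mapP; exists (fmap rho tt); first by rewrite mem_index_enum.
  have := @fside_bd _ _ rho tt r; rewrite oriE => /(congr1 fst) /= E.
  congr (mkside _); apply/eqP; rewrite eq_sym subr_eq; apply/eqP.
  rewrite -[LHS]rk -[X in (emap rho X).1]addr0 E.
  by congr (_ + _)%R; apply: val_inj; rewrite /= sideE.
apply: leq_trans (leq_sum _ (fun k _ => H k)) _.
rewrite big_split /= leq_add2l exchange_big /=.
rewrite (eq_bigr (fun=> face_wt f)); first by rewrite sum_nat_const card_ord.
move=> j _; rewrite /face_wt [RHS](reindex_inj (h := fun k => (k - packet_rot j)%R)) //.
exact: addIr.
Qed.

(** A perimeter reduction, stated on the part of the boundary outside the subpath: the
    weight of the edges there is less than that of the sides of the packet. *)
Lemma reducing_edge_wt f (i : 'I_(degm1 f).+1) m : reducing w i m ->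
  m <= deg f /\
  \sum_(k <- iota m (deg f - m)) edge_wt (bd f (i + inZp k)%R).1 < exponent f * face_wt f.
Proof.
move=> [le lt]; split=> //.
have := leq_trans lt (perimeter_subpath i m).
have := perimeter_packet f.
have -> : \sum_(k < deg f) edge_wt (bd f k).1 =
    \sum_(k <- iota 0 (deg f)) edge_wt (bd f (i + inZp k)%R).1.
  rewrite -[iota 0 (deg f)]/(index_iota 0 (deg f)) big_mkord.
  rewrite (reindex_inj (addrI i)) /=; apply: eq_bigr => k _.
  by rewrite inZp_val.
rewrite -{1}(subnKC le) iotaD big_cat /= add0n.
rewrite [iota 0 m](_ : _ = index_iota 0 m); last by rewrite /index_iota subn0.
rewrite big_mkord; move: (\sum_(k < m) _) (\sum_(k <- _) _) (perimeter _ _) (_ * _).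
lia.
Qed.

End Perimeter.

(** * Finite subgraphs of the covering graph closed under reductions *)

Lemma sum_fibers (J T : eqType) (g : J -> T) (s : seq J) (F : T -> nat) :
  \sum_(j <- s) F (g j) =
  \sum_(x <- undup (map g s)) F x * count (fun j => g j == x) s.
Proof.
have E j : j \in s -> F (g j) = \sum_(x <- undup (map g s) | g j == x) F x.
  move=> js; rewrite -big_filter (_ : filter _ _ = [:: g j]) ?big_seq1 //.
  rewrite (eq_filter (a2 := pred1 (g j))); last by move=> x; rewrite /= eq_sym.
  by rewrite filter_pred1_uniq ?undup_uniq // mem_undup map_f.
rewrite big_seq (eq_bigr _ E) -big_seq (exchange_big_dep xpredT) //=.
apply: eq_bigr => x _.
by rewrite -big_filter big_const_seq count_predT size_filter iter_addn_0.
Qed.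

Section Minimal.
Variables (X : complex) (x0 : vert X) (gens : seq (seq (dart X))) (w : weighting X).
Variables (Fs : seq (face X)).
Hypothesis gens_closed : forall g, g \in gens -> walk x0 g x0.
Hypothesis Fs_uniq : uniq Fs.
Hypothesis Fs_all : forall f, f \in Fs.

Local Notation cvert := (cvert x0 gens).
Local Notation act := (act x0 gens).
Local Notation actp := (actp x0 gens).
Local Notation edge_of := (edge_of x0 gens).
Local Notation ledges := (ledges x0 gens).
Local Notation valid_edges := (valid_edges x0 gens).
Local Notation cedge := (cedge X).
Local Notation edge_wt := (edge_wt w Fs).
Local Notation face_wt := (face_wt w).
Implicit Types (f : face X) (v : seq (dart X)) (S : seq cedge).

Section FaceLift.
Variables (f : face X) (i : 'I_(degm1 f).+1) (v : seq (dart X)).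
Hypothesis cv : cvert v.
Hypothesis ev : pend x0 v = dsrc (bd f i).

Definition lvert t := actp v (bdsub i t).
Definition ledge t : cedge := edge_of (lvert t) (bd f (i + inZp t)%R).

Lemma lvert_cvert t : cvert (lvert t) /\ pend x0 (lvert t) = dsrc (bd f (i + inZp t)%R).
Proof.
have wt : walk (pend x0 v) (bdsub i t) (dsrc (bd f (i + inZp t)%R)).
  by rewrite ev; apply: walk_bdsub.
by have [] := actp_rep gens_closed cv wt.
Qed.

Lemma lvert_deg : lvert (deg f) = v.
Proof.
apply: actp_loop => //; rewrite ev; first exact: walk_bdloop.
exact: homotopic_bdloop.
Qed.

Lemma ledges_bdsub m : ledges v (bdsub i m) = [seq ledge t | t <- iota 0 m].
Proof.
elim: m => // m IH; rewrite -addn1 bdsub_cat iotaD ledges_cat IH map_cat.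
by rewrite bdsub1.
Qed.

End FaceLift.

Lemma lvertD f (i : 'I_(degm1 f).+1) v a b :
  lvert i v (a + b) = lvert (i + inZp a)%R (lvert i v a) b.
Proof. by rewrite /lvert bdsub_cat actp_cat. Qed.

Lemma ledgeD f (i : 'I_(degm1 f).+1) v a b :
  ledge i v (a + b) = ledge (i + inZp a)%R (lvert i v a) b.
Proof. by rewrite /ledge lvertD inZpD addrA. Qed.

Lemma ledge_mod f (i : 'I_(degm1 f).+1) v t : cvert v -> pend x0 v = dsrc (bd f i) ->
  ledge i v (t %% deg f) = ledge i v t.
Proof.
move=> cv ev; rewrite [in RHS](divn_eq t (deg f)).
elim: (t %/ deg f) => // k IH.
by rewrite mulSn -addnA ledgeD inZp_deg addr0 lvert_deg.
Qed.

(** A lift of [f] to the covering space is determined by its corner 0. *)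
Definition face_in S f v : bool :=
  [&& cvert v, pend x0 v == dsrc (bd f 0%R)
    & all (mem S) (ledges v (bdsub (0%R : 'I_(degm1 f).+1) (deg f)))].

Definition ends S : seq (seq (dart X)) :=
  undup (flatten [seq [:: x.1; act x.1 (x.2, false)] | x <- S]).

Definition faces_at S f : nat := count (face_in S f) (ends S).

(** The perimeter of the full subcomplex with set of edges [S]: all the sides at its
    edges, less the sides present, each of which comes from one lift of a 2-cell in
    [S].  By [faces_leq_edges] the subtraction is never truncated. *)
Definition perim S : nat :=
  \sum_(x <- S) edge_wt x.2 - \sum_(f <- Fs) face_wt f * faces_at S f.

Lemma endsP S u : reflect (exists2 x, x \in S & u = x.1 \/ u = act x.1 (x.2, false))
  (u \in ends S).
Proof.
rewrite mem_undup; apply: (iffP flattenP) => [[_ /mapP [x xS ->]]|[x xS h]].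
  by rewrite !inE => /orP [/eqP|/eqP] ->; exists x => //; [left|right].
by eexists; [apply: map_f xS | rewrite !inE; case: h => ->; rewrite eqxx ?orbT].
Qed.

Lemma ends_sub S S' : {subset S <= S'} -> {subset ends S <= ends S'}.
Proof. by move=> SS' u /endsP [x /SS' xS h]; apply/endsP; exists x. Qed.

Lemma edge_of_ends S v d : cvert v -> dsrc d = pend x0 v -> edge_of v d \in S ->
  v \in ends S.
Proof.
move=> cv e xS; apply/endsP; exists (edge_of v d) => //.
rewrite {1 3}(edge_of_dart gens_closed cv e erefl).
by case: d.2; [right|left].
Qed.

Lemma face_in_ends S f v : face_in S f v -> v \in ends S.
Proof.
case/and3P => cv /eqP ev; rewrite /deg bdsubS /= => /andP [h _].
exact: edge_of_ends h.
Qed.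

(** A lift of [f] is determined by its edge number [r], so the lifts in [S] use different
    sides at the edges of [S]. *)
Lemma faces_leq_edges S : uniq S ->
  \sum_(f <- Fs) face_wt f * faces_at S f <= \sum_(x <- S) edge_wt x.2.
Proof.
move=> uS.
have -> : \sum_(f <- Fs) face_wt f * faces_at S f =
    \sum_(s <- all_sides Fs) wt w s * faces_at S (tag s).
  rewrite sum_all_sides; apply: eq_bigr => f _.
  by rewrite /face_wt big_distrl.
have -> : \sum_(x <- S) edge_wt x.2 =
    \sum_(s <- all_sides Fs) wt w s * count (fun x => side_edge s == x.2) S.
  rewrite (exchange_big_dep xpredT) //=; apply: eq_bigr => s _.
  by rewrite -big_filter big_const_seq count_predT size_filter iter_addn_0.
apply: leq_sum => -[f r] _; rewrite leq_mul2l; apply/orP; right.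
rewrite /faces_at -!size_filter /=; set A := filter _ _.
have Af v : v \in A -> [/\ cvert v, pend x0 v = dsrc (bd f 0%R) & face_in S f v].
  by rewrite mem_filter => /andP [h _]; case/and3P: (h) => ? /eqP.
rewrite -(size_map (fun v => ledge (0%R : 'I_(degm1 f).+1) v r)); apply: uniq_leq_size.
  rewrite map_inj_in_uniq ?filter_uniq ?undup_uniq // => v v' /Af [cv ev _] /Af [cv' ev' _] E.
  have [c1 p1] := lvert_cvert cv ev r; have [c2 p2] := lvert_cvert cv' ev' r.
  have {}E := edge_of_inj gens_closed c1 c2 (esym p1) (esym p2) E.
  have w0 : walk (dsrc (bd f 0%R)) (bdsub (0%R : 'I_(degm1 f).+1) r) (dsrc (bd f (0 + inZp r)%R)).
    exact: walk_bdsub.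
  have w1 := w0; have w2 := w0; rewrite -ev in w1; rewrite -ev' in w2.
  by rewrite -(actpK gens_closed cv w1) -(actpK gens_closed cv' w2) -/(lvert _ _ _) E.
move=> x /mapP [v /Af [cv ev /and3P [_ _ /allP h]] ->]; rewrite mem_filter.
apply/andP; split; first by rewrite /ledge edge_of2 add0r inZp_val.
by apply: h; rewrite ledges_bdsub // map_f // mem_iota /= add0n ltn_ord.
Qed.

Section Attach.
Variables (S : seq cedge) (f : face X) (i : 'I_(degm1 f).+1) (m : nat).
Variable (v : seq (dart X)).
Hypothesis uS : uniq S.
Hypothesis red : reducing w i m.
Hypothesis cv : cvert v.
Hypothesis ev : pend x0 v = dsrc (bd f i).
Hypothesis inS : all (mem S) (ledges v (bdsub i m)).
Hypothesis outS : ~~ all (mem S) (ledges v (bdsub i (deg f))).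

Let d := deg f.
Let n := exponent f.
Let per := period f.
Let e := ledge i v.
Let pt := lvert i v.
Definition new_edges := undup [seq x <- ledges v (bdsub i (deg f)) | x \notin S].
Let N := new_edges.
Definition attach := S ++ N.
Let S' := attach.

Let dE : n * per = d.
Proof.
have [W [u [_ E]]] := bd_power_exponent f.
have dvd : n %| d.
  by rewrite /d -size_bdpath E size_flatten /shape map_nseq sumn_nseq dvdn_mull.
by rewrite /per /period mulnC divnK.
Qed.

Lemma attach_uniq : uniq S'.
Proof.
rewrite cat_uniq uS undup_uniq andbT /=; apply/hasPn => x.
by rewrite mem_undup mem_filter => /andP [].
Qed.

Let e_attach t : e t \in S'.
Proof.
rewrite /e -ledge_mod // mem_cat; case: (boolP (ledge i v _ \in S)) => //= nS.
by rewrite mem_undup mem_filter nS ledges_bdsub // map_f // mem_iota ltn_mod.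
Qed.

(** The boundary circle of the lift at [v] may close up after fewer than [n] periods,
   when the subgroup has torsion.  Then the [n] copies of [f] in the packet have only
   [size D] distinct images, each of them hit [a] times, and every edge of the lift is
   hit at least [a] times; so the inequality for the packet, divided by [a], is an
   inequality for its image. *)
Let fixes (j : 'I_n) := pt (j * per) == v.
Let a := count fixes (enum 'I_n).

Let per_pt j t : pt (j * per + t) = lvert i (pt (j * per)) t.
Proof. by rewrite /pt lvertD /lvert bdsub_period. Qed.

Let per_e j t : e (j * per + t) = ledge i (pt (j * per)) t.
Proof.
by rewrite /e /ledge -/(pt _) per_pt inZpD addrA addrAC bd_period.
Qed.

Let pt_valid t : cvert (pt t) /\ pend x0 (pt t) = dsrc (bd f (i + inZp t)%R).
Proof. exact: lvert_cvert. Qed.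

Let pt_per_valid j : cvert (pt (j * per)) /\ pend x0 (pt (j * per)) = dsrc (bd f i).
Proof. by have [c ->] := pt_valid (j * per); rewrite bd_period. Qed.

Let pt_mod t : pt (t %% d) = pt t.
Proof.
rewrite [in RHS](divn_eq t d); elim: (t %/ d) => // k IH.
by rewrite mulSn -addnA /pt lvertD inZp_deg addr0 lvert_deg.
Qed.

Let lvert_inj u u' t : cvert u -> pend x0 u = dsrc (bd f i) ->
  cvert u' -> pend x0 u' = dsrc (bd f i) -> lvert i u t = lvert i u' t -> u = u'.
Proof.
move=> cu eu cu' eu' E; have w0 := walk_bdsub i t.
have w1 := w0; have w2 := w0; rewrite -eu in w1; rewrite -eu' in w2.
by rewrite -(actpK gens_closed cu w1) -(actpK gens_closed cu' w2) -/(lvert _ _ _) E.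
Qed.

Let turn (j : 'I_n) := j * per + (d - i).
Let corner (j : 'I_n) := pt (turn j).
Let D := undup [seq corner j | j <- enum 'I_n].

Let turn_corner j : (i + inZp (turn j))%R = (0 + inZp (j * per))%R :> 'I_(degm1 f).+1.
Proof.
rewrite /turn addnC inZpD addrA -{1}[i]inZp_val -inZpD subnKC ?inZp_deg //.
exact: ltnW.
Qed.

Let fiber_le j0 : count (fun j => corner j == corner j0) (enum 'I_n) <= a.
Proof.
have n0 : 0 < n by apply: exponent_gt0.
pose h (j : 'I_n) : 'I_n := Ordinal (ltn_pmod (j + (n - j0)) n0).
rewrite /a -!size_filter -(size_map h); apply: uniq_leq_size.
  rewrite map_inj_uniq; first by apply/filter_uniq/enum_uniq.
  move=> j j' /(congr1 val) /= /eqP.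
  by rewrite eqn_modDr !modn_small // => /eqP; apply: val_inj.
move=> x /mapP [j]; rewrite mem_filter => /andP [/eqP E _] ->.
rewrite mem_filter mem_enum andbT.
have [c1 e1] := pt_per_valid j; have [c2 e2] := pt_per_valid j0.
have {}E : pt (j * per) = pt (j0 * per).
  by apply: (lvert_inj (t := d - i)) => //; rewrite -!per_pt.
apply/eqP; rewrite /= muln_modl dE pt_mod mulnDl per_pt E -per_pt -mulnDl subnKC; last exact: ltnW.
by rewrite dE; apply: lvert_deg.
Qed.

Let exponent_le : n <= a * size D.
Proof.
have := sum_fibers corner (enum 'I_n) (fun=> 1).
rewrite sum1_size size_enum_ord => ->; rewrite -/D.
rewrite -sum1_size big_distrr /=; rewrite !big_seq; apply: leq_sum => x.
by rewrite mem_undup mul1n muln1 => /mapP [j _ ->]; apply: fiber_le.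
Qed.

Let T := [seq t <- iota 0 d | e t \notin S].

Let new_edgesE : N = undup (map e T).
Proof. by rewrite /N /new_edges ledges_bdsub // filter_map. Qed.

Let edge_fiber x : x \in N -> a <= count (fun t => e t == x) T.
Proof.
rewrite new_edgesE mem_undup => /mapP [t0]; rewrite mem_filter mem_iota add0n => /andP [et td] ->.
have d0 : 0 < d by [].
rewrite /a -!size_filter -(size_map (fun j : 'I_n => (j * per + t0) %% d)).
apply: uniq_leq_size.
  have per0 : 0 < per by rewrite lt0n; apply/eqP => p0; move: dE; rewrite p0 muln0.
  rewrite map_inj_uniq; first by apply/filter_uniq/enum_uniq.
  move=> j j' /eqP.
  rewrite eqn_modDr !modn_small; try by rewrite -dE ltn_pmul2r.
  by rewrite eqn_pmul2r // => /eqP /val_inj.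
move=> y /mapP [j]; rewrite mem_filter => /andP [/eqP fj _] ->.
have E : e ((j * per + t0) %% d) = e t0 by rewrite /e ledge_mod // -/e per_e fj.
by rewrite mem_filter E eqxx mem_filter E et mem_iota /= ltn_mod.
Qed.

Let new_edges_lt : \sum_(x <- N) edge_wt x.2 < size D * face_wt f.
Proof.
have [lem lt] := reducing_edge_wt Fs_uniq Fs_all red.
have h1 : a * \sum_(x <- N) edge_wt x.2 <= \sum_(t <- T) edge_wt (e t).2.
  rewrite (sum_fibers e T (fun x => edge_wt x.2)) -new_edgesE big_distrr /=.
  rewrite !big_seq; apply: leq_sum => x xN.
  by rewrite mulnC leq_mul2l edge_fiber ?orbT.
have h2 : \sum_(t <- T) edge_wt (e t).2 <=
    \sum_(k <- iota m (deg f - m)) edge_wt (bd f (i + inZp k)%R).1.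
  rewrite (eq_bigr (fun t => edge_wt (bd f (i + inZp t)%R).1)); last first.
    by move=> t _; rewrite /e /ledge edge_of2.
  apply: leq_sum_subset; first by rewrite filter_uniq ?iota_uniq.
  move=> t; rewrite mem_filter !mem_iota subnKC // add0n /= => /andP [et ->].
  rewrite andbT leqNgt; apply: contra et => tm.
  move/allP: inS; rewrite ledges_bdsub // => /(_ (e t)); apply.
  by rewrite map_f // mem_iota.
have h3 : n * face_wt f <= a * (size D * face_wt f).
  by rewrite mulnA leq_mul2r exponent_le orbT.
have : a * \sum_(x <- N) edge_wt x.2 < a * (size D * face_wt f).
  exact: leq_ltn_trans h1 (leq_ltn_trans h2 (leq_trans lt h3)).
by rewrite ltn_mul2l => /andP [].
Qed.

Let S_attach : {subset S <= S'}.
Proof. by move=> x xS; rewrite mem_cat xS. Qed.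

Let face_in_attach f' u : face_in S f' u -> face_in S' f' u.
Proof.
case/and3P => c1 e1 h; rewrite /face_in c1 e1 /=.
by apply: sub_all h => x; apply: S_attach.
Qed.

Let faces_at_le f' : faces_at S f' <= faces_at S' f'.
Proof.
rewrite /faces_at -!size_filter; apply: uniq_leq_size.
  by rewrite filter_uniq ?undup_uniq.
move=> u; rewrite !mem_filter => /andP [h uS0]; rewrite (face_in_attach h) /=.
exact: ends_sub S_attach _ uS0.
Qed.

Let corner_edges j : ledges (corner j) (bdsub (0%R : 'I_(degm1 f).+1) d) =
  [seq e (turn j + t) | t <- iota 0 d].
Proof.
have E : bdsub (0%R : 'I_(degm1 f).+1) d = bdsub (i + inZp (turn j))%R d.
  by rewrite turn_corner bdsub_period.
have [c1 e1] := pt_valid (turn j).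
rewrite E ledges_bdsub //; apply: eq_map => t.
by rewrite /e ledgeD.
Qed.

Let corner_face j : face_in S' f (corner j).
Proof.
have [c1 e1] := pt_valid (turn j).
rewrite /face_in c1 e1 turn_corner bd_period eqxx !andTb corner_edges.
by apply/allP => _ /mapP [t _ ->]; apply: e_attach.
Qed.

Let corner_new j : ~~ face_in S f (corner j).
Proof.
apply: contra outS => /and3P [_ _]; rewrite corner_edges => /allP h.
rewrite ledges_bdsub //; apply/allP => y /mapP [t]; rewrite mem_iota add0n => /andP [_ td] ->.
have d0 : 0 < d by [].
pose t' := (t + (d - turn j %% d)) %% d.
have E : (turn j + t') %% d = t.
  have lt : turn j %% d < d by rewrite ltn_mod.
  rewrite /t' modnDmr addnCA -modnDmr -[(turn j + _) %% d]modnDml subnKC; last exact: ltnW.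
  by rewrite modnn addn0 modn_small.
rewrite /= -[ledge i v t]/(e t) -E /e ledge_mod //.
apply: h; apply/mapP; exists t'; last by [].
by rewrite mem_iota add0n /t' ltn_mod.
Qed.

Let faces_at_lt : faces_at S f + size D <= faces_at S' f.
Proof.
rewrite /faces_at -!size_filter -size_cat; apply: uniq_leq_size.
  rewrite cat_uniq filter_uniq ?undup_uniq //= andbT; apply/hasPn => u.
  rewrite mem_undup => /mapP [j _ ->]; rewrite mem_filter negb_and.
  by rewrite corner_new.
move=> u; rewrite mem_cat => /orP [|].
  rewrite !mem_filter => /andP [h uS0]; rewrite (face_in_attach h) /=.
  exact: ends_sub S_attach _ uS0.
rewrite mem_undup => /mapP [j _ ->]; rewrite mem_filter corner_face /=.
exact: face_in_ends (corner_face j).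
Qed.

Lemma attach_valid : valid_edges S -> valid_edges S'.
Proof.
move=> vS x; rewrite mem_cat => /orP [/vS //|].
rewrite mem_undup mem_filter => /andP [_].
have wl : walk (pend x0 v) (bdsub i (deg f)) (dsrc (bd f i)) by rewrite ev; apply: walk_bdloop.
exact: (ledges_valid gens_closed cv wl).
Qed.

(** The new edges weigh less than the sides of the new 2-cells. *)
Lemma attach_perim : perim S' < perim S.
Proof.
have h1 := faces_leq_edges attach_uniq; have h2 := new_edges_lt.
have h3 : \sum_(f' <- Fs) face_wt f' * faces_at S f' + size D * face_wt f <=
    \sum_(f' <- Fs) face_wt f' * faces_at S' f'.
  rewrite !(big_rem f (Fs_all f)) /= addnAC leq_add //.
    by rewrite [size D * _]mulnC -mulnDr leq_mul2l faces_at_lt orbT.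
  by apply: leq_sum => f' _; rewrite leq_mul2l faces_at_le orbT.
rewrite /perim; move: h1 h2 h3; rewrite -/S' {1 4}/S' /attach big_cat /=.
move: (\sum_(x <- S) _) (\sum_(x <- N) _) (size D * _) => A B C.
move: (\sum_(f' <- Fs) face_wt f' * faces_at S f') (\sum_(f' <- Fs) _) => E F.
lia.
Qed.

End Attach.

Definition closed_edges S : Prop := forall f (i : 'I_(degm1 f).+1) m v,
  reducing w i m -> cvert v -> pend x0 v = dsrc (bd f i) ->
  all (mem S) (ledges v (bdsub i m)) -> all (mem S) (ledges v (bdsub i (deg f))).

(** Perimeters are natural numbers, so attaching lifts must come to an end. *)
Theorem closed_extension S0 : valid_edges S0 ->
  exists S, [/\ valid_edges S, {subset S0 <= S} & closed_edges S].
Proof.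
move=> vS0.
have H k S : perim S < k -> uniq S -> valid_edges S ->
    exists S', [/\ valid_edges S', {subset S <= S'} & closed_edges S'].
  elim: k S => // k IH S pk uS vS.
  have [cl|ncl] := pselect (closed_edges S); first by exists S; split.
  have [f [i [m [v [red cv ev inS outS]]]]] : exists f (i : 'I_(degm1 f).+1) m v,
      [/\ reducing w i m, cvert v, pend x0 v = dsrc (bd f i),
        all (mem S) (ledges v (bdsub i m)) & ~~ all (mem S) (ledges v (bdsub i (deg f)))].
    apply: contrapT => h; apply: ncl => f i m v red cv ev inS.
    by apply: contrapT => /negP outS; apply: h; exists f, i, m, v; split.
  have lt := attach_perim uS red cv ev inS outS.
  have [|||S' [v' sub cl]] := IH (attach S i v).
  - exact: leq_trans lt pk.
  - exact: attach_uniq.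
  - exact: attach_valid.
  by exists S'; split=> // x xS; apply: sub; rewrite mem_cat xS.
have [|S [v' sub cl]] := H (perim (undup S0)).+1 (undup S0) (ltnSn _) (undup_uniq _).
  by move=> x; rewrite mem_undup; apply: vS0.
by exists S; split=> // x xS; apply: sub; rewrite mem_undup.
Qed.

End Minimal.

(** * Existence of certificates *)

Lemma lookup_fun (K V : eqType) (L : seq (K * V)) k v : (k, v) \in L ->
  (forall v', (k, v') \in L -> v' = v) -> lookup L k = Some v.
Proof.
elim: L => //= -[k1 v1] L IH kL H /=; case: eqP => [E|ne].
  by congr Some; apply: H; rewrite -E inE eqxx.
apply: IH => [|v' h]; last by apply: H; rewrite inE h orbT.
by move: kL; rewrite inE => /orP [/eqP [e _]|//]; case: ne.
Qed.

Section Certificate.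
Variables (X : complex) (x0 : vert X) (gens : seq (seq (dart X))) (w : weighting X).
Variables (num : edge X -> nat) (Es : seq (edge X)) (Fs : seq (face X)).
Hypothesis gens_closed : forall g, g \in gens -> walk x0 g x0.
Hypothesis num_inj : injective num.
Hypothesis Es_all : forall e, e \in Es.
Hypothesis Fs_all : forall f, f \in Fs.

Local Notation cvert := (cvert x0 gens).
Local Notation act := (act x0 gens).
Local Notation actp := (actp x0 gens).
Local Notation edge_of := (edge_of x0 gens).
Local Notation ledges := (ledges x0 gens).
Local Notation cedge := (cedge X).
Local Notation H := (subgroup_gen x0 gens).
Local Notation th := (tnth (in_tuple gens)).
Local Notation k := (size gens).
Local Notation code := (code_darts num).
Local Notation Rl := (trivial_codes num Es Fs).
Local Notation pend := (pend x0).
Implicit Types (v : seq (dart X)) (d : dart X).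

(** Both directions are needed at once for the induction, on account of symmetry; the
    same triple undoes a step because [r] is not empty. *)
Lemma derivation_homotopic (u u' : vert X) s t : homotopic u u' s t ->
  (exists D, foldl (insdel_step Rl) (code s) D = code t) /\
  (exists D, foldl (insdel_step Rl) (code t) D = code s).
Proof.
elim=> {s t} [s t st|s|s t _ [h1 h2]|s t z _ [[D1 h1] [D2 h2]] _ [[D3 h3] [D4 h4]]] //;
  last first.
- by split; [exists (D1 ++ D3); rewrite foldl_cat h1 h3 |
  exists (D4 ++ D2); rewrite foldl_cat h4 h2].
- by split; exists [::].
have [s1 [r [s2 [-> -> rR]]]] : exists s1 r s2,
    [/\ s = s1 ++ r ++ s2, t = s1 ++ s2 & code r \in Rl].
  case: st => s1 => [d|f] s2 _; [exists s1, [:: d; dflip d], s2 | exists s1, (bdpath f), s2].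
    by split=> //; apply: trivial_codes_back.
  by split=> //; apply: trivial_codes_face.
have r0 : code r != [::].
  case/trivial_codesP: rR => [[d ->] //|[f ->]].
  by rewrite /code_darts bdpathE /deg bdsubS.
pose D := [:: (code s1, (code r, code s2))].
split; exists D; rewrite /D /= /insdel_step /= rR.
  by rewrite /code_darts !map_cat eqxx.
rewrite /code_darts !map_cat; case: eqP => [E|_]; last by rewrite eqxx.
move/(congr1 size): E; rewrite !size_cat => /eqP; rewrite eqn_add2l.
by rewrite -{1}[size (map _ s2)]add0n eqn_add2r eq_sym size_eq0 (negbTE r0).
Qed.

Variable S : seq cedge.
Hypothesis S_valid : valid_edges x0 gens S.
Hypothesis S_closed : closed_edges x0 gens w S.
Hypothesis S_gens : forall g, g \in gens -> {subset ledges [::] g <= S}.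

Definition evaln (a : seq nat) := eval_word th (decode_word k a).

Lemma evaln_walk a : walk x0 (evaln a) x0.
Proof. exact: eval_walk. Qed.

Lemma evaln_cat a b : evaln (a ++ b) = evaln a ++ evaln b.
Proof. by rewrite /evaln decode_word_cat eval_word_cat. Qed.

Lemma evaln_inv a : evaln (inv_word a) = inv_path (evaln a).
Proof. by rewrite /evaln decode_word_inv eval_word_inv. Qed.

Definition letters_ok (a : seq nat) : bool := all (fun x => x./2 < k) a.

Lemma letters_ok_inv a : letters_ok a -> letters_ok (inv_word a).
Proof.
by rewrite /letters_ok /inv_word all_rev all_map => /sub_all; apply => x /=; rewrite half_flip.
Qed.

Definition cend (x : cedge) := act x.1 (x.2, false).

Lemma cend_cvert x : x \in S ->
  [/\ cvert x.1, dsrc (x.2, false) = pend x.1, cvert (cend x) & pend (cend x) = etgt x.2].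
Proof.
move=> /S_valid [c1 e1]; have e1' : dsrc (x.2, false) = pend x.1 by [].
by have [c2 e2] := act_cvert gens_closed c1 e1'; split.
Qed.

Lemma cvert_walk v : cvert v -> walk x0 v (pend v).
Proof. by case/andP. Qed.

(** The two paths to the end of an edge, along the edge and by the representative, are
    in the same class, hence differ by an element of the subgroup. *)
Fact label_exists x : exists a : word k, x \in S ->
  homotopic x0 x0 (x.1 ++ [:: (x.2, false)] ++ inv_path (cend x)) (eval_word th a).
Proof.
have [xS|nxS] := boolP (x \in S); last by exists [::].
have [c1 e1 c2 e2] := cend_cvert xS.
have gd : good x0 (rcons x.1 (x.2, false)).
  rewrite -cats1; have ww : walk x0 (x.1 ++ [:: (x.2, false)]) (etgt x.2).
    by apply: walk_catI (cvert_walk c1) _; rewrite /= -e1 !eqxx.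
  by have [] := good_pend ww.
have [_ _ _ [_ [a ha]]] := rep_same gens gd.
by exists a => _; move: ha; rewrite cat_rcons.
Qed.

Definition label (x : cedge) : seq nat :=
  [seq code_letter (nat_of_ord y.1, y.2) | y <- projT1 (cid (label_exists x))].

Lemma label_decode x : decode_word k (label x) = projT1 (cid (label_exists x)).
Proof.
rewrite /label; elim: (projT1 _) => //= -[i b] a IH.
by rewrite decode_code_letter /= IH.
Qed.

Lemma labelP x : x \in S ->
  homotopic x0 x0 (x.1 ++ [:: (x.2, false)] ++ inv_path (cend x)) (evaln (label x)).
Proof. by rewrite /evaln label_decode; case: cid. Qed.

Lemma label_ok x : letters_ok (label x).
Proof.
rewrite /letters_ok /label all_map; apply/allP => -[i b] _ /=.
by rewrite /code_letter /= addnC half_bit_double.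
Qed.

(** The base vertex comes first, so that its number is 0. *)
Definition states : seq (seq (dart X)) := [::] :: ends x0 gens S.

Definition step v d : option (seq (dart X) * seq nat) :=
  if [&& cvert v, pend v == dsrc d & edge_of v d \in S] then
    Some (act v d, if d.2 then inv_word (label (edge_of v d)) else label (edge_of v d))
  else None.

Definition num_state v : nat := index v states.
Definition num_out (y : seq (dart X) * seq nat) : nat * seq nat := (num_state y.1, y.2).

Definition cert_transducer : transducer :=
  flatten [seq [:: ((num_state x.1, code_dart num (x.2, false)), (num_state (cend x), label x));
     ((num_state (cend x), code_dart num (x.2, true)), (num_state x.1, inv_word (label x)))]
   | x <- S].

Lemma states_cvert v : v \in states -> cvert v.
Proof.
rewrite inE => /orP [/eqP ->|/endsP [x xS]]; first exact: cvert_nil.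
by have [c1 _ c2 _] := cend_cvert xS; case=> ->.
Qed.

Lemma num_state_inj v v' : v \in states -> v' \in states ->
  num_state v = num_state v' -> v = v'.
Proof.
by move=> h h' E; rewrite -(nth_index [::] h) -/(num_state v) E /num_state nth_index.
Qed.

Lemma edge_cend x : x \in S -> edge_of (cend x) (x.2, true) = x.
Proof.
move=> xS; have [c1 e1 _ _] := cend_cvert xS.
by rewrite /edge_of /= -[(x.2, true)]/(dflip (x.2, false)) actK // -surjective_pairing.
Qed.

Lemma step_states v d y : step v d = Some y -> v \in states /\ y.1 \in states.
Proof.
rewrite /step; case: ifP => // /and3P [cv /eqP e xS] [<-] /=.
have [ca ea] := act_cvert gens_closed cv (esym e).
rewrite !inE (edge_of_ends gens_closed cv (esym e) xS).
rewrite (@edge_of_ends _ _ _ gens_closed _ _ (dflip d)) ?orbT //.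
by rewrite edge_of_flip.
Qed.

Lemma cert_transducerP e : e \in cert_transducer <->
  exists v d y, [/\ v \in states, step v d = Some y &
    e = ((num_state v, code_dart num d), num_out y)].
Proof.
split.
  move=> /flattenP [_ /mapP [x xS ->]]; have [c1 e1 c2 e2] := cend_cvert xS.
  have E1 : edge_of x.1 (x.2, false) = x by rewrite /edge_of /= -surjective_pairing.
  have s1 : step x.1 (x.2, false) = Some (cend x, label x).
    by rewrite /step c1 e1 eqxx E1 xS.
  have s2 : step (cend x) (x.2, true) = Some (x.1, inv_word (label x)).
    rewrite /step c2 e2 /dsrc /= eqxx edge_cend // xS.
    by rewrite -[(x.2, true)]/(dflip (x.2, false)) actK.
  rewrite !inE => /orP [/eqP ->|/eqP ->].
    by exists x.1, (x.2, false), (cend x, label x); split=> //; have [] := step_states s1.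
  exists (cend x), (x.2, true), (x.1, inv_word (label x)); split=> //.
  by have [] := step_states s2.
move=> [v [d [y [vs sv ->]]]].
move: sv; rewrite /step; case: ifP => // /and3P [cv /eqP e0 xS] [<-].
apply/flattenP; eexists; first by apply: map_f xS.
rewrite edge_of2; case: d e0 xS => ed [] e0 xS; rewrite /= !inE; apply/orP; [right|left].
  rewrite /cend /= -[(ed, false)]/(dflip (ed, true)) actK //.
  by rewrite /num_out /= eqxx.
Qed.

Lemma trans_step v d : v \in states ->
  trans cert_transducer (num_state v) (code_dart num d) = omap num_out (step v d).
Proof.
move=> vs; have U z : ((num_state v, code_dart num d), z) \in cert_transducer ->
    Some z = omap num_out (step v d).
  move=> /cert_transducerP [v' [d' [y [vs' sv [E1 E2 ->]]]]].
  by rewrite (num_state_inj vs vs' E1) (code_dart_inj num_inj E2) sv.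
case E: (step v d) => [y|] /=.
  apply: lookup_fun; first by apply/cert_transducerP; exists v, d, y.
  by move=> z /U; rewrite E => -[].
case E': (trans _ _ _) => [z|] //.
by have := U _ (lookup_in E'); rewrite E.
Qed.

Lemma trun_step v s : v \in states ->
  trun (trans cert_transducer) (num_state v) (code s) = omap num_out (trun step v s).
Proof.
elim: s v => //= d s IH v vs; rewrite !trun_cons trans_step //.
case E: (step v d) => [y|] //=; have [_ ys] := step_states E.
by rewrite IH //; case: (trun _ _ _).
Qed.

Lemma step_homotopic v d y : step v d = Some y ->
  homotopic x0 x0 (v ++ [:: d] ++ inv_path y.1) (evaln y.2).
Proof.
rewrite /step; case: ifP => // /and3P [cv /eqP e xS] [<-] /=.
have := labelP xS; rewrite /cend edge_of2; case: d e xS => ed [] e xS /=.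
  have -> : act (act v (ed, true)) (ed, false) = v.
    by rewrite -[(ed, false)]/(dflip (ed, true)) actK.
  move=> /homotopic_inv_path; rewrite evaln_inv.
  by rewrite inv_path_cat inv_path_cons -cats1 inv_pathK -catA.
by [].
Qed.

Lemma trun_homotopic v s y : cvert v -> trun step v s = Some y ->
  [/\ y.1 = actp v s, cvert y.1, walk (pend v) s (pend y.1), all (mem S) (ledges v s) &
    homotopic x0 x0 (v ++ s ++ inv_path y.1) (evaln y.2) /\ letters_ok y.2].
Proof.
elim: s v y => [|d s IH] v y cv.
  case=> <- /=; split=> //.
  by split=> //; apply: homotopic_inv (cvert_walk cv).
rewrite trun_cons; case E: (step v d) => [y1|] //=; have h1 := step_homotopic E.
move: E; rewrite /step; case: ifP => // /and3P [_ /eqP e xS] [E1].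
have [ca ea] := act_cvert gens_closed cv (esym e).
have y1E : y1.1 = act v d by rewrite -E1.
have ok1 : letters_ok y1.2.
  by rewrite -E1 /=; case: d.2; rewrite ?letters_ok_inv ?label_ok.
rewrite y1E in h1 *; case E2: (trun _ _ _) => [y2|] //= [<-] /=.
have [a2 c2 w2 l2 [h2 ok2]] := IH _ _ ca E2; rewrite ea in w2.
rewrite e eqxx xS w2; split=> //; split; last by rewrite /letters_ok all_cat; apply/andP.
have wd : walk (pend v) [:: d] (dtgt d) by rewrite /= e !eqxx.
have wa := cvert_walk ca; rewrite ea in wa.
have w2i := walk_inv (cvert_walk c2).
rewrite evaln_cat; apply: homotopic_trans (homotopic_cat (evaln_walk _) _ h1 h2); last first.
  exact: walk_catI wa (walk_catI w2 w2i).
rewrite -!catA; apply: homotopic_catl (cvert_walk cv) _.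
rewrite -cat1s; apply: homotopic_catl wd _.
rewrite catA -[X in homotopic _ _ X]cat0s; apply: homotopic_catr (walk_catI w2 w2i) _.
exact/homotopic_sym/(homotopic_invl wa).
Qed.

Lemma trun_defined v s z : cvert v -> walk (pend v) s z -> all (mem S) (ledges v s) ->
  exists a, trun step v s = Some (actp v s, a).
Proof.
elim: s v => [|d s IH] v cv; first by exists [::].
rewrite trun_cons => /andP [/eqP e ws] /= /andP [xS l].
have [ca ea] := act_cvert gens_closed cv e.
rewrite -ea in ws; have [a ha] := IH _ ca ws l.
by rewrite /step cv -e eqxx xS /= ha /=; eexists.
Qed.

Local Notation Fl := (face_codes num Fs).
Local Notation Tl := (reducing_pairs num w Fs).
Local Notation rels := (cert_relators Fl (map code gens) cert_transducer).

Lemma trun_gen g : g \in gens -> exists a,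
  trun (trans cert_transducer) 0 (code g) = Some (0, a) /\
  homotopic x0 x0 (evaln a) g /\ letters_ok a.
Proof.
move=> gin; have s0 : [::] \in states by rewrite inE.
have wg := gens_closed gin; have cn := cvert_nil x0 gens.
have wg0 : walk (pend [::]) g x0 by [].
have [|a ha] := trun_defined cn wg0.
  by apply/allP => x; apply: S_gens.
have [_ _ _ _ [h ok]] := trun_homotopic cn ha.
have E : actp [::] g = [::].
  have [-> _ _] := actp_rep gens_closed cn wg0.
  by rewrite cat0s -(rep_eq gens_closed (same_sub (sub_generator gens_closed gin))) rep_nil.
exists a; have := trun_step g s0; rewrite ha /= E => ->; split=> //; split=> //.
by move: h; rewrite /= E /= cats0 => /homotopic_sym.
Qed.

Lemma face_relator_run v f y : v \in states ->
  trun (trans cert_transducer) (num_state v) (code (bdpath f)) = Some y ->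
  y.1 = num_state v -> homotopic x0 x0 (evaln y.2) [::] /\ letters_ok y.2.
Proof.
move=> vs; rewrite trun_step //; case E: (trun _ _ _) => [z|] //= [<-] /= Ez.
have cv := states_cvert vs; have [zE cz wz _ [h ok]] := trun_homotopic cv E.
split=> //; apply: homotopic_trans (homotopic_sym h) _.
have pv : pend v = dsrc (bd f 0%R).
  by move: wz; rewrite bdpathE /deg bdsubS => /andP [/eqP].
have zv : z.1 = v.
  rewrite zE bdpathE; apply: actp_loop => //; rewrite pv; first exact: walk_bdloop.
  exact: homotopic_bdloop.
have wl : walk (pend v) [::] (pend v) by rewrite /= eqxx.
apply: homotopic_trans (homotopic_inv (cvert_walk cv)).
rewrite zv; apply: homotopic_catl (cvert_walk cv) _; rewrite -[X in homotopic _ _ _ X]cat0s.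
apply: homotopic_catr (walk_inv (cvert_walk cv)) _.
by rewrite pv bdpathE; apply: homotopic_bdloop.
Qed.

(** By [trun_homotopic], a relator evaluates to the boundary of a 2-cell conjugated by the
    path that represents a state, or to a generator followed by its inverse. *)
Lemma cert_relatorsP r : r \in rels ->
  homotopic x0 x0 (evaln r) [::] /\ letters_ok r.
Proof.
rewrite mem_cat => /orP [/mapP [j]|].
  rewrite mem_iota size_map /= add0n => jk ->; rewrite (nth_map [::]) //.
  have gin : nth [::] gens j \in gens by apply: mem_nth.
  have [a [-> [h ok]]] := trun_gen gin.
  split; last first.
    by rewrite /letters_ok all_cat [all _ a]ok /= half_flip doubleK jk.
  rewrite evaln_cat.
  have -> : evaln [:: flip_letter j.*2] = inv_path (nth [::] gens j).
    have D : decode_letter k (flip_letter j.*2) = Some (Ordinal jk, true).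
      rewrite -(decode_code_letter (Ordinal jk) true) -[j.*2]addn0.
      by rewrite -[j.*2 + 0]/(code_letter (j, false)) flip_code_letter.
    by rewrite /evaln /= D /eval_word /= cats0 (tnth_nth [::]).
  apply: homotopic_trans (homotopic_inv (gens_closed gin)).
  exact: homotopic_catr (walk_inv (gens_closed gin)) h.
move=> /flattenP [_ /mapP [e ein ->]] /flattenP [_ /mapP [c /mapP [f _ ->] ->]].
have [v [d [y [vs _ ->]]]] := (cert_transducerP e).1 ein.
rewrite /=; case E: (trun _ _ _) => [z|] //; case: eqP => // zv.
by rewrite inE => /eqP ->; exact: (face_relator_run vs E zv).
Qed.

Lemma derivations_exist (rs : seq (seq nat)) :
  (forall r, r \in rs -> homotopic x0 x0 (evaln r) [::]) ->
  exists E : seq derivation, forall r, r \in rs ->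
    has (fun D => foldl (insdel_step Rl) (eval_nword (map code gens) r) D == [::]) E.
Proof.
elim: rs => [|r rs IH] h; first by exists [::].
have [|E HE] := IH; first by move=> r' r'in; apply: h; rewrite inE r'in orbT.
have [[D HD] _] := derivation_homotopic (h r (mem_head _ _)).
exists (D :: E) => r'; rewrite inE /= => /orP [/eqP ->|/HE ->]; last by rewrite orbT.
by rewrite code_darts_eval // HD eqxx.
Qed.

Lemma closed_edges_certificate : exists c, check Tl Fl Rl (map code gens, c).
Proof.
have [E HE] := derivations_exist (fun r rin => (cert_relatorsP rin).1).
exists (cert_transducer, E); apply/and5P; split.
- apply/allP => e /cert_transducerP [v [d [y [vs sv ->]]]] /=.
  have [_ ys] := step_states sv.
  rewrite -code_dart_flip -[lookup _ _]/(trans _ _ _) trans_step //.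
  move: sv; rewrite /step; case: ifP => // /and3P [cv /eqP e0 xS] [<-] /=.
  have [ca ea] := act_cvert gens_closed cv (esym e0).
  rewrite ca ea eqxx edge_of_flip // xS /= actK // /num_out /=.
  by case: d.2; rewrite //= inv_wordK.
- apply/allP => e /cert_transducerP [v [d [y [vs _ ->]]]]; apply/allP => t.
  move=> /reducing_pairsP [f [i [m [red m0 ->]]]].
  rewrite [X in trun _ X]/= [(_, _).1]/= [(_, _).2]/= !trun_step //.
  case E1: (trun _ _ (bdsub i m)) => [z|] //=.
  have cv := states_cvert vs; have [zE cz wz l _] := trun_homotopic cv E1.
  have pv : pend v = dsrc (bd f i).
    by case: m m0 wz {red zE l E1} => // m _; rewrite bdsubS => /andP [/eqP].
  have wl : walk (pend v) (bdsub i (deg f)) (dsrc (bd f i)) by rewrite pv; apply: walk_bdloop.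
  have [a ha] := trun_defined cv wl (S_closed red cv pv l).
  have loop : actp v (bdsub i (deg f)) = v.
    by apply: actp_loop => //; rewrite pv; [apply: walk_bdloop | apply: homotopic_bdloop].
  by rewrite loop in ha; rewrite ha /=.
- by apply/allP => _ /mapP [g gin ->]; have [a [-> _]] := trun_gen gin.
- by apply/allP => r /cert_relatorsP [_]; rewrite size_map.
- by apply/allP => r /HE.
Qed.

End Certificate.

Lemma finite_enum (T : choiceType) : finite_set [set: T] ->
  exists s : seq T, uniq s /\ forall x, x \in s.
Proof.
move=> /finite_seqP [s E]; exists (undup s); rewrite undup_uniq; split=> // x.
by rewrite mem_undup; have : [set` s]%classic x by rewrite -E.
Qed.

Lemma certificate_exists (X : complex) (x0 : vert X) (gens : seq (seq (dart X)))
    (w : weighting X) (num : edge X -> nat) (Es : seq (edge X)) (Fs : seq (face X)) :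
  (forall g, g \in gens -> walk x0 g x0) -> injective num ->
  (forall e, e \in Es) -> uniq Fs -> (forall f, f \in Fs) ->
  exists c, check (reducing_pairs num w Fs) (face_codes num Fs) (trivial_codes num Es Fs)
    (map (code_darts num) gens, c).
Proof.
move=> gc ni Ea Fu Fa.
pose S0 := flatten [seq ledges x0 gens [::] g | g <- gens].
have vS0 : valid_edges x0 gens S0.
  move=> x /flattenP [_ /mapP [g gin ->]].
  exact: (ledges_valid gc (cvert_nil x0 gens) (gc g gin)).
have [S [vS sub cl]] := closed_extension w gc Fu Fa vS0.
apply: (closed_edges_certificate gc ni Ea Fa vS cl) => g gin x xin; apply: sub.
by apply/flattenP; eexists; [apply: map_f gin | exact: xin].
Qed.

Unset Implicit Arguments.

Theorem theorem6p1 (X : complex) (w : weighting X) (x0 : vert X)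
    (num : edge X -> nat) :
  connected X -> compact_complex X -> reduction_hypothesis w -> injective num ->
  exists p : recfun,
    forall gens : seq (seq (dart X)), (forall g, g \in gens -> walk x0 g x0) ->
      exists P : fin_pres,
        reval p [:: code_gens num gens] (code_pres P) /\
        presents x0 P (subgroup_gen x0 gens).
Proof.
move=> conn [_ finE finF] RH ni.
have [Es [_ Ea]] := finite_enum finE; have [Fs [Fu Fa]] := finite_enum finF.
have [p Hp] := certificate_search (reducing_pairs num w Fs) (face_codes num Fs)
  (trivial_codes num Es Fs).
exists p => gens gc.
have [c [ok r]] := Hp _ (certificate_exists w gc ni Ea Fu Fa).
have [pres codeE] := certificate_sound Fa ni conn RH gc ok.
eexists; split; last exact: pres.
rewrite codeE; move: r; rewrite size_map.
have E : code_gens num gens = @enc (seq (seq nat)) _ (map (code_darts num) gens).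
  rewrite /code_gens -[RHS]/(CodeSeq.code (map (@enc (seq nat) _) _)) -map_comp.
  by congr CodeSeq.code; apply: eq_map => s /=; rewrite map_id.
by rewrite E.
Qed.
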